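(* Let $F^m=(M,M',F)$ be a Finsler manifold, $HM'$ a nonlinear connection on $M'$ with associate almost complex structure $J$, and $S,T$ two skew-symmetric Finsler tensor fields of type $(1,2)$ on $F^m$. Let $\mathcal{D}$ be the natural almost complex linear connection associated to the $(HM',S,T)$-Cartan connection, with torsion $T^{\mathcal{D}}$, and let $G$ be the Sasaki metric on $M'$. If $T^{\mathcal{D}}=0$, then: 1) $F^m=(M,M',F)$ has zero flag curvature; 2) $J$ is integrable; 3) $\nabla' J=0$, where $\nabla'$ is the Levi-Civita connection of $G$; 4) $(M',J,G)$ is Kählerian.
   Context: Let $M$ be a real $m$-dimensional smooth manifold, $\pi:TM\to M$ its tangent bundle with zero section $\theta$, and $M'\subset TM$ a nonempty open submanifold with $\pi(M')=M$ and $\theta(M)\cap M'=\varnothing$, with induced local coordinates $(x^i,y^i)$. A Finsler manifold $F^m=(M,M',F)$ is given by a positive smooth function $F$ on $M'$ such that $F^{\ast}=F^2$ satisfies $F^{\ast}(x,ky)=k^2F^{\ast}(x,y)$ for $k>0$ (whenever both sides are defined) and $g_{ij}=\frac12\frac{\partial^2F^{\ast}}{\partial y^i\partial y^j}$ is positive definite at each point. Flag curvature has its usual meaning in Finsler geometry. $VM'=\ker(\pi_{\ast}|_{TM'})$ is the vertical vector bundle, locally spanned by $\frac{\partial}{\partial y^i}$; $g$ denotes the metric on $VM'$ with $g(\frac{\partial}{\partial y^i},\frac{\partial}{\partial y^j})=g_{ij}$. A nonlinear connection is a distribution $HM'$ with $TM'=HM'\oplus VM'$; it is locally spanned by $\frac{\delta}{\delta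 x^i}=\frac{\partial}{\partial x^i}-N^j_i(x,y)\frac{\partial}{\partial y^j}$. $h$ and $v$ are the projections of $TM'$ onto $HM'$ and $VM'$. The associate almost complex structure to $HM'$ is the bundle map $J:TM'\to TM'$ with $J(\frac{\delta}{\delta x^i})=-\frac{\partial}{\partial y^i}$, $J(\frac{\partial}{\partial y^i})=\frac{\delta}{\delta x^i}$. A skew-symmetric Finsler tensor field of type $(1,2)$ is a skew-symmetric $C^\infty(M')$-bilinear map $\Gamma(VM')\times\Gamma(VM')\to\Gamma(VM')$. For a linear connection $\nabla$ on $VM'$ (covariant derivative of vertical sections along arbitrary $X\in\Gamma(TM')$), the natural almost complex linear connection associated to $(HM',\nabla)$ is the linear connection on $M'$ given by $\mathcal{D}_XY=\nabla_XvY-J\nabla_XJhY$ for $X,Y\in\Gamma(TM')$, with torsion $T^{\mathcal{D}}(X,Y)=\mathcal{D}_XY-\mathcal{D}_YX-[X,Y]$. The $(HM',S,T)$-Cartan connection is the pair $(HM',\nabla)$, where $\nabla$ is the unique linear connection on $VM'$ such that $\nabla_Xg=0$ for all $X\in\Gamma(TM')$ and, for all $X,Y\in\Gamma(TM')$, $T^{\mathcal{D}}(vX,vY)=S(vX,vY)$ and $hT^{\mathcal{D}}(hX,hY)=J\,T(JhX,JhY)$. The Sasaki metric is $G=g_{ij}(x,y)dx^idx^j+g_{ij}(x,y)\delta y^i\delta y^j$ with $\delta y^i=dy^i+N^i_j(x,y)dx^j$; that is, $G(\frac{\delta}{\delta x^i},\frac{\delta}{\delta x^j})=G(\frac{\partial}{\partial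 y^i},\frac{\partial}{\partial y^j})=g_{ij}$ and $G(\frac{\delta}{\delta x^i},\frac{\partial}{\partial y^j})=0$. *)

(* Defs.v *)
From mathcomp Require Import all_boot all_order all_algebra.
From mathcomp Require Import all_classical all_reals all_analysis.

Set Implicit Arguments.
Unset Strict Implicit.
Unset Printing Implicit Defensive.

Import Order.TTheory GRing.Theory Num.Theory.
Import numFieldNormedType.Exports.

Local Open Scope classical_set_scope.
Local Open Scope ring_scope.

(** * Smooth maps on open sets of a normed space *)

(* Being [k] times differentiable for every [k] is the same as being of class
   C^infinity. The definition is only meant for open [U]. *)
Fixpoint diffn (R : realType) (V W : normedModType R) (k : nat) (U : set V)
    (f : V -> W) : Prop :=
  if k is k'.+1 then
    (forall x, U x -> differentiable f x) /\
    (forall v, diffn k' U (fun x => 'D_v f x))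
  else True.

Definition smooth_on (R : realType) (V W : normedModType R) (U : set V)
    (f : V -> W) : Prop :=
  forall k, diffn k U f.

(** * Manifolds

    [charts V T] is the bare data of a family of charts of [T] with values in
    [V]; only the base manifold carries explicit axioms, the charts of (open
    subsets of) its tangent bundle being derived from its own.  All notions
    below are expressed through every chart of the family. *)

Record charts (R : realType) (V : normedModType R) (T : Type) := Charts {
  idx : Type;
  chart_dom : idx -> set T;
  chart_coord : idx -> T -> V;
  chart_at : T -> idx (* a preferred chart around each point *)
}.

Section Charts.
Context {R : realType} {V : normedModType R} {T : Type} (A : charts V T).

Definition img (a : idx A) : set V := chart_coord a @` chart_dom a.

(* The local expression [f \o chart_coord a ^-1] of [f], extended by 0 outside
   [img a]. *)
Definition rep {W : normedModType R} (a : idx A) (f : T -> W) : V -> W :=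
  fun x => xget 0 [set w | exists p, [/\ chart_dom a p, chart_coord a p = x & w = f p]].

Definition smooth_fun {W : normedModType R} (f : T -> W) : Prop :=
  forall a, smooth_on (img a) (rep a f).

(* A tangent vector at [p] is the family of its components in all the charts
   around [p], related by the differentials of the coordinate changes (and
   set to 0 in the charts which do not contain [p]).  Families of components
   are added and scaled pointwise. *)
Definition fam : Type := idx A -> V.

Definition tangent (p : T) : set fam :=
  [set v : fam | (forall a, ~ chart_dom a p -> v a = 0) /\
    (forall a b, chart_dom a p -> chart_dom b p ->
       v b = 'D_(v a) (rep a (chart_coord b)) (chart_coord a p))].

(* The tangent vector at [p] whose components in the chart [a] are [w]. *)
Definition tvec (a : idx A) (p : T) (w : V) : fam :=
  fun b => if `[< chart_dom b p >] then
    'D_w (rep a (chart_coord b)) (chart_coord a p)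
  else 0.

(* [section E X]: [X] is a smooth section of the subbundle [E] of the tangent
   bundle, that is [X \in Gamma(E)]; [section tangent] are the vector fields. *)
Definition section (E : T -> set fam) (X : T -> fam) : Prop :=
  (forall p, E p (X p)) /\
  (forall a, smooth_on (img a) (rep a (fun p => X p a))).

(* The derivative [X(f)] of the function [f] along the vector field [X]. *)
Definition act (X : T -> fam) (f : T -> R) : T -> R := fun p =>
  'D_(X p (chart_at A p)) (rep (chart_at A p) f) (chart_coord (chart_at A p) p).

Definition bracket (X Y : T -> fam) : T -> fam := fun p a =>
  if `[< chart_dom a p >] then
    'D_(X p a) (rep a (fun q => Y q a)) (chart_coord a p)
    - 'D_(Y p a) (rep a (fun q => X q a)) (chart_coord a p)
  else 0.

Definition fscale (f : T -> R) (X : T -> fam) : T -> fam :=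
  fun p => f p *: X p.

(* Pointwise action of a bundle endomorphism on a vector field. *)
Definition bapp (J : T -> fam -> fam) (X : T -> fam) : T -> fam :=
  fun p => J p (X p).

(* Linear connections on a subbundle [E] of the tangent bundle; those on the
   manifold itself are obtained for [E = tangent]. *)
Definition linear_connection (E : T -> set fam)
    (nab : (T -> fam) -> (T -> fam) -> (T -> fam)) : Prop :=
  [/\ forall X Y, section tangent X -> section E Y -> section E (nab X Y),
      forall X X' Y, section tangent X -> section tangent X' -> section E Y ->
        nab (X + X') Y = nab X Y + nab X' Y,
      forall f X Y, smooth_fun f -> section tangent X -> section E Y ->
        nab (fscale f X) Y = fscale f (nab X Y),
      forall X Y Y', section tangent X -> section E Y -> section E Y' ->
        nab X (Y + Y') = nab X Y + nab X Y' &
      forall f X Y, smooth_fun f -> section tangent X -> section E Y ->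
        nab X (fscale f Y) = fscale f (nab X Y) + fscale (act X f) Y].

(* [nabla_X g = 0] for all [X], for a metric [g] on the subbundle [E]. *)
Definition metric_connection (E : T -> set fam) (g : T -> fam -> fam -> R)
    (nab : (T -> fam) -> (T -> fam) -> (T -> fam)) : Prop :=
  forall X Y Z, section tangent X -> section E Y -> section E Z ->
  forall p, act X (fun q => g q (Y q) (Z q)) p
            = g p (nab X Y p) (Z p) + g p (Y p) (nab X Z p).

Definition torsion (D : (T -> fam) -> (T -> fam) -> (T -> fam))
    (X Y : T -> fam) : T -> fam :=
  D X Y - D Y X - bracket X Y.

Definition riemannian_metric (G : T -> fam -> fam -> R) : Prop :=
  [/\ forall p v v' w (c : R), tangent p v -> tangent p v' -> tangent p w ->
        G p (c *: v + v') w = c * G p v w + G p v' w,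
      forall p v w, tangent p v -> tangent p w -> G p v w = G p w v,
      forall p v, tangent p v -> v <> 0 -> 0 < G p v v &
      forall X Y, section tangent X -> section tangent Y ->
        smooth_fun (fun p => G p (X p) (Y p))].

Definition levi_civita (G : T -> fam -> fam -> R)
    (nab : (T -> fam) -> (T -> fam) -> (T -> fam)) : Prop :=
  [/\ linear_connection tangent nab, metric_connection tangent G nab &
      forall X Y, section tangent X -> section tangent Y ->
        torsion nab X Y = 0].

(* [nabla J = 0] *)
Definition parallel (nab : (T -> fam) -> (T -> fam) -> (T -> fam))
    (J : T -> fam -> fam) : Prop :=
  forall X Y, section tangent X -> section tangent Y ->
    nab X (bapp J Y) - bapp J (nab X Y) = 0.

Definition almost_complex (J : T -> fam -> fam) : Prop :=
  [/\ forall p v, tangent p v -> tangent p (J p v),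
      forall p v w (c : R), tangent p v -> tangent p w ->
        J p (c *: v + w) = c *: J p v + J p w,
      forall p v, tangent p v -> J p (J p v) = - v &
      forall X, section tangent X -> section tangent (bapp J X)].

Definition nijenhuis (J : T -> fam -> fam) (X Y : T -> fam) : T -> fam :=
  bracket (bapp J X) (bapp J Y) - bapp J (bracket (bapp J X) Y)
  - bapp J (bracket X (bapp J Y)) - bracket X Y.

(* Integrability is the vanishing of the Nijenhuis tensor. *)
Definition integrable_acs (J : T -> fam -> fam) : Prop :=
  almost_complex J /\
  forall X Y, section tangent X -> section tangent Y -> nijenhuis J X Y = 0.

(* Evaluation of the exterior derivative of a 2-form on vector fields. *)
Definition d2form (w : T -> fam -> fam -> R) (X Y Z : T -> fam) : T -> R :=
  fun p =>
    act X (fun q => w q (Y q) (Z q)) p + act Y (fun q => w q (Z q) (X q)) p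
    + act Z (fun q => w q (X q) (Y q)) p
    - w p (bracket X Y p) (Z p) - w p (bracket Y Z p) (X p)
    - w p (bracket Z X p) (Y p).

Definition kahlerian (J : T -> fam -> fam) (G : T -> fam -> fam -> R) : Prop :=
  [/\ riemannian_metric G, integrable_acs J,
      forall p v w, tangent p v -> tangent p w ->
        G p (J p v) (J p w) = G p v w &
      forall X Y Z, section tangent X -> section tangent Y ->
        section tangent Z -> forall p,
        d2form (fun q v w => G q v (J q w)) X Y Z p = 0].

End Charts.

Arguments tangent {R V T} A p _.
Arguments section {R V T} A E X.
Arguments smooth_fun {R V T} A {W} f.

(* The tangent map of [f] at [p]. *)
Definition tmap (R : realType) (V V' : normedModType R) (T T' : Type)
    (A : charts V T) (A' : charts V' T') (f : T -> T') (p : T) (v : fam A) :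
    fam A' :=
  fun b => if `[< chart_dom b (f p) >] then
    'D_(v (chart_at A p)) (rep (chart_at A p) (fun q => chart_coord b (f q)))
       (chart_coord (chart_at A p) p)
  else 0.

Arguments tmap {R V V' T T'} A A' f p _ _.

(** * The base manifold and its tangent bundle *)

Definition smooth_manifold (R : realType) (m : nat) (M : topologicalType)
    (A : charts 'rV[R]_m M) : Prop :=
  [/\ hausdorff_space M,
      @second_countable M,
      forall p, chart_dom (chart_at A p) p,
      forall a : idx A,
        [/\ open (chart_dom a), {within chart_dom a, continuous (chart_coord a)},
            {in chart_dom a &, injective (chart_coord a)} &
            forall O : set M, open O -> O `<=` chart_dom a -> open (chart_coord a @` O)] &
      forall a b : idx A,
        smooth_on (chart_coord a @` (chart_dom a `&` chart_dom b)) (rep a (chart_coord b))].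

Section TangentBundle.
Context {R : realType} {m : nat} {M : topologicalType} (A : charts 'rV[R]_m M).

Record TM := TMPoint {
  base : M;
  vec : fam A;
  vec_tangent : tangent A base vec
}.

(* The induced local coordinates [(x, y)] of a point of the tangent bundle. *)
Definition tcoord (a : idx A) (u : TM) : 'rV[R]_m * 'rV[R]_m :=
  (chart_coord a (base u), vec u a).

Definition tdom (a : idx A) : set TM := [set u | chart_dom a (base u)].

(* [M'] is a nonempty open subset of [TM] projecting onto [M] and disjoint
   from the image of the zero section. *)
Definition open_slit_subset (M' : set TM) : Prop :=
  [/\ M' !=set0,
      forall a, open (tcoord a @` (M' `&` tdom a)),
      base @` M' = setT &
      forall u, M' u -> vec u <> 0].

End TangentBundle.

Arguments TM {R m M} A.

(* The open submanifold [M'], as a type. *)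
Definition slit (R : realType) (m : nat) (M : topologicalType)
  (A : charts 'rV[R]_m M) (M' : set (TM A)) : Type := {u : TM A | M' u}.

(** * Finsler geometry *)

(* The vectors [e_i] of the model space of [M], placed along the base
   coordinates [x] and along the fibre coordinates [y]. *)
Definition ex (R : realType) (m : nat) (i : 'I_m) : 'rV[R]_m * 'rV[R]_m :=
  (delta_mx 0 i, 0).
Definition ey (R : realType) (m : nat) (i : 'I_m) : 'rV[R]_m * 'rV[R]_m :=
  (0, delta_mx 0 i).
Arguments ex {R m} i.
Arguments ey {R m} i.

Definition bil (R : realType) (m : nat) (g : 'M[R]_m) (v w : 'rV[R]_m) : R :=
  \sum_i \sum_j g i j * v 0 i * w 0 j.

(* The coordinate formulas for the fundamental tensor [g_ij], the coefficients
   [G^i] of the geodesic spray, the Riemann curvature [R^i_k] and the flag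
   curvature of the flag spanned by [y] and [w], at [z = (x, y)]; here [L]
   stands for the local expression of [F^2]. *)
Section Local.
Context {R : realType} {m : nat}.
Local Notation E := ('rV[R]_m * 'rV[R]_m)%type.
Implicit Types (L : E -> R) (z : E).

Definition gij L z : 'M[R]_m :=
  \matrix_(i, j) (2^-1 * 'D_(ey i) ('D_(ey j) L) z).

Definition spray L (i : 'I_m) z : R :=
  4^-1 * \sum_l invmx (gij L z) i l *
    (\sum_k 'D_(ex k) ('D_(ey l) L) z * z.2 0 k
     - 'D_(ex l) L z).

Definition riemann_curv L z : 'M[R]_m :=
  \matrix_(i, k)
    (2 * 'D_(ex k) (spray L i) z
     - \sum_j z.2 0 j * 'D_(ex j) ('D_(ey k) (spray L i)) z
     + 2 * \sum_j spray L j z *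
             'D_(ey j) ('D_(ey k) (spray L i)) z
     - \sum_j 'D_(ey j) (spray L i) z * 'D_(ey k) (spray L j) z).

Definition flag_curvature L z (w : 'rV[R]_m) : R :=
  let g := gij L z in
  let Rw : 'rV[R]_m := w *m (riemann_curv L z)^T in
  bil g Rw w / (bil g z.2 z.2 * bil g w w - bil g z.2 w ^+ 2).

End Local.

Section Finsler.
Context {R : realType} {m : nat} {M : topologicalType} {A : charts 'rV[R]_m M}.
Context {M' : set (TM A)}.
Local Notation E := ('rV[R]_m * 'rV[R]_m)%type.

Definition base_proj (u : slit M') : M := base (sval u).

(* The charts of [M'] induced by those of [M]; its local coordinates are
   [(x, y)]. *)
Definition scharts : charts E (slit M') :=
  @Charts R E (slit M') (idx A) (fun a => [set u | tdom a (sval u)])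
    (fun a u => tcoord a (sval u)) (fun u => chart_at A (base_proj u)).

Local Notation fam' := (fam scharts).

Definition vertical (u : slit M') : set fam' :=
  [set v | tangent scharts u v /\ tmap scharts A base_proj u v = 0].

Definition Fstar (F : slit M' -> R) : slit M' -> R := fun u => F u ^+ 2.

Definition gmx (F : slit M' -> R) (a : idx A) (u : slit M') : 'M[R]_m :=
  gij (rep (A := scharts) a (Fstar F)) (chart_coord (c := scharts) a u).

Definition finsler_manifold (F : slit M' -> R) : Prop :=
  [/\ smooth_manifold A,
      open_slit_subset M',
      (forall u, 0 < F u) /\ smooth_fun scharts F,
      forall (u u' : slit M') (k : R), 0 < k ->
        base_proj u' = base_proj u -> vec (sval u') = k *: vec (sval u) ->
        Fstar F u' = k ^+ 2 * Fstar F u &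
      forall a u, chart_dom (c := scharts) a u ->
        forall w : 'rV[R]_m, w != 0 -> 0 < bil (gmx F a u) w w].

Definition zero_flag_curvature (F : slit M' -> R) : Prop :=
  forall (a : idx A) (u : slit M'), chart_dom (c := scharts) a u ->
  forall w : 'rV[R]_m, row_free (col_mx (vec (sval u) a) w) ->
  flag_curvature (rep (A := scharts) a (Fstar F)) (chart_coord (c := scharts) a u) w
  = 0.

(* The metric [g] on the vertical bundle. *)
Definition vmetric (F : slit M' -> R) (u : slit M') (v w : fam') : R :=
  let a := chart_at scharts u in bil (gmx F a u) (v a).2 (w a).2.

(** ** Nonlinear connections *)

(* [hproj H] and [vproj H] are the projections of the tangent bundle of [M']
   onto [H] and onto the vertical bundle. *)
Definition hproj (H : slit M' -> set fam') (u : slit M') (v : fam') : fam' :=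
  xget 0 [set w | H u w /\ vertical u (v - w)].

Definition vproj (H : slit M' -> set fam') (u : slit M') (v : fam') : fam' :=
  v - hproj H u v.

Definition partial_x (a : idx A) (i : 'I_m) (u : slit M') : fam' :=
  tvec (A := scharts) a u (ex i).
Definition partial_y (a : idx A) (i : 'I_m) (u : slit M') : fam' :=
  tvec (A := scharts) a u (ey i).

(* [delta / delta x^i]: the horizontal vector differing from
   [partial / partial x^i] by the vertical one with components [N^j_i]. *)
Definition delta_x (H : slit M' -> set fam') (a : idx A) (i : 'I_m)
    (u : slit M') : fam' :=
  hproj H u (partial_x a i u).

(* A smooth distribution complementary to the vertical bundle; smoothness is
   that of the coefficients [N^j_i]. *)
Definition nonlinear_connection (H : slit M' -> set fam') : Prop :=
  [/\ forall u, H u `<=` tangent scharts u,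
      forall u, H u 0 /\
        forall v w (c : R), H u v -> H u w -> H u (c *: v + w),
      forall u v, tangent scharts u v ->
        exists! w, H u w /\ vertical u (v - w) &
      forall (a : idx A) i,
        smooth_on (img (A := scharts) a)
          (rep (A := scharts) a (fun u => delta_x H a i u a))].

Definition associate_acs (H : slit M' -> set fam')
    (J : slit M' -> fam' -> fam') : Prop :=
  (forall u v w (c : R), tangent scharts u v -> tangent scharts u w ->
     J u (c *: v + w) = c *: J u v + J u w) /\
  (forall (a : idx A) (u : slit M'), chart_dom (c := scharts) a u -> forall i,
     J u (delta_x H a i u) = - partial_y a i u /\
     J u (partial_y a i u) = delta_x H a i u).

(** ** Cartan connections *)

(* Skew-symmetric Finsler tensor fields of type (1,2). *)
Definition skew_tensor (S : (slit M' -> fam') -> (slit M' -> fam') ->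
    (slit M' -> fam')) : Prop :=
  [/\ forall X Y, section scharts vertical X -> section scharts vertical Y ->
        section scharts vertical (S X Y),
      forall X X' Y, section scharts vertical X ->
        section scharts vertical X' -> section scharts vertical Y ->
        S (X + X') Y = S X Y + S X' Y,
      forall (f : slit M' -> R) X Y, smooth_fun scharts f ->
        section scharts vertical X -> section scharts vertical Y ->
        S (fscale f X) Y = fscale f (S X Y) &
      forall X Y, section scharts vertical X -> section scharts vertical Y ->
        S X Y = - S Y X].

Definition natural_connection (H : slit M' -> set fam')
    (J : slit M' -> fam' -> fam')
    (nab : (slit M' -> fam') -> (slit M' -> fam') -> (slit M' -> fam'))
    (X Y : slit M' -> fam') : slit M' -> fam' :=
  nab X (bapp (vproj H) Y) - bapp J (nab X (bapp J (bapp (hproj H) Y))).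

(* [(H, nab)] is the [(H, S, T)]-Cartan connection. *)
Definition cartan_connection (F : slit M' -> R) (H : slit M' -> set fam')
    (J : slit M' -> fam' -> fam')
    (S T nab : (slit M' -> fam') -> (slit M' -> fam') -> (slit M' -> fam')) :
    Prop :=
  let TD := torsion (natural_connection H J nab) in
  let h := bapp (hproj H) in
  let v := bapp (vproj H) in
  [/\ linear_connection vertical nab,
      metric_connection vertical (vmetric F) nab,
      forall X Y, section scharts (tangent scharts) X ->
        section scharts (tangent scharts) Y ->
        TD (v X) (v Y) = S (v X) (v Y) &
      forall X Y, section scharts (tangent scharts) X ->
        section scharts (tangent scharts) Y ->
        h (TD (h X) (h Y)) = bapp J (T (bapp J (h X)) (bapp J (h Y)))].

(* [G = g_ij dx^i dx^j + g_ij delta y^i delta y^j]; the 1-forms [delta y^i]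
   give the fibre components of the vertical part of a vector. *)
Definition sasaki (F : slit M' -> R) (H : slit M' -> set fam') (u : slit M')
    (v w : fam') : R :=
  let a := chart_at scharts u in
  bil (gmx F a u) (v a).1 (w a).1
  + bil (gmx F a u) (vproj H u v a).2 (vproj H u w a).2.

End Finsler.
Arguments scharts {R m M A} M'.

(* Main.v *)
(* The natural connection [D] is metric for the Sasaki metric [G] and commutes
   with [J]. If it is torsion free, it is the Levi-Civita connection of [G], so
   [J] is parallel, its Nijenhuis tensor vanishes and the fundamental 2-form is
   closed.

   For the flag curvature, write the torsion in a local frame
   [delta_i, partial_j]. Its mixed part says that [nabla] vanishes on vertical
   directions, hence [g_ij] does not depend on [y], and that
   [nabla_(delta_i) partial_j] has the components
   [Gamma_ij^k = partial N^k_i / partial y^j]. Its horizontal part says that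
   [Gamma_ij^k] is symmetric in [i, j] and that [[delta_i, delta_j] = 0].
   Metricity then makes [Gamma] the Christoffel symbols of a Riemannian metric
   on an open subset of [M]. By Euler's theorem [F^2 = g_ij y^i y^j], so the
   spray is [Gamma^i_jk y^j y^k / 2], and its curvature is, up to contraction
   with [y], the fibre derivative of [[delta_i, delta_j] = 0]. *)

(* The mixed part of the torsion splits because [D] preserves both subbundles: the derivative of a
   vertical frame vector along delta_i is vertical, and so is the bracket of delta_i with it, while
   the derivative of delta_i along a vertical direction is horizontal. The latter must vanish, and
   [J] turns it into a vertical derivative of a vertical frame vector.

   The obstacle is that [H] is neither homogeneous in y nor tied to the spray. From Gamma = dN/dy
   one recovers N on a fibre only up to a term which is locally constant there, so N cannot be
   inserted into the spray. Flatness is therefore read off the fibre derivative of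
   [delta_i, delta_j] = 0: once Gamma is known to be constant along the fibre, N enters this
   derivative only through Gamma.

   That constancy is obtained without solving for Christoffel symbols: differentiating metricity
   along the fibre gives a trilinear form, symmetric in one pair of arguments and skew in another,
   hence zero. *)
From HB Require Import structures.
Require Import Defs.
From mathcomp Require Import all_boot all_order all_algebra.
From mathcomp Require Import all_classical all_reals all_analysis.
From mathcomp Require Import ring lra.

Set Implicit Arguments.
Unset Strict Implicit.
Unset Printing Implicit Defensive.

Import Order.TTheory GRing.Theory Num.Theory.
Import numFieldNormedType.Exports.

Local Open Scope classical_set_scope.
Local Open Scope ring_scope.

(** * Smooth maps *)

Section Differentiable.
Context {R : realType} {V W : normedModType R}.

(** The little-o expansion of [g] at [x] is also one of [f], and such an expansion with a continuous
    linear part determines the differential. *)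
Lemma near_eq_differentiable (f g : V -> W) x :
  (\near x, f x = g x) -> differentiable g x -> differentiable f x.
Proof.
move=> fg dg; have [dgc dgo] := (diff_locallyP x g).1 dg.
have fx : f x = g x by exact: nbhs_singleton fg.
have fo : f \o shift x = cst (f x) + 'd g x +o_ 0 id.
  apply/eqaddoP => e e0; move/eqaddoP: dgo => /(_ e e0).
  have : \forall y \near (0 : V), f (y + x) = g (y + x).
    by move: fg; rewrite (near_shift 0)/= subr0.
  by apply: filterS2 => y /= + /=; rewrite !fctE /= fx => ->.
by apply/diff_locallyP; rewrite (diff_unique dgc fo).
Qed.

Lemma differentiable_eq_on (U : set V) (f g : V -> W) x :
  open U -> U x -> {in U, f =1 g} -> differentiable g x -> differentiable f x.
Proof.
move=> oU Ux fg; apply: near_eq_differentiable.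
by apply: filterS (open_nbhs_nbhs (conj oU Ux)) => y Uy; apply: fg; rewrite inE.
Qed.

Lemma derive_eq_on (U : set V) (f g : V -> W) x v :
  open U -> U x -> {in U, f =1 g} -> 'D_v f x = 'D_v g x.
Proof.
move=> oU Ux fg; apply: near_eq_derive.
by apply: filterS (open_nbhs_nbhs (conj oU Ux)) => y Uy; apply: fg; rewrite inE.
Qed.

Lemma derive_linear (f : V -> W) x v w (c : R) :
  differentiable f x -> 'D_(c *: v + w) f x = c *: 'D_v f x + 'D_w f x.
Proof. by move=> df; rewrite !deriveE// linearP. Qed.

Lemma derivev_sum (I : finType) (f : V -> W) x (c : I -> R) (v : I -> V) :
  differentiable f x ->
  'D_(\sum_i c i *: v i) f x = \sum_i c i *: 'D_(v i) f x.
Proof.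
move=> df; rewrite deriveE// linear_sum; apply: eq_bigr => i _.
by rewrite linearZ deriveE.
Qed.

End Differentiable.

Section Chain.
Context {R : realType} {U V W : normedModType R}.

Lemma derive_comp (f : U -> V) (g : V -> W) x v :
  differentiable f x -> differentiable g (f x) ->
  'D_v (fun y => g (f y)) x = 'D_('D_v f x) g (f x).
Proof.
move=> df dg; rewrite -[fun y => _]/(g \o f) !deriveE//; last first.
  exact: differentiable_comp.
by rewrite diff_comp.
Qed.

Lemma derive_clinear (f : U -> V) (l : {linear V -> W}) x v :
  continuous l -> differentiable f x ->
  'D_v (fun y => l (f y)) x = l ('D_v f x).
Proof.
move=> lc df; rewrite derive_comp//; last exact: linear_differentiable.
by rewrite [LHS]deriveE; [rewrite diff_lin|exact: linear_differentiable].
Qed.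

End Chain.

(* Finite bases; they reduce the chain rule for [diffn], whose directions are
   constant, to products of scalar functions. *)
Record cbasis (R : realType) (W : normedModType R) := CBasis {
  cbI : finType;
  cbe : cbI -> W;
  cbc : cbI -> {linear W -> R};
  cbc_cont : forall i, continuous (cbc i);
  cbE : forall w, w = \sum_i cbc i w *: cbe i
}.
Arguments cbe {R W} c i.
Arguments cbc {R W} c i.

(** * Calculus of [diffn]: sums, products, inverses, composition *)

Section Diffn.
Context {R : realType}.
Implicit Types (V W Z : normedModType R).

Lemma diffn_subset V W k (U O : set V) (f : V -> W) :
  O `<=` U -> diffn k U f -> diffn k O f.
Proof.
move=> OU; elim: k f => //= k IH f [df Df]; split=> [x /OU/df//|v].
exact/IH/Df.
Qed.

Lemma diffn_leS V W k (U : set V) (f : V -> W) : diffn k.+1 U f -> diffn k U f.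
Proof.
elim: k f => //= k IH f [df Df]; split=> // v; exact/IH/Df.
Qed.

(** Derivatives only see germs. This is how functions extended by 0 outside their natural domain,
    such as [rep], are shown to be smooth. *)
Lemma diffn_local V W k (U : set V) (f : V -> W) :
  (forall x, U x -> exists O g, [/\ open O, O x, diffn k O g & {in O, f =1 g}]) ->
  diffn k U f.
Proof.
elim: k U f => //= k IH U f H; split=> [x /H [ O [g [ oO Ox [dg _] fg]]]|v].
  exact: differentiable_eq_on fg (dg x Ox).
apply: IH => x /H [ O [g [ oO Ox [dg Dg] fg]]].
exists O, (fun x => 'D_v g x); split=> // y /set_mem Oy.
exact: derive_eq_on fg.
Qed.

Lemma diffn_eq V W k (U : set V) (f g : V -> W) :
  open U -> {in U, f =1 g} -> diffn k U g -> diffn k U f.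
Proof. by move=> oU fg dg; apply: diffn_local => x Ux; exists U, g. Qed.

Lemma diffn_cst V W k (U : set V) (c : W) : diffn k U (fun=> c).
Proof.
elim: k c => //= k IH c; split=> [x _|v]; first exact: differentiable_cst.
have -> // : 'D_v (fun=> c) = (fun=> 0) :> (V -> W).
by apply/funext => x; exact: derive_cst.
Qed.

Lemma diffnD V W k (U : set V) (f g : V -> W) : open U ->
  diffn k U f -> diffn k U g -> diffn k U (fun x => f x + g x).
Proof.
move=> oU; elim: k f g => //= k IH f g [df Df] [dg Dg]; split=> [x Ux|v].
  by apply: differentiableD; [exact: df|exact: dg].
apply: (@diffn_eq _ _ _ _ _ (fun x => 'D_v f x + 'D_v g x)) => // [x /set_mem Ux|].
  by apply: deriveD; apply: diff_derivable; [exact: df|exact: dg].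
exact: IH.
Qed.

Lemma diffn_sum V W k (U : set V) (I : Type) (r : seq I) (P : pred I) (f : I -> V -> W) :
  open U -> (forall i, P i -> diffn k U (f i)) ->
  diffn k U (fun x => \sum_(i <- r | P i) f i x).
Proof.
move=> oU H; elim: r => [|i r IH].
  have -> : (fun x => \sum_(i <- [::] | P i) f i x) = fun=> 0.
    by apply/funext => x; rewrite big_nil.
  exact: diffn_cst.
have -> : (fun x => \sum_(i <- i :: r | P i) f i x) =
    if P i then (fun x => f i x + \sum_(i <- r | P i) f i x)
    else fun x => \sum_(i <- r | P i) f i x.
  by apply/funext => x; rewrite big_cons; case: ifP.
by case: ifP => // Pi; apply: diffnD => //; exact: H.
Qed.

Lemma diffn_clinear V W Z k (U : set V) (f : V -> W) (l : {linear W -> Z}) :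
  open U -> continuous l -> diffn k U f -> diffn k U (fun x => l (f x)).
Proof.
move=> oU lc; elim: k f => //= k IH f [df Df]; split=> [x Ux|v].
  apply: (@differentiable_comp _ _ _ _ f l); first exact: df.
  exact: linear_differentiable.
apply: (@diffn_eq _ _ _ _ _ (fun x => l ('D_v f x))) => // [x /set_mem Ux|].
  by apply: derive_clinear => //; exact: df.
exact: IH.
Qed.

Lemma diffn_lin V W k (U : set V) (l : {linear V -> W}) :
  continuous l -> diffn k U l.
Proof.
move=> lc; case: k => //= k; split=> [x _|v]; first exact: linear_differentiable.
have -> : 'D_v l = (fun=> l v) :> (V -> W); last exact: diffn_cst.
apply/funext => x; rewrite deriveE; last exact: linear_differentiable.
by rewrite diff_lin.
Qed.

Lemma diffnM V k (U : set V) (f g : V -> R) : open U ->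
  diffn k U f -> diffn k U g -> diffn k U (fun x => f x * g x).
Proof.
move=> oU; elim: k f g => //= k IH f g [df Df] [dg Dg]; split=> [x Ux|v].
  by apply: differentiableM; [exact: df|exact: dg].
apply: (@diffn_eq _ _ _ _ _ (fun x => f x * 'D_v g x + g x * 'D_v f x)) => //.
  by move=> x /set_mem Ux; apply: deriveM; apply: diff_derivable; [exact: df|exact: dg].
by apply: diffnD => //; apply: IH => //; apply: diffn_leS.
Qed.

Lemma diffnZl V W k (U : set V) (f : V -> R) (w : W) : open U ->
  diffn k U f -> diffn k U (fun x => f x *: w).
Proof.
move=> oU; elim: k f => //= k IH f [df Df]; split=> [x Ux|v].
  by apply: differentiableZl; exact: df.
apply: (@diffn_eq _ _ _ _ _ (fun x => 'D_v f x *: w)) => // [x /set_mem Ux|].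
  have d := df x Ux.
  by rewrite !deriveE//; [rewrite diffZl|apply: differentiableZl].
exact: IH.
Qed.

Lemma diffnV V k (U : set V) (f : V -> R) : open U ->
  (forall x, U x -> f x != 0) -> diffn k U f -> diffn k U (fun x => (f x)^-1).
Proof.
move=> oU f0; elim: k f f0 => //= k IH f f0 [df Df]; split=> [x Ux|v].
  by apply: differentiableV; [exact: df|exact: f0].
(* The square is spelled as a product of two inverses, so that the induction hypothesis for the
   inverse applies to each factor. *)
apply: (@diffn_eq _ _ _ _ _ (fun x => (-1) * ((f x)^-1 * (f x)^-1) * 'D_v f x)) => //.
  move=> x /set_mem Ux; rewrite deriveV; first by rewrite -exprVn expr2 mulN1r.
    exact: f0.
  exact/diff_derivable/df.
have dfV : diffn k U (fun x => (f x)^-1).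
  by apply: IH => //; exact: (@diffn_leS _ _ k).
do 2!apply: diffnM => //; first exact: diffn_cst.
exact: diffnM.
Qed.

Lemma diffn_pair V W Z k (U : set V) (f : V -> W) (g : V -> Z) : open U ->
  diffn k U f -> diffn k U g -> diffn k U (fun x => (f x, g x)).
Proof.
move=> oU; elim: k f g => //= k IH f g [df Df] [dg Dg]; split=> [x Ux|v].
  by apply: differentiable_pair; [exact: df|exact: dg].
apply: (@diffn_eq _ _ _ _ _ (fun x => ('D_v f x, 'D_v g x))) => //.
  move=> x /set_mem Ux; have dfx := df x Ux; have dgx := dg x Ux.
  by rewrite !deriveE//; [rewrite diff_pair|apply: differentiable_pair].
exact: IH.
Qed.

Lemma derive_pair V W Z (f : V -> W) (g : V -> Z) x v :
  differentiable f x -> differentiable g x ->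
  'D_v (fun x => (f x, g x)) x = ('D_v f x, 'D_v g x).
Proof.
move=> df dg; rewrite !deriveE//; last exact: differentiable_pair.
by rewrite diff_pair.
Qed.

Lemma diffnZ V W (b : cbasis W) k (U : set V) (f : V -> R) (g : V -> W) :
  open U -> diffn k U f -> diffn k U g -> diffn k U (fun x => f x *: g x).
Proof.
move=> oU df dg.
apply: (@diffn_eq _ _ _ _ _ (fun x => \sum_i (f x * cbc b i (g x)) *: cbe b i)) => //.
  move=> x _; rewrite {1}[g x](cbE b) scaler_sumr.
  by apply: eq_bigr => i _; rewrite scalerA.
apply: diffn_sum => // i _; apply: diffnZl => //; apply: diffnM => //.
by apply: diffn_clinear => //; exact: cbc_cont.
Qed.

Lemma diffn_comp V W Z (b : cbasis W) (bZ : cbasis Z) k (U : set V) (O : set W)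
    (f : V -> W) (g : W -> Z) :
  open U -> (forall x, U x -> O (f x)) ->
  diffn k U f -> diffn k O g -> diffn k U (fun x => g (f x)).
Proof.
move=> oU UO; elim: k f g UO => //= k IH f g UO [df Df] [dg Dg]; split=> [x Ux|v].
  by apply: (@differentiable_comp _ _ _ _ f g); [exact: df|exact/dg/UO].
(* The direction ['D_v f x] varies with [x]; expanded in the basis [b], it leaves derivatives of [g]
   in fixed directions, to which the induction hypothesis applies. *)
apply: (@diffn_eq _ _ _ _ _
  (fun x => \sum_i cbc b i ('D_v f x) *: 'D_(cbe b i) g (f x))) => //.
  move=> x /set_mem Ux; have dfx := df x Ux; have dgx := dg _ (UO x Ux).
  by rewrite (derive_comp v dfx dgx) {1}(cbE b ('D_v f x)) derivev_sum.
apply: diffn_sum => // i _; apply: diffnZ => //.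
  by apply: (diffn_clinear oU _ (Df v)); exact: cbc_cont.
by apply: (IH f ('D_(cbe b i) g)) => //; exact: (@diffn_leS _ _ k).
Qed.

End Diffn.

Section Bases.
Context {R : realType}.

Definition rcoord m (i : 'I_m) (w : 'rV[R]_m) : R := w 0 i.

Lemma rcoord_linear m (i : 'I_m) : linear (rcoord i : _ -> R^o).
Proof. by move=> c u v; rewrite /rcoord !mxE. Qed.

HB.instance Definition _ m (i : 'I_m) :=
  GRing.isLinear.Build R 'rV[R]_m R _ (rcoord i) (rcoord_linear i).

Definition cbasisR : cbasis R.
Proof.
refine (@CBasis R R unit (fun=> 1) (fun=> [the {linear R -> R} of idfun]) _ _).
- by move=> _ x; exact: cvg_id.
- by move=> w; rewrite (big_pred1 tt)//= [RHS]mulr1.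
Defined.

Definition cbasis_rV m : cbasis 'rV[R]_m.
Proof.
refine (@CBasis R 'rV[R]_m 'I_m (fun i => delta_mx 0 i)
  (fun i => [the {linear 'rV[R]_m -> R} of rcoord i]) _ _).
- by move=> i; exact: coord_continuous.
- by move=> w; exact: row_sum_delta.
Defined.

Definition cbasis_prod (V W : normedModType R) (b : cbasis V) (c : cbasis W) :
  cbasis (V * W)%type.
Proof.
refine (@CBasis R (V * W)%type (cbI b + cbI c)%type
  (fun s => match s with inl i => (cbe b i, 0) | inr j => (0, cbe c j) end)
  (fun s => match s with
     | inl i => [the {linear (V * W)%type -> R} of cbc b i \o fst]
     | inr j => [the {linear (V * W)%type -> R} of cbc c j \o snd] end) _ _).
- case=> i x; apply: (@continuous_comp _ _ _ (_ : V * W -> _)).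
  + exact: cvg_fst.
  + exact: cbc_cont.
  + exact: cvg_snd.
  + exact: cbc_cont.
- case=> v w; rewrite big_sumType/=.
  rewrite [RHS]surjective_pairing; congr pair.
    rewrite raddfD !raddf_sum/= [X in _ + X]big1 ?addr0; last first.
      by move=> i _; rewrite scaler0.
    exact: cbE.
  rewrite raddfD !raddf_sum/= [X in X + _]big1 ?add0r; last first.
    by move=> i _; rewrite scaler0.
  exact: cbE.
Defined.

End Bases.

(** * Symmetry of second derivatives *)

Section Schwarz.
Context {R : realType} {V : normedModType R}.
Implicit Types (f : V -> R).

Lemma is_derive_line f (a u : V) (t : R) :
  differentiable f (a + t *: u) ->
  is_derive t 1 (fun s : R => f (a + s *: u)) ('D_u f (a + t *: u)).
Proof.
move=> df.
have dl : is_diff t (fun s : R => a + s *: u) ( *:%R ^~ u).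
  by apply: is_diff_eq; rewrite add0r.
have dc := @is_diff_comp _ _ _ _ _ _ _ _ _ dl (differentiableP df).
have d : differentiable (fun s : R => f (a + s *: u)) t by case: dc.
apply: DeriveDef; first exact: diff_derivable.
rewrite deriveE// -[fun s => _]/(f \o (fun s : R => a + s *: u)) diff_val/=.
by rewrite scale1r deriveE.
Qed.

(* Young's theorem: both mixed derivatives are the limit of the second
   difference of [f] divided by [t ^+ 2]. *)
Lemma second_difference f (x u v : V) :
  (\forall y \near x, differentiable f y) -> differentiable ('D_u f) x ->
  forall e, 0 < e -> \forall t \near 0^'+,
    `|f (x + t *: u + t *: v) - f (x + t *: u) - f (x + t *: v) + f x
      - t ^+ 2 * 'D_v ('D_u f) x| <= e * t ^+ 2.
Proof.
move=> df du e e0; set h := 'D_u f.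
(* The first-order expansion of [h] is used at the offsets [c *: u + t *: v] and [c *: u], whose
   norms add up to at most [t * (2 * |u| + |v|)]. The summand 1 keeps the denominator positive. *)
pose e1 := e / (2 * `|u| + `|v| + 1).
have c0 : 0 < 2 * `|u| + `|v| + 1.
  by rewrite ltr_wpDl// addr_ge0// mulr_ge0.
have e10 : 0 < e1 by rewrite divr_gt0.
have [_ /eqaddoP/(_ e1 e10)] := (diff_locallyP x h).1 du.
move=> /nbhs_ballP[d1 /= d10 H1].
have [d2 /= d20 H2] : exists2 d, 0 < d & forall k, `|k| < d -> differentiable f (x + k).
  move/nbhs_ballP: df => [d /= d0 H]; exists d => // k kd; apply: H.
  by rewrite -ball_normE/= opprD addrA subrr sub0r normrN.
have {}H1 k : `|k| < d1 -> `|h (x + k) - h x - 'd h x k| <= e1 * `|k|.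
  move=> kd; have := H1 k; rewrite -ball_normE/= sub0r normrN => /(_ kd).
  by rewrite !fctE/= opprD addrA [k + x]addrC.
near=> t.
have t0 : 0 < t by near: t; exact: nbhs_right_gt.
have small : t * (`|u| + `|v| + 1) < Num.min d1 d2.
  rewrite -ltr_pdivlMr; last by rewrite ltr_wpDl// addr_ge0.
  near: t; apply: nbhs_right_lt; by rewrite divr_gt0// lt_min d10.
have bnd (c b : R) : 0 <= c <= t -> 0 <= b <= t ->
    `|c *: u + b *: v| < Num.min d1 d2.
  move=> /andP[c00 ct] /andP[b0 bt]; apply: le_lt_trans small.
  apply: (le_trans (ler_normD _ _)); rewrite !normrZ !ger0_norm// !mulrDr mulr1.
  rewrite -[leLHS]addr0; apply: lerD; last exact: ltW.
  by apply: lerD; apply: ler_wpM2r.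
(* The second difference is the increment of [psi] over [[0, t]]; the mean value theorem makes it
   [t] times a difference of two values of [h]. *)
pose psi (s : R) : R := f ((x + t *: v) + s *: u) - f (x + s *: u).
have dpsi s : 0 <= s <= t ->
    is_derive s 1 psi (h ((x + t *: v) + s *: u) - h (x + s *: u)).
  move=> st; apply: is_deriveB; apply: is_derive_line.
    rewrite -addrA; apply: H2; rewrite addrC.
    by have := bnd s t st; rewrite lexx ltW// lt_min => /(_ isT)/andP[].
  apply: H2; have := bnd s 0 st; rewrite lexx ltW// scale0r addr0 lt_min.
  by move=> /(_ isT)/andP[].
have [||c ctt E] := @MVT R psi
    (fun s => h ((x + t *: v) + s *: u) - h (x + s *: u)) 0 t t0.
- by move=> s; rewrite in_itv/= => /andP[s0 st]; apply: dpsi; rewrite !ltW.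
- apply: derivable_within_continuous => s; rewrite in_itv/= => st.
  by have [] := dpsi s st.
have ct : 0 <= c <= t by move: ctt; rewrite in_itv/= => /andP[? ?]; rewrite !ltW.
have -> : f (x + t *: u + t *: v) - f (x + t *: u) - f (x + t *: v) + f x
    = psi t - psi 0.
  rewrite /psi scale0r !addr0 [x + t *: v + _]addrAC; ring.
rewrite E subr0.
have t00 : 0 <= t <= t by rewrite lexx ltW.
have z00 : 0 <= (0 : R) <= t by rewrite lexx ltW.
have A := H1 (c *: u + t *: v) _.
have B := H1 (c *: u) _.
have {A} A : `|h (x + t *: v + c *: u) - h x - 'd h x (c *: u + t *: v)|
    <= e1 * `|c *: u + t *: v|.
  rewrite -[x + _ + _]addrA [t *: v + _]addrC; apply: A.
  by have := bnd c t ct t00; rewrite lt_min => /andP[].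
have {B} B : `|h (x + c *: u) - h x - 'd h x (c *: u)| <= e1 * `|c *: u|.
  apply: B; have := bnd c 0 ct z00.
  by rewrite scale0r addr0 lt_min => /andP[].
rewrite (deriveE _ du).
have dl1 : 'd h x (c *: u + t *: v) = c * 'd h x u + t * 'd h x v.
  by rewrite linearD !linearZ.
have dl2 : 'd h x (c *: u) = c * 'd h x u by rewrite linearZ.
rewrite dl1 in A; rewrite dl2 in B.
move: A B; set p := h (x + _ + _); set q := h (x + _).
set du' := 'd h x u; set dv' := 'd h x v => A B.
have -> : (p - q) * t - t ^+ 2 * dv' =
   t * ((p - h x - (c * du' + t * dv')) - (q - h x - c * du')) by ring.
rewrite normrM gtr0_norm// expr2 mulrA [e * t]mulrC -mulrA ler_pM2l//.
apply: (le_trans (ler_normB _ _)); apply: (le_trans (lerD A B)).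
have N : `|c *: u + t *: v| + `|c *: u| <= t * (2 * `|u| + `|v| + 1).
  have n1 := ler_normD (c *: u) (t *: v); rewrite !normrZ (gtr0_norm t0) in n1 *.
  have n2 : `|c| * `|u| <= t * `|u|.
    by apply: ler_wpM2r => //; case/andP: ct => ? ?; rewrite ger0_norm.
  by rewrite !mulrDr; lra.
rewrite -mulrDr; apply: (le_trans (ler_wpM2l (ltW e10) N)).
by rewrite /e1 [t * _]mulrC mulrA divfK ?gt_eqF// mulrC.
Unshelve. all: by end_near. Qed.

Lemma schwarz f (x u v : V) :
  (\forall y \near x, differentiable f y) -> differentiable ('D_u f) x ->
  differentiable ('D_v f) x -> 'D_v ('D_u f) x = 'D_u ('D_v f) x.
Proof.
move=> df du dv; apply/eqP; rewrite -subr_eq0 -normr_eq0 eq_le normr_ge0 andbT.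
apply/ler_addgt0Pl => e e0; rewrite addr0.
have e2 : 0 < e / 2 by rewrite divr_gt0.
have HA := second_difference v df du e2.
have HB := second_difference u df dv e2.
(* The second difference is symmetric in [u] and [v], so at one common [t] both mixed derivatives
   approximate the same number, each with error [e / 2 * t ^+ 2]. *)
have [t [t0 [A B]]] := filter_ex (filterI (nbhs_right_gt 0) (filterI HA HB)).
rewrite /= in t0.
rewrite -(ler_pM2r (exprn_gt0 2 t0)) -{1}[t ^+ 2]gtr0_norm ?exprn_gt0//.
rewrite -normrM.
set a := 'D_v _ x in A *; set b := 'D_u _ x in B *.
rewrite [x + t *: v + t *: u]addrAC in B.
set p := f _ in A B; set q := f (x + t *: u) in A B *.
set r := f (x + t *: v) in A B *.
have -> : (a - b) * t ^+ 2 = (p - r - q + f x - t ^+ 2 * b)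
   - (p - q - r + f x - t ^+ 2 * a) by ring.
apply: (le_trans (ler_normB _ _)); apply: (le_trans (lerD B A)).
by rewrite -mulrDl -splitr.
Qed.

End Schwarz.

(** * Smooth bump functions *)

Section Bump.
Context {R : realType}.

(** The flat function exp(-1/t) with a power of 1/t in front: the family indexed by [n] spans a
    space closed under differentiation, which makes an induction on the order possible. *)
Definition expflat (n : nat) (t : R) : R :=
  if 0 < t then t^-1 ^+ n * expR (- t^-1) else 0.

Lemma expflat_ge0 n t : 0 <= expflat n t.
Proof.
rewrite /expflat; case: ifP => // t0.
by rewrite mulr_ge0 ?expR_ge0// exprn_ge0// invr_ge0 ltW.
Qed.

(** One term of the exponential series at s = 1/t gives exp(s) >= s^(n+2) / (n+2)!. The two spare
    powers of t make the function flat enough at 0 for [is_derive_quad]. *)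
Lemma expflat_le n t : expflat n t <= n.+2`!%:R * t ^+ 2.
Proof.
rewrite /expflat; case: ifP => [t0|_]; last by rewrite mulr_ge0// sqr_ge0.
have s0 : 0 < t^-1 by rewrite invr_gt0.
have := expR_ge1Dxn n.+1 (ltW s0).
set N := n.+2`!%:R => H.
have N0 : 0 < N by rewrite ltr0n fact_gt0.
have {}H : t^-1 ^+ n.+2 / N <= expR t^-1.
  by apply: le_trans H; rewrite lerDr.
rewrite expRN ler_pdivrMr ?expR_gt0//.
have -> : t^-1 ^+ n = (N * t ^+ 2) * (t^-1 ^+ n.+2 / N).
  rewrite -(addn2 n) exprD; move: (t^-1 ^+ n) => a; rewrite exprVn; field.
  by rewrite !gt_eqF.
by rewrite ler_pM2l// mulr_gt0// exprn_gt0.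
Qed.

Lemma is_derive_quad (f : R -> R) (C : R) :
  (forall t, `|f t| <= C * t ^+ 2) -> is_derive (0 : R) (1 : R) f 0.
Proof.
move=> H.
have f0 : f 0 = 0 by apply/eqP; rewrite -normr_le0 (le_trans (H 0))// expr0n mulr0.
have C0 : 0 <= C by have := H 1; rewrite expr1n mulr1; apply: le_trans.
suff L : h^-1 *: (f (h *: 1 + 0) - f 0) @[h --> 0^'] --> (0 : R).
  by apply: DeriveDef; [apply/cvg_ex; exists 0|apply/cvg_lim].
apply/cvgrPdist_le => e e0; near=> h.
have h0 : h != 0 by near: h; exact: nbhs_dnbhs_neq.
rewrite f0 subr0 addr0 sub0r normrN /GRing.scale/= mulr1 normrM normfV.
rewrite ler_pdivrMl ?normr_gt0//; apply: (le_trans (H h)).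
rewrite -real_normK ?num_real// expr2 mulrCA ler_pM2l ?normr_gt0//.
apply: (@le_trans _ _ ((C + 1) * `|h|)); first by rewrite ler_wpM2r// lerDl.
rewrite -ler_pdivlMl; last by rewrite ltr_wpDl.
near: h; apply: dnbhs0_le; rewrite mulr_gt0// invr_gt0 ltr_wpDl//.
Unshelve. all: by end_near. Qed.

Lemma is_derive_expflat n t :
  is_derive (t : R) (1 : R) (expflat n) (- n%:R * expflat n.+1 t + expflat n.+2 t).
Proof.
have [t0|t0|->] := ltgtP t 0.
- have -> : - n%:R * expflat n.+1 t + expflat n.+2 t = 0.
    by rewrite /expflat ltNge (ltW t0)/= mulr0 addr0.
  apply: (@near_eq_is_derive _ _ _ (cst 0)).
  near=> s; have : s < 0 by near: s; exact: lt_nbhsl.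
  by move=> /ltW s0; rewrite /expflat ltNge s0.
- have eqf : \near t, (fun s : R => s^-1 ^+ n * expR (- s^-1)) t = expflat n t.
    near=> s; have : 0 < s by near: s; exact: lt_nbhsr.
    by rewrite /expflat => ->.
  have tn : t != 0 by rewrite gt_eqF.
  rewrite /expflat t0.
  have dV : is_derive (t : R) (1 : R) (fun s : R => s^-1) (- (t^-1 ^+ 2)).
    have dd : derivable (fun s : R => s^-1) t 1.
      by apply: (@derivableV _ _ id) => //; exact: derivable_id.
    apply: DeriveDef => //; rewrite (@deriveV _ _ id)//.
    by rewrite derive_id /GRing.scale/= mulr1 exprVn.
  have dE : is_derive (t : R) (1 : R) (fun s : R => expR (- s^-1)) (t^-1 ^+ 2 * expR (- t^-1)).
    have d1 : is_derive (t : R) (1 : R) (fun s : R => - s^-1) (t^-1 ^+ 2).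
      by rewrite -[t^-1 ^+ 2]opprK; exact: is_deriveN.
    have := @is_derive1_comp R expR (fun s : R => - s^-1) t _ _ (is_derive_expR _) d1.
    by rewrite mulrC.
  have dX : is_derive (t : R) (1 : R) (fun s : R => s^-1 ^+ n) (- n%:R * t^-1 ^+ n.+1).
    have -> : (fun s : R => s^-1 ^+ n) = (fun s : R => s^-1) ^+ n.
      by apply/funext => s; rewrite exprfctE.
    have := is_deriveX n dV.
    move=> H; apply: (is_derive_eq H); rewrite /GRing.scale/=.
    case: n {H eqf} => [|n]; first by rewrite oppr0 !mul0r.
    by rewrite [n.+1.-1]/= !exprS; ring.
  apply: (near_eq_is_derive eqf); apply: (is_derive_eq (is_deriveM dX dE)).
  by rewrite /GRing.scale/= !exprS; ring.
(* At the gluing point the formula takes the value 0, which is also the derivative of a function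
   dominated by a multiple of [t ^+ 2]. *)
- have -> : - n%:R * expflat n.+1 0 + expflat n.+2 0 = 0.
    by rewrite /expflat ltxx mulr0 addr0.
  apply: (@is_derive_quad _ (n.+2`!%:R)) => s.
  by rewrite ger0_norm ?expflat_ge0// expflat_le.
Unshelve. all: by end_near. Qed.

Lemma diffn_expflat k n : diffn k [set: R] (expflat n).
Proof.
elim: k n => //= k IH n.
have df x : differentiable (expflat n) x.
  by apply/derivable1_diffP; have [] := is_derive_expflat n x.
split=> [x _|v]; first exact: df.
apply: (@diffn_eq _ _ _ _ _ _ (fun t => v * (- n%:R * expflat n.+1 t + expflat n.+2 t))).
- exact: openT.
- move=> t _; rewrite -[v]mulr1 -[v * 1]/(v *: 1) deriveE// linearZ/= -deriveE//.
  by rewrite (@derive_val _ _ _ _ _ _ _ (is_derive_expflat n t)) /GRing.scale/= mulr1.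
apply: diffnM; [exact: openT|exact: diffn_cst|apply: diffnD; first exact: openT].
  by apply: diffnM; [exact: openT|exact: diffn_cst|exact: IH].
exact: IH.
Qed.

(** The denominator is positive, since [t] and [1 - t] are never both nonpositive. *)
Definition smoothstep (t : R) : R := expflat 0 t / (expflat 0 t + expflat 0 (1 - t)).

Lemma expflat_gt0 n t : 0 < t -> 0 < expflat n t.
Proof.
by move=> t0; rewrite /expflat t0 mulr_gt0 ?expR_gt0// exprn_gt0// invr_gt0.
Qed.

Lemma smoothstep0 t : t <= 0 -> smoothstep t = 0.
Proof. by move=> t0; rewrite /smoothstep {1}/expflat ltNge t0/= mul0r. Qed.

Lemma smoothstep1 t : 1 <= t -> smoothstep t = 1.
Proof.
move=> t1; rewrite /smoothstep [expflat 0 (1 - t)]/expflat ltNge subr_le0 t1/=.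
by rewrite addr0 divff// gt_eqF// expflat_gt0// (lt_le_trans ltr01).
Qed.

Lemma diffn_smoothstep k : diffn k [set: R] smoothstep.
Proof.
have d1 : diffn k [set: R] (fun t => expflat 0 (1 - t)).
  apply: (@diffn_comp R R R R cbasisR cbasisR k setT setT (fun t : R => 1 - t) (expflat 0)) => //.
  - exact: openT.
  - apply: diffnD; [exact: openT|exact: diffn_cst|].
    apply: (@diffn_clinear _ _ _ _ _ _ id -%R); first exact: openT.
      exact: opp_continuous.
    by apply: (@diffn_lin _ _ _ _ _ idfun) => x; exact: cvg_id.
  - exact: diffn_expflat.
apply: diffnM; [exact: openT|exact: diffn_expflat|].
apply: diffnV; first exact: openT.
  move=> t _; rewrite gt_eqF//; have [t0|t0] := ltP 0 t.
    by rewrite ltr_pwDl ?expflat_gt0 ?expflat_ge0.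
  by rewrite ltr_wpDl ?expflat_ge0// expflat_gt0// subr_gt0 (le_lt_trans t0).
by apply: diffnD => //; [exact: openT|exact: diffn_expflat].
Qed.

(** The norm of row vectors is the sup norm, which is not smooth, so the bump is built on the
    Euclidean square [q]. The support is still enclosed in a sup-norm ball, because the square of
    each coordinate difference is at most [q]. *)
Lemma exists_smooth_bump m (x0 : 'rV[R]_m) (U : set 'rV[R]_m) : open U -> U x0 ->
  exists (b : 'rV[R]_m -> R) (K : set 'rV[R]_m),
    [/\ compact K /\ K `<=` U, forall x, ~ K x -> b x = 0, smooth_on setT b &
        exists V, [/\ open V, V x0 & forall x, V x -> b x = 1]].
Proof.
move=> oU Ux0.
have /nbhs_ballP[e /= e0 eU] := open_nbhs_nbhs (conj oU Ux0).
have e20 : 0 < e / 2 by rewrite divr_gt0.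
pose q (x : 'rV[R]_m) : R := \sum_i (x 0 i - x0 0 i) * (x 0 i - x0 0 i).
pose rho := (e / 2) ^+ 2 / 2.
have rho0 : 0 < rho by rewrite divr_gt0// exprn_gt0.
have dq k : diffn k setT q.
  apply: diffn_sum; first exact: openT.
  move=> i _.
  have dc : diffn k [set: 'rV[R]_m] (fun x => x 0 i - x0 0 i).
    apply: diffnD; [exact: openT| |exact: diffn_cst].
    apply: (@diffn_lin _ _ _ _ _ [the {linear 'rV[R]_m -> R} of rcoord i]).
    exact: coord_continuous.
  by apply: diffnM => //; exact: openT.
(* This is 1 for [q x <= rho] and 0 for [q x >= 2 * rho]; the choice of [rho] makes [2 * rho] the
   square of the radius of [K]. *)
pose b x := smoothstep (2 - rho^-1 * q x).
exists b, (closed_ball x0 (e / 2)); split.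
- split; last first.
    apply: subset_trans eU; apply: closed_ball_subset => //=.
    by rewrite ltr_pdivrMr// ltr_pMr// ltr1n.
  apply: bounded_closed_compact; last exact: closed_ball_closed.
  rewrite /bounded_near/=; near=> N => x /=; rewrite closed_ballE//= /closed_ball_/= => xe.
  have -> : x = x0 - (x0 - x) by rewrite opprB addrC subrK.
  apply: (le_trans (ler_normB _ _)); apply: (le_trans (lerD (lexx _) xe)).
  by near: N; apply: nbhs_pinfty_ge; rewrite num_real.
- move=> x Kx; rewrite /b smoothstep0// subr_le0 ler_pdivlMl//.
  rewrite leNgt; apply/negP => qlt; apply: Kx.
  rewrite closed_ballE//= /closed_ball_/=.
  rewrite [leLHS]/Num.Def.normr/= mx_normrE (bigmax_le _ (ltW e20))//= => -[i j] _.
  rewrite !mxE/= distrC (ord1 i) -[leRHS](ger0_norm (ltW e20)) -ler_sqr ?nnegrE//.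
  rewrite !real_normK ?num_real//.
  apply: le_trans (_ : q x <= _).
    rewrite /q (bigD1 j)//= expr2 lerDl; apply: sumr_ge0 => l _.
    by rewrite -expr2 sqr_ge0.
  by apply/ltW/(lt_le_trans qlt); rewrite /rho divfK.
- move=> k; apply: (@diffn_comp R _ _ _ cbasisR cbasisR k setT setT
    (fun x => 2 - rho^-1 * q x) smoothstep) => //.
  + exact: openT.
  + apply: diffnD; [exact: openT|exact: diffn_cst|].
    apply: (@diffn_clinear _ _ _ _ _ _ (fun x => rho^-1 * q x) -%R).
    * exact: openT.
    * exact: opp_continuous.
    * by apply: diffnM; [exact: openT|exact: diffn_cst|exact: dq].
  + exact: diffn_smoothstep.
exists [set x | q x < rho]; split.
- apply: (@open_comp _ _ q [set y | y < rho]); last exact: open_lt.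
  by move=> x _; apply: differentiable_continuous; have [+ _] := dq 1%N; apply.
- by rewrite /= /q big1// => i _; rewrite subrr mulr0.
- move=> x /= qx; rewrite /b smoothstep1// lerBrDl -lerBrDr ler_pdivrMl//.
  by rewrite (_ : 2 - 1 = 1) ?mulr1 ?ltW//; ring.
Unshelve. all: by end_near. Qed.

End Bump.

(** * Smooth atlases *)

Section Atlas.
Context {R : realType} {V : normedModType R} {T : Type} (A : charts V T).

(** What [M] and the slit bundle have in common. [T] carries no topology, so openness is required of
    the coordinate images of the overlaps. *)
Definition smooth_atlas : Prop :=
  [/\ forall p, chart_dom (chart_at A p) p,
      forall a : idx A, {in chart_dom a &, injective (chart_coord a)},
      forall a b : idx A, open (chart_coord a @` (chart_dom a `&` chart_dom b)) &
      forall a b : idx A,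
        smooth_on (chart_coord a @` (chart_dom a `&` chart_dom b)) (rep a (chart_coord b))].

Hypothesis atlasA : smooth_atlas.
Implicit Types (a b c : idx A) (p q : T) (W : normedModType R).

Lemma chart_atP p : chart_dom (chart_at A p) p.
Proof. by case: atlasA => h _ _ _; exact: h. Qed.

Lemma repE W a (f : T -> W) p : chart_dom a p -> rep a f (chart_coord a p) = f p.
Proof.
move=> ap; rewrite /rep; case: xgetP => [w _ [q [aq + ->]]|/(_ (f p))].
  by case: atlasA => _ inj _ _ /inj -> //; rewrite inE.
by case; exists p.
Qed.

Lemma overlap_open a b : open (chart_coord a @` (chart_dom a `&` chart_dom b)).
Proof. by case: atlasA. Qed.

Lemma img_open a : open (img a).
Proof. by rewrite /img -[chart_dom a]setIid; exact: overlap_open. Qed.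

Lemma img_chart a p : chart_dom a p -> img a (chart_coord a p).
Proof. by move=> ap; exists p. Qed.

Lemma transition_smooth a b :
  smooth_on (chart_coord a @` (chart_dom a `&` chart_dom b)) (rep a (chart_coord b)).
Proof. by case: atlasA. Qed.

Lemma transition_diff a b p : chart_dom a p -> chart_dom b p ->
  differentiable (rep a (chart_coord b)) (chart_coord a p).
Proof.
by move=> ap bp; have [+ _] := @transition_smooth a b 1%N; apply; exists p.
Qed.

Lemma near_overlap a b p : chart_dom a p -> chart_dom b p ->
  nbhs (chart_coord a p) (chart_coord a @` (chart_dom a `&` chart_dom b)).
Proof.
by move=> ap bp; apply: open_nbhs_nbhs; split; [exact: overlap_open|exists p].
Qed.

(** On the overlap [rep a f] is [rep b f] after the transition map; the chain rule then says that
    derivatives along a tangent vector do not depend on the chart. *)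
Lemma derive_rep W a b (f : T -> W) p w : chart_dom a p -> chart_dom b p ->
  differentiable (rep b f) (chart_coord b p) ->
  'D_w (rep a f) (chart_coord a p) =
  'D_('D_w (rep a (chart_coord b)) (chart_coord a p)) (rep b f) (chart_coord b p).
Proof.
move=> ap bp df.
have E : \forall x \near chart_coord a p,
    rep a f x = rep b f (rep a (chart_coord b) x).
  apply: filterS (near_overlap ap bp) => _ [q [aq bq] <-].
  by rewrite !repE.
rewrite (near_eq_derive _ E) derive_comp ?repE//.
exact: transition_diff.
Qed.

Lemma derive_rep_chart a p w : chart_dom a p ->
  'D_w (rep a (chart_coord a)) (chart_coord a p) = w.
Proof.
move=> ap.
have E : \forall x \near chart_coord a p, rep a (chart_coord a) x = id x.
  by apply: filterS (near_overlap ap ap) => _ [q [aq _] <-]; rewrite repE.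
by rewrite (near_eq_derive _ E) derive_id.
Qed.

Lemma tangentE p v a b : tangent A p v -> chart_dom a p -> chart_dom b p ->
  v b = 'D_(v a) (rep a (chart_coord b)) (chart_coord a p).
Proof. by case=> _ H; exact: H. Qed.

Lemma tangent_out p v a : tangent A p v -> ~ chart_dom a p -> v a = 0.
Proof. by case=> H _; exact: H. Qed.

Lemma tangent_inj p v w a : tangent A p v -> tangent A p w -> chart_dom a p ->
  v a = w a -> v = w.
Proof.
move=> tv tw ap vw; apply/funext => b.
have [bp|bp] := pselect (chart_dom b p).
  by rewrite (tangentE tv ap bp) (tangentE tw ap bp) vw.
by rewrite !(@tangent_out p).
Qed.

Lemma tangent_linear p v w (c : R) :
  tangent A p v -> tangent A p w -> tangent A p (c *: v + w).
Proof.
move=> tv tw; split=> [a ap|a b ap bp].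
  by rewrite !fctE (tangent_out tv ap) (tangent_out tw ap) scaler0 addr0.
rewrite !fctE derive_linear; last exact: transition_diff.
by rewrite -(tangentE tv) // -(tangentE tw).
Qed.

Lemma tangent0 p : tangent A p 0.
Proof.
split=> // a b ap bp.
by rewrite -[(0 : fam A) a]/(0 : V) -[(0 : fam A) b]/(0 : V) derive0.
Qed.

Lemma tangentD p v w : tangent A p v -> tangent A p w -> tangent A p (v + w).
Proof. by move=> tv tw; have := tangent_linear 1 tv tw; rewrite scale1r. Qed.

Lemma tangentZ p v (c : R) : tangent A p v -> tangent A p (c *: v).
Proof. by move=> tv; have := tangent_linear c tv (tangent0 p); rewrite addr0. Qed.

Lemma tangentN p v : tangent A p v -> tangent A p (- v).
Proof. by move=> tv; rewrite -scaleN1r; exact: tangentZ. Qed.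

Lemma tangentB p v w : tangent A p v -> tangent A p w -> tangent A p (v - w).
Proof. by move=> tv tw; apply: tangentD => //; exact: tangentN. Qed.

Lemma tangent_sum p (I : Type) (r : seq I) (P : pred I) (F : I -> fam A) :
  (forall i, P i -> tangent A p (F i)) -> tangent A p (\sum_(i <- r | P i) F i).
Proof.
by move=> H; elim/big_ind: _ => //; [exact: tangent0|exact: tangentD].
Qed.

Lemma tvecE a b p w : chart_dom b p ->
  tvec a p w b = 'D_w (rep a (chart_coord b)) (chart_coord a p).
Proof. by move=> bp; rewrite /tvec asboolT. Qed.

Lemma tvec_chart a p w : chart_dom a p -> tvec a p w a = w.
Proof. by move=> ap; rewrite tvecE// derive_rep_chart. Qed.

Lemma tangent_tvec a p w : chart_dom a p -> tangent A p (tvec a p w).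
Proof.
move=> ap; split=> [b bp|b c bp cp]; first by rewrite /tvec asboolF.
by rewrite !tvecE// (derive_rep _ ap bp)//; exact: transition_diff.
Qed.

Lemma smooth_fun_diff W (f : T -> W) a p : smooth_fun A f -> chart_dom a p ->
  differentiable (rep a f) (chart_coord a p).
Proof. by move=> /(_ a 1%N)[+ _] ap; apply; exact: img_chart. Qed.

Lemma actE (X : T -> fam A) (f : T -> R) a p : smooth_fun A f ->
  tangent A p (X p) -> chart_dom a p ->
  act X f p = 'D_(X p a) (rep a f) (chart_coord a p).
Proof.
move=> sf tX ap; have cp := chart_atP p.
rewrite /act (derive_rep _ cp ap); last exact: smooth_fun_diff.
by rewrite -(tangentE tX).
Qed.

Lemma actD (X : T -> fam A) (f g : T -> R) p : smooth_fun A f -> smooth_fun A g ->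
  act X (fun q => f q + g q) p = act X f p + act X g p.
Proof.
move=> sf sg; rewrite /act; set c := chart_at A p; have cp := chart_atP p.
have E : \forall x \near chart_coord c p, rep c (fun q => f q + g q) x =
    (rep c f + rep c g) x.
  by apply: filterS (near_overlap cp cp) => _ [q [aq _] <-]; rewrite fctE !repE.
rewrite (near_eq_derive _ E) deriveD//; apply: diff_derivable; exact: smooth_fun_diff.
Qed.

Lemma bracketE (X Y : T -> fam A) a p : chart_dom a p ->
  bracket X Y p a =
    'D_(X p a) (rep a (fun q => Y q a)) (chart_coord a p)
    - 'D_(Y p a) (rep a (fun q => X q a)) (chart_coord a p).
Proof. by move=> ap; rewrite /bracket asboolT. Qed.

Lemma rep_smooth W a (f : T -> W) (g : V -> W) :
  smooth_on (img a) g -> (forall p, chart_dom a p -> f p = g (chart_coord a p)) ->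
  smooth_on (img a) (rep a f).
Proof.
move=> sg fg k; apply: diffn_eq (sg k); first exact: img_open.
by move=> _ /set_mem[p ap <-]; rewrite repE// fg.
Qed.

Lemma sectionD (X Y : T -> fam A) : section A (tangent A) X ->
  section A (tangent A) Y -> section A (tangent A) (X + Y).
Proof.
move=> [tX sX] [tY sY]; split=> [p|a]; first exact: tangentD.
apply: (@rep_smooth _ _ _
  (fun x => rep a (fun p => X p a) x + rep a (fun p => Y p a) x)) => [k|p ap].
  by apply: diffnD; [exact: img_open|exact: sX|exact: sY].
by rewrite !repE.
Qed.

Lemma sectionN (X : T -> fam A) : section A (tangent A) X ->
  section A (tangent A) (- X).
Proof.
move=> [tX sX]; split=> [p|a]; first exact: tangentN.
apply: (@rep_smooth _ _ _ (fun x => - rep a (fun p => X p a) x)) => [k|p ap].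
  apply: (@diffn_clinear _ _ _ _ _ _ _ -%R); [exact: img_open| |exact: sX].
  exact: opp_continuous.
by rewrite !repE.
Qed.

Lemma sectionB (X Y : T -> fam A) : section A (tangent A) X ->
  section A (tangent A) Y -> section A (tangent A) (X - Y).
Proof. by move=> sX sY; apply: sectionD => //; exact: sectionN. Qed.

Variable (bV : cbasis V).

(** Smoothness in the chart [a] may be tested near each point in any other chart [b]: the local
    expression is pulled back by the transition map on [U'], the open set of points which it sends
    into [O]. *)
Lemma smooth_rep W (bW : cbasis W) a (f : T -> W) :
  (forall p, chart_dom a p -> exists b O (g : V -> W),
    [/\ chart_dom b p, open O, O (chart_coord b p) & smooth_on O g /\
      forall q, chart_dom a q -> chart_dom b q -> O (chart_coord b q) ->
        f q = g (chart_coord b q)]) ->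
  smooth_on (img a) (rep a f).
Proof.
move=> H k; apply: diffn_local => _ [p ap <-].
have [b [ O [g [bp oO Op [sg fg]]]]] := H p ap.
pose U' := chart_coord a @` (chart_dom a `&` chart_dom b) `&`
  (rep a (chart_coord b) @^-1` O).
have oU' : open U'.
  rewrite openE => _ [[q [aq bq] <-]]; rewrite /preimage/= repE// => Oq.
  apply: filterI; first exact: near_overlap.
  have := differentiable_continuous (transition_diff aq bq).
  by apply; rewrite repE//; apply: open_nbhs_nbhs.
exists U', (fun x => g (rep a (chart_coord b) x)); split=> //.
- by split; [exists p|rewrite /= repE].
- apply: (@diffn_comp _ _ _ _ bV bW _ U' O) => //; first by move=> x [].
  by apply: (@diffn_subset _ _ _ _ _ _ _ _ (@transition_smooth a b k)) => x [].
- move=> x /set_mem [[q [aq bq] <-]]; rewrite /= !repE// => Oq; exact: fg.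
Qed.

(** One chart around each point suffices: in another chart the components are combinations of the
    partial derivatives of the transition map, with the smooth components [xi] as coefficients. This
    is what allows a section to be glued from pieces. *)
Lemma smooth_section (X : T -> fam A) : (forall p, tangent A p (X p)) ->
  (forall p, exists b O (xi : V -> V),
    [/\ chart_dom b p, open O, O (chart_coord b p) & smooth_on O xi /\
      forall q, chart_dom b q -> O (chart_coord b q) -> X q b = xi (chart_coord b q)]) ->
  section A (tangent A) X.
Proof.
move=> tX H; split=> // a; apply: (smooth_rep bV) => p ap.
have [b [ O [xi [bp oO Op [sxi Xxi]]]]] := H p.
exists b, (O `&` chart_coord b @` (chart_dom b `&` chart_dom a)),
  (fun x => \sum_i cbc bV i (xi x) *: 'D_(cbe bV i) (rep b (chart_coord a)) x).
have oO' : open (O `&` chart_coord b @` (chart_dom b `&` chart_dom a)).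
  by apply: openI => //; exact: overlap_open.
split=> //.
- by split=> //; exists p.
- split=> [k|q aq bq [Oq _]].
    apply: diffn_sum => // i _; apply: (diffnZ bV) => //.
      apply: diffn_clinear => //; first exact: cbc_cont.
      by apply: diffn_subset (sxi k) => x [].
    have [_ /(_ (cbe bV i))] := @transition_smooth b a k.+1.
    by apply: diffn_subset => x [].
  rewrite (tangentE (tX q) bq aq) (Xxi q bq Oq) {1}(cbE bV (xi _)).
  by rewrite derivev_sum//; exact: transition_diff.
Qed.

End Atlas.

(** * The slit tangent bundle *)

Section LineDerivatives.
Context {R : realType} {V W : normedModType R}.

Lemma near0_line (P : V -> Prop) (z v : V) :
  (\forall y \near z, P y) -> \forall t \near (0 : R), P (t *: v + z).
Proof.
move=> Pz; have c : {for (0 : R), continuous (fun t : R => t *: v + z)}.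
  apply: continuousD; first exact: scalel_continuous.
  exact: cst_continuous.
by apply: (c P); rewrite scale0r add0r.
Qed.

(** Agreement on a line through [z] is enough, not on a neighbourhood. This permits freezing [y]
    when differentiating along the base, and freezing [x] when differentiating along the fibre. *)
Lemma derive_line_eq (f g : V -> W) (z v : V) :
  (\forall t \near (0 : R), f (t *: v + z) = g (t *: v + z)) ->
  'D_v f z = 'D_v g z.
Proof.
move=> fg; have fz : f z = g z by have := nbhs_singleton fg; rewrite scale0r add0r.
rewrite /derive; congr (lim _).
rewrite eqEsubset; split; apply/near_eq_cvg/cvg_within; apply: filterS fg => t /=;
by rewrite fz => ->.
Qed.

Lemma derive_line_affine (f : V -> W) (z v : V) (c : W) :
  (\forall t \near (0 : R), f (t *: v + z) = f z + t *: c) -> 'D_v f z = c.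
Proof.
move=> fE; rewrite /derive; apply/cvg_lim => //.
apply: cvg_trans (@cvg_cst _ c _ (0^') _).
apply: near_eq_cvg; near=> t.
have tn : t != 0 by near: t; exact: nbhs_dnbhs_neq.
rewrite /= (_ : f (t *: v + z) = f z + t *: c); last by near: t; exact: cvg_within fE.
by rewrite addrC addKr scalerA mulVf// scale1r.
Unshelve. all: by end_near. Qed.

End LineDerivatives.

(** * The induced atlas of the slit tangent bundle *)

Section Basics.
Context {R : realType} {m : nat} {M : topologicalType} {A : charts 'rV[R]_m M}.
Local Notation E := ('rV[R]_m * 'rV[R]_m)%type.
Context {M' : set (TM A)}.
Hypothesis manA : smooth_manifold A.
Hypothesis slitM' : open_slit_subset M'.
Implicit Types (a b c : idx A) (u : slit M').
Local Notation SA := (scharts M').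
Local Notation sdom a := (chart_dom (c := SA) a).
Local Notation sco a := (chart_coord (c := SA) a).

Definition bE : cbasis E := cbasis_prod (cbasis_rV m) (cbasis_rV m).

Lemma manifold_atlas : smooth_atlas A.
Proof.
case: manA => _ _ cat cax sm; split=> //.
- by move=> a; case: (cax a).
- move=> a b; have [oa _ _ H] := cax a; have [ob _ _ _] := cax b.
  by apply: H; [exact: openI|move=> x []].
Qed.

Lemma continuous_fstE : continuous (fst : E -> 'rV[R]_m).
Proof. by move=> z; exact: cvg_fst. Qed.
Lemma continuous_sndE : continuous (snd : E -> 'rV[R]_m).
Proof. by move=> z; exact: cvg_snd. Qed.

Lemma differentiable_fstE (z : E) : differentiable (fst : E -> 'rV[R]_m) z.
Proof.
exact/(@linear_differentiable _ _ _ [the {linear E -> 'rV[R]_m} of fst])/continuous_fstE.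
Qed.

Lemma derive_fstE (z v : E) : 'D_v (fst : E -> 'rV[R]_m) z = v.1.
Proof.
rewrite deriveE; last exact: differentiable_fstE.
by rewrite (@diff_lin _ _ _ [the {linear E -> 'rV[R]_m} of fst])//; exact: continuous_fstE.
Qed.

(* The change of induced coordinates [(x, y) |-> (phi x, D_y phi x)]. *)
Definition lift_map (phi : 'rV[R]_m -> 'rV[R]_m) (z : E) : E :=
  (phi z.1, \sum_i z.2 0 i *: 'D_(delta_mx 0 i) phi z.1).

Lemma lift_mapE phi (z : E) : differentiable phi z.1 ->
  lift_map phi z = (phi z.1, 'D_(z.2) phi z.1).
Proof.
by move=> d; rewrite /lift_map -derivev_sum// -row_sum_delta.
Qed.

Lemma lift_map_smooth phi (U : set 'rV[R]_m) (U' : set E) : open U' ->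
  (forall z, U' z -> U z.1) -> smooth_on U phi -> smooth_on U' (lift_map phi).
Proof.
move=> oU UU sphi k.
have comp1 (f : 'rV[R]_m -> 'rV[R]_m) : diffn k U f -> diffn k U' (fun z => f z.1).
  move=> df; apply: (@diffn_comp _ _ _ _ (cbasis_rV m) (cbasis_rV m) k U' U fst f) => //.
  apply: (@diffn_lin _ _ _ _ _ [the {linear E -> 'rV[R]_m} of fst]).
  exact: continuous_fstE.
apply: diffn_pair => //; first exact: comp1.
apply: diffn_sum => // i _; apply: (diffnZ (cbasis_rV m)) => //.
  apply: (@diffn_clinear _ _ _ _ _ _ snd [the {linear 'rV[R]_m -> R} of rcoord i]) => //.
    exact: coord_continuous.
  apply: (@diffn_lin _ _ _ _ _ [the {linear E -> 'rV[R]_m} of snd]).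
  exact: continuous_sndE.
by apply: (comp1 ('D_(delta_mx 0 i) phi)); have [_] := sphi k.+1; apply.
Qed.

Lemma scoE a u : sco a u = (chart_coord a (base_proj u), vec (sval u) a).
Proof. by []. Qed.

(** The slit condition and the overlap condition separate; the latter only concerns x, so openness
    follows from that of the image of [M'] and of the overlap in the base. *)
Lemma overlapE a b : sco a @` (sdom a `&` sdom b) =
  tcoord a @` (M' `&` tdom a) `&` [set z | (chart_coord a @` (chart_dom a `&` chart_dom b)) z.1].
Proof.
apply/seteqP; split=> z /=.
  move=> [[u Mu] [au bu] <-]; split; first by exists u.
  by exists (base u).
move=> [[u [Mu au] <-] [p [ap bp] /= pu]].
exists (exist _ u Mu) => //; split=> //=; rewrite /tdom/=.
have [_ inj _ _] := manifold_atlas.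
by rewrite -(inj a p (base u)) ?inE.
Qed.

Lemma soverlap_open a b : open (sco a @` (sdom a `&` sdom b)).
Proof.
rewrite overlapE; apply: openI; first by case: slitM' => _ + _ _; apply.
apply: (@open_comp _ _ fst (chart_coord a @` (chart_dom a `&` chart_dom b))).
  by move=> z _; exact: continuous_fstE.
exact: (overlap_open manifold_atlas).
Qed.

Lemma rep_transition a b u : sdom a u -> sdom b u ->
  sco b u = lift_map (rep a (chart_coord b)) (sco a u).
Proof.
move=> au bu; rewrite lift_mapE; last exact: (transition_diff manifold_atlas).
rewrite !scoE/= (repE manifold_atlas)//.
by rewrite (tangentE (vec_tangent (sval u)) au bu).
Qed.

(** The coordinate y is a single component of the tangent vector, but the other components follow
    from it; what remains of a point of [slit M'] are proofs. *)
Lemma slit_inj a : {in sdom a &, injective (sco a)}.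
Proof.
move=> [[p v tv] Mu] [[q w tw] Mw]; rewrite !inE => ap aq [].
rewrite /tdom/= in ap aq *.
have [_ inj _ _] := manifold_atlas.
move=> /inj pq; rewrite !inE in pq; have {pq} := pq ap aq; move=> E; subst q => vw.
have {vw} := tangent_inj tv tw ap vw; move=> E; subst w.
have E := Prop_irrelevance tv tw; subst tw.
by congr exist; exact: Prop_irrelevance.
Qed.

Lemma slit_atlas : smooth_atlas SA.
Proof.
have inj := slit_inj; have so := soverlap_open.
split=> //.
  by move=> u; exact: (chart_atP manifold_atlas).
move=> a b k; apply: (@diffn_eq _ _ _ _ _ _ (lift_map (rep (A := A) a (chart_coord (c := A) b)))) => //.
  move=> _ /set_mem[u [au bu] <-]; rewrite -rep_transition// /rep.
  case: xgetP => [w _ [q [aq + ->]]|/(_ (sco b u))].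
    by move=> /inj -> //; rewrite inE.
  by case; exists u.
apply: lift_map_smooth (transition_smooth manifold_atlas a b) _ => //.
by rewrite overlapE => z [].
Qed.

End Basics.

(** * Vertical vectors, horizontal lifts and [J] in a chart *)

Section Vertical.
Context {R : realType} {m : nat} {M : topologicalType} {A : charts 'rV[R]_m M}.
Local Notation E := ('rV[R]_m * 'rV[R]_m)%type.
Context {M' : set (TM A)}.
Hypothesis manA : smooth_manifold A.
Hypothesis slitM' : open_slit_subset M'.
Local Notation SA := (scharts M').
Local Notation sdom a := (chart_dom (c := SA) a).
Local Notation sco a := (chart_coord (c := SA) a).
Local Notation fam' := (fam SA).
Local Notation phi a b := (rep (A := A) a (chart_coord (c := A) b)).
Implicit Types (a b c : idx A) (u : slit M') (v w : fam').
Local Notation satlas := (slit_atlas manA slitM').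

Lemma sdom_at u : sdom (chart_at SA u) u.
Proof. exact: (chart_atP satlas). Qed.

Lemma phi_diff a b u : sdom a u -> sdom b u ->
  differentiable (phi a b) (chart_coord a (base_proj u)).
Proof. by move=> au bu; apply: (transition_diff (manifold_atlas manA)). Qed.

Lemma near_lift a b u : sdom a u -> sdom b u ->
  \forall z \near sco a u, exists q, [/\ sdom a q, sdom b q, z = sco a q &
    rep (A := SA) a (sco b) z = lift_map (phi a b) z].
Proof.
move=> au bu; apply: filterS (near_overlap satlas au bu) => _ [q [aq bq] <-].
by exists q; split=> //; rewrite (repE satlas)//; exact: rep_transition.
Qed.

(** The base part of the transition of [M'] depends on x alone and is the transition [phi a b] of
    [M]. *)
Lemma tangent_fst a b u v : tangent SA u v -> sdom a u -> sdom b u ->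
  (v b).1 = 'D_((v a).1) (phi a b) (chart_coord a (base_proj u)).
Proof.
move=> tv au bu; rewrite (tangentE tv au bu).
have dt := transition_diff satlas au bu.
transitivity ('D_(v a) (fun z => (rep (A := SA) a (sco b) z).1) (sco a u)).
  rewrite (@derive_clinear _ _ _ _ _ [the {linear E -> 'rV[R]_m} of fst])//.
  exact: continuous_fstE.
rewrite (_ : 'D_(v a) _ _ = 'D_(v a) (fun z : E => phi a b z.1) (sco a u)).
  rewrite (@derive_comp _ _ _ _ fst (phi a b)); first by rewrite derive_fstE.
    exact: differentiable_fstE.
  exact: phi_diff.
by apply: near_eq_derive; apply: filterS (near_lift au bu) => z [q [_ _ _ ->]].
Qed.

Lemma tangent_snd a b u v : tangent SA u v -> sdom a u -> sdom b u ->
  (v a).1 = 0 ->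
  (v b).2 = 'D_((v a).2) (phi a b) (chart_coord a (base_proj u)).
Proof.
move=> tv au bu v0; rewrite (tangentE tv au bu).
have dt := transition_diff satlas au bu.
transitivity ('D_(v a) (fun z => (rep (A := SA) a (sco b) z).2) (sco a u)).
  rewrite (@derive_clinear _ _ _ _ _ [the {linear E -> 'rV[R]_m} of snd])//.
  exact: continuous_sndE.
have nl := near_lift au bu.
have [_ [_ _ _ E0]] := nbhs_singleton nl.
have dp := phi_diff au bu.
(* Along a vertical line x is fixed and [lift_map] is affine in y, so no second derivative of the
   transition map appears. *)
apply: derive_line_affine; apply: filterS (near0_line (v a) nl) => t [_ [_ _ _ ->]].
have z1 : (t *: v a + sco a u).1 = chart_coord a (base_proj u).
  by rewrite /= v0 scaler0 add0r.
rewrite E0 !lift_mapE//; last by rewrite z1.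
by rewrite z1 /= derive_linear// addrC.
Qed.

Lemma tmap_base a u v : tangent SA u v -> sdom a u ->
  tmap SA A base_proj u v a = (v a).1.
Proof.
move=> tv au; rewrite /tmap asboolT//; set c := chart_at SA u.
have cu : sdom c u := sdom_at u.
rewrite (tangent_fst tv cu au).
rewrite (_ : 'D_(v c) _ _ = 'D_(v c) (fun z : E => phi c a z.1) (sco c u)).
  rewrite (@derive_comp _ _ _ _ fst (phi c a)); first by rewrite derive_fstE.
    exact: differentiable_fstE.
  exact: phi_diff.
apply: near_eq_derive; apply: filterS (near_lift cu au) => z [q [cq aq -> _]].
by rewrite (repE satlas)// (repE (manifold_atlas manA)).
Qed.

Lemma verticalE a u v : sdom a u ->
  vertical u v <-> tangent SA u v /\ (v a).1 = 0.
Proof.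
move=> au; split=> [[tv v0]|[tv v0]]; split=> //.
  by rewrite -(tmap_base tv au) v0.
apply/funext => b; have [bu|bu] := pselect (chart_dom b (base_proj u)).
  by rewrite tmap_base// (tangent_fst tv au bu) v0 derive0.
by rewrite /tmap asboolF.
Qed.

Lemma vertical_tangent u v : vertical u v -> tangent SA u v.
Proof. by case. Qed.

Lemma vertical_fst a u v : sdom a u -> vertical u v -> (v a).1 = 0.
Proof. by move=> au /(verticalE v au)[]. Qed.

Lemma vertical_linear u v w (c : R) : vertical u v -> vertical u w ->
  vertical u (c *: v + w).
Proof.
move=> vv vw; have cu := sdom_at u; apply/(verticalE _ cu); split.
  by apply: (tangent_linear satlas); exact: vertical_tangent.
rewrite -[(c *: v + w) _]/(c *: v _ + w _) /=.
by rewrite (vertical_fst cu vv) (vertical_fst cu vw) scaler0 addr0.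
Qed.

Lemma vertical0 u : vertical u (0 : fam').
Proof.
by apply/(verticalE _ (sdom_at u)); split=> //; exact: tangent0.
Qed.

Lemma section_vertical X : section SA vertical X -> section SA (tangent SA) X.
Proof. by case=> vX sX; split=> // p; exact: vertical_tangent. Qed.

Context {H : slit M' -> set fam'}.
Hypothesis hH : nonlinear_connection H.

Lemma hprojP u v : tangent SA u v -> H u (hproj H u v) /\ vertical u (v - hproj H u v).
Proof.
move=> tv; case: hH => _ _ ex _; rewrite /hproj.
by case: xgetP => [w _ //|nw]; have [w [hw _]] := ex u v tv; case: (nw w).
Qed.

Lemma hproj_uniq u v w : tangent SA u v -> H u w -> vertical u (v - w) ->
  hproj H u v = w.
Proof.
move=> tv Hw vw; case: hH => _ _ ex _; have [w0 [_ uniq]] := ex u v tv.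
exact: etrans (esym (uniq _ (hprojP tv))) (uniq w (conj Hw vw)).
Qed.

Lemma H_tangent u v : H u v -> tangent SA u v.
Proof. by case: hH => Ht _ _ _; exact: Ht. Qed.

Lemma hproj_tangent u v : tangent SA u v -> tangent SA u (hproj H u v).
Proof. by move=> /hprojP[/H_tangent]. Qed.

Lemma vproj_vertical u v : tangent SA u v -> vertical u (vproj H u v).
Proof. by move=> /hprojP[]. Qed.

Lemma hproj_H u v : H u v -> hproj H u v = v.
Proof.
move=> Hv; apply: hproj_uniq => //; first exact: H_tangent.
by rewrite subrr; exact: vertical0.
Qed.

Lemma hproj_vertical u v : vertical u v -> hproj H u v = 0.
Proof.
move=> vv; apply: hproj_uniq; first exact: vertical_tangent.
  by case: hH => _ /(_ u)[].
by rewrite subr0.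
Qed.

Lemma H_sum u (I : Type) (r : seq I) (P : pred I) (F : I -> fam') :
  (forall i, P i -> H u (F i)) -> H u (\sum_(i <- r | P i) F i).
Proof.
move=> HF; have [_ /(_ u)[H0 HD] _ _] := hH.
elim/big_ind: _ => // x y Hx Hy; by have := HD x y 1 Hx Hy; rewrite scale1r.
Qed.

Lemma H_scale u (c : R) v : H u v -> H u (c *: v).
Proof.
move=> Hv; have [_ /(_ u)[H0 HD] _ _] := hH.
by have := HD v 0 c Hv H0; rewrite addr0.
Qed.

Lemma partial_x_tangent a i u : sdom a u -> tangent SA u (partial_x a i u).
Proof. by move=> au; apply: (tangent_tvec satlas). Qed.

Lemma partial_y_chart a i u : sdom a u -> partial_y a i u a = ey i.
Proof. by move=> au; apply: (tvec_chart satlas). Qed.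

Lemma partial_y_vertical a i u : sdom a u -> vertical u (partial_y a i u).
Proof.
move=> au; apply/(verticalE _ au); split; first exact: (tangent_tvec satlas).
by rewrite partial_y_chart.
Qed.

Lemma delta_x_H a i u : sdom a u -> H u (delta_x H a i u).
Proof. by move=> au; case: (hprojP (partial_x_tangent i au)). Qed.

Lemma delta_x_fst a i u : sdom a u -> (delta_x H a i u a).1 = delta_mx 0 i.
Proof.
move=> au; have [_ /(vertical_fst au)] := hprojP (partial_x_tangent i au).
rewrite -[(_ - _) a]/(partial_x a i u a - delta_x H a i u a).
by rewrite {1}/partial_x (tvec_chart satlas)//= => /eqP; rewrite subr_eq0 => /eqP.
Qed.

(* In the chart [a], [hlift a u xi] is the vector [(xi, - N xi)]. *)
Definition hlift a u (xi : 'rV[R]_m) : 'rV[R]_m :=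
  \sum_i xi 0 i *: (delta_x H a i u a).2.

Lemma famD (x y : fam') a : (x + y) a = x a + y a. Proof. by []. Qed.
Lemma famN (x : fam') a : (- x) a = - x a. Proof. by []. Qed.
Lemma famZ (c : R) (x : fam') a : (c *: x) a = c *: x a. Proof. by []. Qed.
Lemma fam_sum (I : Type) (r : seq I) (P : pred I) (F : I -> fam') a :
  (\sum_(i <- r | P i) F i) a = \sum_(i <- r | P i) F i a.
Proof. by elim/big_rec2: _ => // i x y _ <-. Qed.

Lemma sum_delta_x a u (xi : 'rV[R]_m) : sdom a u ->
  (\sum_i xi 0 i *: delta_x H a i u) a = (xi, hlift a u xi).
Proof.
move=> au; rewrite fam_sum [LHS]surjective_pairing !raddf_sum/=; congr pair.
rewrite [RHS]row_sum_delta; apply: eq_bigr => i _; by rewrite delta_x_fst.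
Qed.

Lemma sum_partial_y a u (xi : 'rV[R]_m) : sdom a u ->
  (\sum_i xi 0 i *: partial_y a i u) a = (0, xi).
Proof.
move=> au; rewrite fam_sum [LHS]surjective_pairing !raddf_sum/=; congr pair.
  by rewrite big1// => i _; rewrite partial_y_chart//= scaler0.
rewrite [RHS]row_sum_delta; apply: eq_bigr => i _; by rewrite partial_y_chart.
Qed.

(** The combination of the [delta_x] with the base components of [v] as coefficients is horizontal
    and has the same base part as [v]. *)
Lemma hproj_chart a u v : tangent SA u v -> sdom a u ->
  hproj H u v a = ((v a).1, hlift a u (v a).1).
Proof.
move=> tv au.
suff -> : hproj H u v = \sum_i (v a).1 0 i *: delta_x H a i u by exact: sum_delta_x.
apply: (hproj_uniq tv).
  by apply: H_sum => i _; apply: H_scale; exact: delta_x_H.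
apply/(verticalE _ au); split.
  apply: (tangentB satlas tv).
  apply: (tangent_sum satlas) => i _.
  apply: (tangentZ satlas).
  by  apply: H_tangent; exact: delta_x_H.
by rewrite famD famN sum_delta_x//= subrr.
Qed.

Lemma vproj_chart a u v : tangent SA u v -> sdom a u ->
  vproj H u v a = (0, (v a).2 - hlift a u (v a).1).
Proof.
move=> tv au; rewrite /vproj famD famN hproj_chart// [LHS]surjective_pairing/=.
by rewrite subrr.
Qed.

Context {J : slit M' -> fam' -> fam'}.
Hypothesis hJ : associate_acs H J.

Lemma J_linear u v w (c : R) : tangent SA u v -> tangent SA u w ->
  J u (c *: v + w) = c *: J u v + J u w.
Proof. by case: hJ => lin _; exact: lin. Qed.

Lemma J0 u : J u 0 = 0.
Proof.
have t0 := tangent0 SA u : tangent SA u 0.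
by have := J_linear 1 t0 t0; rewrite !scale1r !addr0 => /eqP; rewrite -subr_eq0 opprD addNKr oppr_eq0 => /eqP.
Qed.

Lemma JD u v w : tangent SA u v -> tangent SA u w -> J u (v + w) = J u v + J u w.
Proof. by move=> tv tw; have := J_linear 1 tv tw; rewrite !scale1r. Qed.

Lemma JZ u v (c : R) : tangent SA u v -> J u (c *: v) = c *: J u v.
Proof.
by move=> tv; have := J_linear c tv (tangent0 SA u); rewrite J0 !addr0.
Qed.

Lemma JN u v : tangent SA u v -> J u (- v) = - J u v.
Proof. by move=> tv; rewrite -scaleN1r JZ// scaleN1r. Qed.

Lemma JB u v w : tangent SA u v -> tangent SA u w -> J u (v - w) = J u v - J u w.
Proof.
by move=> tv tw; rewrite (JD tv (tangentN satlas tw)) JN.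
Qed.

Lemma J_sum u n (c : 'I_n -> R) (F : 'I_n -> fam') :
  (forall i, tangent SA u (F i)) ->
  J u (\sum_i c i *: F i) = \sum_i c i *: J u (F i).
Proof.
move=> tF; have : tangent SA u (\sum_i c i *: F i) /\
    J u (\sum_i c i *: F i) = \sum_i c i *: J u (F i); last by case.
elim/big_rec2: _ => [|i y x _ [tx <-]].
  by split; [exact: tangent0|exact: J0].
by split; [exact: (tangent_linear satlas (c i) (tF i) tx)|exact: (J_linear (c i) (tF i) tx)].
Qed.

(** [J] is prescribed on the frame only, so [v] is expanded in it, with coefficients [xi] and
    [zeta]. Both conclusions come from the resulting expansion of [J u v]. *)
Lemma J_spec a u v : tangent SA u v -> sdom a u ->
  tangent SA u (J u v) /\
  J u v a = ((v a).2 - hlift a u (v a).1,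
             hlift a u ((v a).2 - hlift a u (v a).1) - (v a).1).
Proof.
move=> tv au; set xi := (v a).1; set zeta := _ - hlift a u xi.
have td i : tangent SA u (delta_x H a i u) by apply: H_tangent; exact: delta_x_H.
have tp i : tangent SA u (partial_y a i u).
  by apply: vertical_tangent; exact: partial_y_vertical.
have ts (r : 'rV[R]_m) (F : 'I_m -> fam') : (forall i, tangent SA u (F i)) ->
    tangent SA u (\sum_i r 0 i *: F i).
  by move=> tF; apply: (tangent_sum satlas) => i _; exact: (tangentZ satlas _ (tF i)).
have vE : v = \sum_i xi 0 i *: delta_x H a i u + \sum_i zeta 0 i *: partial_y a i u.
  apply: (tangent_inj tv (tangentD satlas (ts _ _ td) (ts _ _ tp)) au).
  rewrite famD sum_delta_x// sum_partial_y// [LHS]surjective_pairing.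
  by congr pair => /=; rewrite ?addr0// addrC subrK.
have JvE : J u v = - (\sum_i xi 0 i *: partial_y a i u)
    + \sum_i zeta 0 i *: delta_x H a i u.
  rewrite vE (JD (ts _ _ td) (ts _ _ tp)) !J_sum//; congr (_ + _).
    rewrite -sumrN; apply: eq_bigr => i _.
    by case: hJ => _ /(_ a u au i)[-> _]; rewrite scalerN.
  by apply: eq_bigr => i _; case: hJ => _ /(_ a u au i)[_ ->].
rewrite JvE; split.
  exact: (tangentD satlas (tangentN satlas (ts _ _ tp)) (ts _ _ td)).
rewrite famD famN sum_delta_x// sum_partial_y// [LHS]surjective_pairing.
by congr pair => /=; rewrite ?oppr0 ?add0r// addrC.
Qed.

Lemma J_tangent u v : tangent SA u v -> tangent SA u (J u v).
Proof. by move=> tv; case: (J_spec tv (sdom_at u)). Qed.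

Lemma J_chart a u v : tangent SA u v -> sdom a u ->
  J u v a = ((v a).2 - hlift a u (v a).1,
             hlift a u ((v a).2 - hlift a u (v a).1) - (v a).1).
Proof. by move=> tv au; case: (J_spec tv au). Qed.

Lemma hliftN a u (r : 'rV[R]_m) : hlift a u (- r) = - hlift a u r.
Proof. by rewrite /hlift -sumrN; apply: eq_bigr => i _; rewrite mxE scaleNr. Qed.

Lemma hlift0 a u : hlift a u 0 = 0.
Proof. by rewrite /hlift big1// => i _; rewrite mxE scale0r. Qed.

Lemma JJ u v : tangent SA u v -> J u (J u v) = - v.
Proof.
move=> tv; have cu := sdom_at u.
have tJ := J_tangent tv.
apply: (tangent_inj (J_tangent tJ) (tangentN satlas tv) cu).
rewrite famN (J_chart tJ cu) (J_chart tv cu).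
have e (x y : 'rV[R]_m) : x - y - x = - y by rewrite addrAC subrr add0r.
rewrite /= e hliftN opprB addKr; by case: (v _).
Qed.

End Vertical.

(** * Closure properties of [smooth_on] *)

Section SmoothOn.
Context {R : realType}.
Implicit Types (V W : normedModType R).

Lemma smooth_on_diff V W (U : set V) (f : V -> W) x :
  smooth_on U f -> U x -> differentiable f x.
Proof. by move=> /(_ 1%N)[+ _] => + Ux; apply. Qed.

Lemma smooth_on_derive V W (U : set V) (f : V -> W) v :
  smooth_on U f -> smooth_on U ('D_v f).
Proof. by move=> sf k; have [_] := sf k.+1; apply. Qed.

Lemma smooth_onM V (U : set V) (f g : V -> R) : open U -> smooth_on U f ->
  smooth_on U g -> smooth_on U (fun x => f x * g x).
Proof. by move=> oU sf sg k; apply: diffnM. Qed.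

Lemma smooth_onD V W (U : set V) (f g : V -> W) : open U -> smooth_on U f ->
  smooth_on U g -> smooth_on U (fun x => f x + g x).
Proof. by move=> oU sf sg k; apply: diffnD. Qed.

Lemma smooth_on_sum V W (U : set V) (I : Type) (r : seq I) (P : pred I)
    (f : I -> V -> W) : open U -> (forall i, P i -> smooth_on U (f i)) ->
  smooth_on U (fun x => \sum_(i <- r | P i) f i x).
Proof. by move=> oU sf k; apply: diffn_sum => // i Pi; exact: sf. Qed.

Lemma smooth_on_cst V W (U : set V) (c : W) : smooth_on U (fun=> c).
Proof. by move=> k; exact: diffn_cst. Qed.

Lemma smooth_on_sub V W (U O : set V) (f : V -> W) : O `<=` U ->
  smooth_on U f -> smooth_on O f.
Proof. by move=> OU sf k; apply: diffn_subset (sf k). Qed.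

Lemma smooth_on_eq V W (U : set V) (f g : V -> W) : open U ->
  {in U, f =1 g} -> smooth_on U g -> smooth_on U f.
Proof. by move=> oU fg sg k; apply: diffn_eq (sg k). Qed.

Lemma smooth_on_coord V m (U : set V) (f : V -> 'rV[R]_m) i : open U ->
  smooth_on U f -> smooth_on U (fun x => f x 0 i).
Proof.
move=> oU sf k.
apply: (@diffn_clinear _ _ _ _ _ _ f [the {linear 'rV[R]_m -> R} of rcoord i]) => //.
exact: coord_continuous.
Qed.

Lemma smooth_on_fst V W W' (U : set V) (f : V -> W * W') : open U ->
  smooth_on U f -> smooth_on U (fun x => (f x).1).
Proof.
move=> oU sf k.
apply: (@diffn_clinear _ _ _ _ _ _ f [the {linear (W * W')%type -> W} of fst]) => //.
by move=> x; exact: cvg_fst.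
Qed.

Lemma smooth_on_snd V W W' (U : set V) (f : V -> W * W') : open U ->
  smooth_on U f -> smooth_on U (fun x => (f x).2).
Proof.
move=> oU sf k.
apply: (@diffn_clinear _ _ _ _ _ _ f [the {linear (W * W')%type -> W'} of snd]) => //.
by move=> x; exact: cvg_snd.
Qed.

Lemma smooth_on_pair V W W' (U : set V) (f : V -> W) (g : V -> W') : open U ->
  smooth_on U f -> smooth_on U g -> smooth_on U (fun x => (f x, g x)).
Proof. by move=> oU sf sg k; apply: diffn_pair. Qed.

Lemma smooth_onN V W (U : set V) (f : V -> W) : open U ->
  smooth_on U f -> smooth_on U (fun x => - f x).
Proof.
move=> oU sf k; apply: (@diffn_clinear _ _ _ _ _ _ _ -%R) => //.
exact: opp_continuous.
Qed.

Lemma smooth_schwarz V (U : set V) (f : V -> R) u v x : open U -> U x ->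
  smooth_on U f -> 'D_v ('D_u f) x = 'D_u ('D_v f) x.
Proof.
move=> oU Ux sf; apply: schwarz.
- by apply: filterS (open_nbhs_nbhs (conj oU Ux)) => y; exact: smooth_on_diff.
- exact: smooth_on_diff (smooth_on_derive u sf) Ux.
- exact: smooth_on_diff (smooth_on_derive v sf) Ux.
Qed.

Lemma derive_lincomb V (n : nat) (f : 'I_n -> V -> R) (c : 'I_n -> R) v x :
  (forall i, differentiable (f i) x) ->
  'D_v (fun y => \sum_i c i * f i y) x = \sum_i c i * 'D_v (f i) x.
Proof.
move=> df.
have -> : (fun y => \sum_i c i * f i y) = \sum_i (c i *: f i).
  by apply/funext => y; rewrite fct_sumE.
rewrite derive_sum => [|i]; last exact/diff_derivable/differentiableZ.
by apply: eq_bigr => i _; rewrite deriveZ//; exact: diff_derivable.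
Qed.

End SmoothOn.

(** * The fundamental tensor as a fibre Hessian *)

Section Bil.
Context {R : realType} {m : nat}.
Local Notation E := ('rV[R]_m * 'rV[R]_m)%type.
Implicit Types (g : 'M[R]_m) (v w : 'rV[R]_m) (c : R).

Lemma bil_linearl g c v v' w : bil g (c *: v + v') w = c * bil g v w + bil g v' w.
Proof.
rewrite /bil mulr_sumr -big_split/=; apply: eq_bigr => i _.
rewrite mulr_sumr -big_split/=; apply: eq_bigr => j _; rewrite !mxE; ring.
Qed.

Lemma bilC g v w : (forall i j, g i j = g j i) -> bil g v w = bil g w v.
Proof.
move=> gC; rewrite /bil exchange_big/=; apply: eq_bigr => i _.
by apply: eq_bigr => j _; rewrite gC; ring.
Qed.

Lemma bil0l g w : bil g 0 w = 0.
Proof.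
by have := bil_linearl g 1 0 0 w; rewrite scale1r addr0 mul1r => /eqP;
   rewrite -subr_eq0 opprD addNKr oppr_eq0 => /eqP.
Qed.

Lemma bilNl g v w : bil g (- v) w = - bil g v w.
Proof. by have := bil_linearl g (-1) v 0 w; rewrite !addr0 bil0l addr0 scaleN1r mulN1r. Qed.

Lemma bilNr g v w : bil g v (- w) = - bil g v w.
Proof.
rewrite /bil -sumrN; apply: eq_bigr => i _; rewrite -sumrN; apply: eq_bigr => j _.
by rewrite mxE mulrN.
Qed.

Lemma vec_ey w : (0, w) = \sum_j w 0 j *: ey j :> E.
Proof.
rewrite [RHS]surjective_pairing !raddf_sum/=; congr pair.
  by rewrite big1// => j _; rewrite scaler0.
exact: row_sum_delta.
Qed.

Lemma vec_ex w : (w, 0) = \sum_j w 0 j *: ex j :> E.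
Proof.
rewrite [RHS]surjective_pairing !raddf_sum/=; congr pair.
  exact: row_sum_delta.
by rewrite big1// => j _; rewrite scaler0.
Qed.

Lemma derive_ey (f : E -> R) z w : differentiable f z ->
  'D_(0, w) f z = \sum_j w 0 j * 'D_(ey j) f z.
Proof. by move=> df; rewrite vec_ey derivev_sum. Qed.

Lemma bil_gij (f : E -> R) (U : set E) z v w : open U -> U z -> smooth_on U f ->
  'D_(0, v) ('D_(0, w) f) z = 2 * bil (gij f z) v w.
Proof.
move=> oU Uz sf.
have sd j : differentiable ('D_(ey j) f) z.
  exact: smooth_on_diff (smooth_on_derive (ey j) sf) Uz.
rewrite (@derive_eq_on _ _ _ U _ (fun y => \sum_j w 0 j * 'D_(ey j) f y))//; last first.
  by move=> y /set_mem Uy; apply: derive_ey; exact: smooth_on_diff sf Uy.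
rewrite derive_lincomb//.
rewrite /bil exchange_big/= mulr_sumr; apply: eq_bigr => j _.
rewrite derive_ey// !mulr_sumr; apply: eq_bigr => i _.
by rewrite mxE; field.
Qed.

Lemma gij_sym (f : E -> R) (U : set E) z : open U -> U z -> smooth_on U f ->
  forall i j, gij f z i j = gij f z j i.
Proof.
move=> oU Uz sf i j; rewrite mxE [RHS]mxE.
by have -> := smooth_schwarz (ey j) (ey i) oU Uz sf.
Qed.

End Bil.

(** * The vertical and Sasaki metrics *)

Section Metric.
Context {R : realType} {m : nat} {M : topologicalType} {A : charts 'rV[R]_m M}.
Local Notation E := ('rV[R]_m * 'rV[R]_m)%type.
Context {M' : set (TM A)} {F : slit M' -> R}.
Hypothesis hF : finsler_manifold F.
Local Notation SA := (scharts M').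
Local Notation sdom a := (chart_dom (c := SA) a).
Local Notation sco a := (chart_coord (c := SA) a).
Local Notation fam' := (fam SA).
Local Notation phi a b := (rep (A := A) a (chart_coord (c := A) b)).
Local Notation "'L_' a" := (rep (A := SA) a (Fstar F)) (at level 8, a at level 2).
Implicit Types (a b c : idx A) (u : slit M') (v w : fam').

Lemma finsler_man : smooth_manifold A. Proof. by case: hF. Qed.
Lemma finsler_slit : open_slit_subset M'. Proof. by case: hF. Qed.
Local Notation manA := finsler_man.
Local Notation slitM' := finsler_slit.
Local Notation satlas := (slit_atlas manA slitM').

Lemma simg_open a : open (img (A := SA) a).
Proof. exact: (img_open satlas). Qed.

Arguments simg_open : clear implicits.

Lemma L_smooth a : smooth_on (img (A := SA) a) (L_ a).
Proof.
have [_ _ [_ sF] _ _] := hF.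
apply: (rep_smooth satlas (g := fun z => rep (A := SA) a F z * rep (A := SA) a F z)).
  by apply: smooth_onM; [exact: simg_open|exact: sF|exact: sF].
by move=> u au; rewrite (repE satlas)// /Fstar expr2.
Qed.

Arguments L_smooth : clear implicits.

Lemma bil_gmx a u (v w : 'rV[R]_m) : sdom a u ->
  'D_(0, v) ('D_(0, w) (L_ a)) (sco a u) = 2 * bil (gmx F a u) v w.
Proof.
move=> au; exact: (bil_gij v w (simg_open a) (img_chart au) (L_smooth a)).
Qed.

Lemma gmxC a u i j : sdom a u -> gmx F a u i j = gmx F a u j i.
Proof. by move=> au; exact: (gij_sym (simg_open a) (img_chart au) (L_smooth a)). Qed.

Lemma gmx_pos a u (w : 'rV[R]_m) : sdom a u -> w != 0 -> 0 < bil (gmx F a u) w w.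
Proof. by move=> au; case: hF => _ _ _ _; exact. Qed.

Lemma derive_lift a b u (w : 'rV[R]_m) : sdom a u -> sdom b u ->
  'D_(0, w) (rep (A := SA) a (sco b)) (sco a u) =
  (0, 'D_w (phi a b) (chart_coord a (base_proj u))).
Proof.
move=> au bu; rewrite -(tvecE _ _ bu).
have tv := tangent_tvec satlas (0, w) au.
have e : tvec (A := SA) a u (0, w) a = (0, w) by exact: (tvec_chart satlas).
rewrite [LHS]surjective_pairing (tangent_fst manA slitM' tv au bu).
rewrite (tangent_snd manA slitM' tv au bu); last by rewrite e.
by rewrite e/= derive0.
Qed.

(** With x fixed the change of fibre coordinates is linear, so the fibre Hessian of F^2 transforms
    as a tensor. Hence [vmetric] may be computed in every chart. *)
Lemma gmx_change a b u (v w : 'rV[R]_m) : sdom a u -> sdom b u ->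
  bil (gmx F a u) v w =
  bil (gmx F b u) ('D_v (phi a b) (chart_coord a (base_proj u)))
                  ('D_w (phi a b) (chart_coord a (base_proj u))).
Proof.
move=> au bu; apply: (@mulfI _ 2); first by rewrite pnatr_eq0.
rewrite -(bil_gmx v w au) -(bil_gmx _ _ bu); set x := chart_coord a _.
set v' := 'D_v _ _; set w' := 'D_w _ _.
have nl := near_lift manA slitM' au bu.
have dLb : differentiable ('D_(0, w') (L_ b)) (sco b u).
  exact: smooth_on_diff (smooth_on_derive _ (L_smooth b)) (img_chart bu).
have dt := transition_diff satlas au bu.
have st : rep (A := SA) a (sco b) (sco a u) = sco b u by rewrite (repE satlas).
(* The base point does not move along the vertical line, so the image [w'] of the inner direction
   [w] is the same at all its points. *)
transitivity ('D_(0, v) (fun z => 'D_(0, w') (L_ b) (rep (A := SA) a (sco b) z)) (sco a u)).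
  apply: derive_line_eq; apply: filterS (near0_line (0, v) nl) => t [q [aq bq zq _]].
  have xq : chart_coord a (base_proj q) = x.
    by have /(congr1 fst) := zq; rewrite /= scaler0 add0r => <-.
  rewrite zq (derive_rep satlas _ aq bq); last first.
    exact: smooth_on_diff (L_smooth b) (img_chart bq).
  by rewrite derive_lift// xq (repE satlas).
rewrite -st in dLb.
by have -> := derive_comp (0, v) dt dLb; rewrite st derive_lift.
Qed.

Lemma gmx_vertical a b u v w : sdom a u -> sdom b u ->
  vertical u v -> vertical u w ->
  bil (gmx F a u) (v a).2 (w a).2 = bil (gmx F b u) (v b).2 (w b).2.
Proof.
move=> au bu vv vw.
rewrite (tangent_snd manA slitM' (vertical_tangent vv) au bu (vertical_fst manA slitM' au vv)).
rewrite (tangent_snd manA slitM' (vertical_tangent vw) au bu (vertical_fst manA slitM' au vw)).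
exact: gmx_change.
Qed.

Lemma vmetricE a u v w : sdom a u -> vertical u v -> vertical u w ->
  vmetric F u v w = bil (gmx F a u) (v a).2 (w a).2.
Proof. by move=> au; apply: gmx_vertical; first exact: (sdom_at manA slitM'). Qed.

Context {H : slit M' -> set fam'}.
Hypothesis hH : nonlinear_connection H.
Local Notation G := (sasaki F H).

Lemma vproj_linear u v w (c : R) : tangent SA u v -> tangent SA u w ->
  vproj H u (c *: v + w) = c *: vproj H u v + vproj H u w.
Proof.
move=> tv tw.
have E (x y x' y' : fam') : c *: x + y - (c *: x' + y') = c *: (x - x') + (y - y').
  by rewrite scalerBr opprD addrACA.
suff e : hproj H u (c *: v + w) = c *: hproj H u v + hproj H u w.
  by rewrite /vproj e E.
apply: (hproj_uniq hH (tangent_linear satlas c tv tw)).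
  have [_ /(_ u)[_ HD] _ _] := hH.
  by apply: HD; [case: (hprojP hH tv)|case: (hprojP hH tw)].
rewrite E.
exact: (vertical_linear manA slitM' c (vproj_vertical hH tv) (vproj_vertical hH tw)).
Qed.

Lemma sasaki_linear u v v' w (c : R) : tangent SA u v -> tangent SA u v' ->
  tangent SA u w -> G u (c *: v + v') w = c * G u v w + G u v' w.
Proof.
move=> tv tv' tw; rewrite /sasaki (vproj_linear c tv tv') !famD !famZ /= !bil_linearl mulrDr.
by rewrite addrACA.
Qed.

Lemma sasakiC u v w : G u v w = G u w v.
Proof.
have cu : sdom (chart_at SA u) u := sdom_at manA slitM' u.
have gC i j := gmxC i j cu.
exact: (congr2 +%R (bilC _ _ gC) (bilC _ _ gC)).
Qed.

Lemma bil_ge0 a u (w : 'rV[R]_m) : sdom a u -> 0 <= bil (gmx F a u) w w.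
Proof.
move=> au; have [->|w0] := eqVneq w 0; first by rewrite bil0l.
exact/ltW/gmx_pos.
Qed.

Lemma sasaki_pos u v : tangent SA u v -> v <> 0 -> 0 < G u v v.
Proof.
move=> tv v0; rewrite /sasaki; set c := chart_at SA u.
have cu : sdom c u := sdom_at manA slitM' u.
(* A nonzero base part makes the first summand positive. Otherwise the horizontal lift is 0, and the
   vertical part is [v] itself. *)
have [v1|v1] := eqVneq (v c).1 0; last first.
  by apply: ltr_pwDl; [exact: gmx_pos|exact: bil_ge0].
rewrite v1 bil0l add0r; apply: gmx_pos => //; apply/eqP => v2; apply: v0.
apply: (tangent_inj tv (tangent0 SA u) cu).
move: v2; rewrite (vproj_chart manA slitM' hH tv cu)/= v1 hlift0 subr0 => v2.
by rewrite [LHS]surjective_pairing v1 v2.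
Qed.

Context {J : slit M' -> fam' -> fam'}.
Hypothesis hJ : associate_acs H J.

Lemma sasaki_J u v w : tangent SA u v -> tangent SA u w ->
  G u (J u v) (J u w) = G u v w.
Proof.
move=> tv tw; have := sdom_at manA slitM' u.
rewrite /sasaki; move: (chart_at SA u) => c cu.
have tJv := J_tangent manA slitM' hH hJ tv; have tJw := J_tangent manA slitM' hH hJ tw.
rewrite (vproj_chart manA slitM' hH tJv cu) (vproj_chart manA slitM' hH tJw cu).
rewrite (vproj_chart manA slitM' hH tv cu) (vproj_chart manA slitM' hH tw cu).
rewrite (J_chart manA slitM' hH hJ tv cu) (J_chart manA slitM' hH hJ tw cu).
have e (x y : 'rV[R]_m) : x - y - x = - y by rewrite addrAC subrr add0r.
by rewrite /= !e bilNl bilNr opprK addrC.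
Qed.

(* [J] identifies the horizontal bundle with the vertical one isometrically. *)
Lemma sasaki_split u v w : tangent SA u v -> tangent SA u w ->
  G u v w = vmetric F u (J u (hproj H u v)) (J u (hproj H u w))
          + vmetric F u (vproj H u v) (vproj H u w).
Proof.
move=> tv tw; have := sdom_at manA slitM' u.
rewrite /sasaki /vmetric; move: (chart_at SA u) => c cu.
apply: (congr1 (fun r => r + _)).
have e x : tangent SA u x -> (J u (hproj H u x) c).2 = - (x c).1.
  move=> tx; rewrite (J_chart manA slitM' hH hJ (hproj_tangent hH tx) cu).
  by rewrite (hproj_chart manA slitM' hH tx cu) /= subrr hlift0 sub0r.
have bilNN g (x y x' y' : 'rV[R]_m) : x = - x' -> y = - y' -> bil g x' y' = bil g x y.
  by move=> -> ->; rewrite bilNl bilNr opprK.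
exact: (bilNN _ _ _ _ _ (e v tv) (e w tw)).
Qed.

Lemma J_hproj_vertical u v : tangent SA u v -> vertical u (J u (hproj H u v)).
Proof.
move=> tv; have cu : sdom (chart_at SA u) u := sdom_at manA slitM' u.
have th := hproj_tangent hH tv.
apply/(verticalE manA slitM' _ cu); split; first exact: (J_tangent manA slitM' hH hJ th).
by rewrite (J_chart manA slitM' hH hJ th cu) (hproj_chart manA slitM' hH tv cu)/= subrr.
Qed.

End Metric.

(** * The natural almost complex connection *)

Section Cartan.
Context {R : realType} {m : nat} {M : topologicalType} {A : charts 'rV[R]_m M}.
Local Notation E := ('rV[R]_m * 'rV[R]_m)%type.
Context {M' : set (TM A)} {F : slit M' -> R}.
Hypothesis hF : finsler_manifold F.
Local Notation SA := (scharts M').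
Local Notation sdom a := (chart_dom (c := SA) a).
Local Notation sco a := (chart_coord (c := SA) a).
Local Notation fam' := (fam SA).
Local Notation "'L_' a" := (rep (A := SA) a (Fstar F)) (at level 8, a at level 2).
Implicit Types (a b c : idx A) (u : slit M') (v w : fam') (X Y Z : slit M' -> fam').
Local Notation manA := (finsler_man hF).
Local Notation slitM' := (finsler_slit hF).
Local Notation satlas := (slit_atlas manA slitM').

Context {H : slit M' -> set fam'} {J : slit M' -> fam' -> fam'}.
Hypothesis hH : nonlinear_connection H.
Hypothesis hJ : associate_acs H J.
Local Notation G := (sasaki F H).
Local Notation tsec X := (section SA (tangent SA) X).
Local Notation vsec X := (section SA vertical X).
Local Notation hX X := (bapp (hproj H) X).
Local Notation vX X := (bapp (vproj H) X).
Local Notation JX X := (bapp J X).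

Lemma hlift_smooth a (xi : E -> 'rV[R]_m) : smooth_on (img (A := SA) a) xi ->
  smooth_on (img (A := SA) a)
    (fun z => \sum_i xi z 0 i *: (rep (A := SA) a (fun u => delta_x H a i u a) z).2).
Proof.
move=> sxi; have oa := simg_open hF (a := a).
apply: smooth_on_sum => // i _ k; apply: (diffnZ (cbasis_rV m)) => //.
  exact: (smooth_on_coord i oa sxi k).
by apply: smooth_on_snd => //; case: hH => _ _ _; exact.
Qed.

Lemma hsec X : tsec X -> tsec (hX X).
Proof.
move=> [tX sX]; split=> [u|a]; first exact: (hproj_tangent hH (tX u)).
pose xi z := (rep (A := SA) a (fun p => X p a) z).1.
have oa := simg_open hF (a := a).
have sxi : smooth_on (img (A := SA) a) xi by exact: (smooth_on_fst oa (sX a)).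
apply: (rep_smooth satlas (smooth_on_pair oa sxi (hlift_smooth sxi))) => u au.
rewrite /bapp (hproj_chart manA slitM' hH (tX u) au) /xi (repE satlas)//.
congr pair; apply: eq_bigr => i _; by rewrite (repE satlas).
Qed.

Lemma vsecP X : tsec X -> vsec (vX X).
Proof.
move=> sX; have [_ s] := sectionB satlas sX (hsec sX).
split; last exact: s.
by move=> u; apply: (vproj_vertical hH); case: sX.
Qed.

Lemma Jsec X : tsec X -> tsec (JX X).
Proof.
move=> [tX sX]; split=> [u|a]; first exact: (J_tangent manA slitM' hH hJ (tX u)).
have oa := simg_open hF (a := a).
pose x z := rep (A := SA) a (fun p => X p a) z.
pose n (r : E -> 'rV[R]_m) z :=
  \sum_i r z 0 i *: (rep (A := SA) a (fun u => delta_x H a i u a) z).2.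
have s1 : smooth_on (img (A := SA) a) (fun z => (x z).1) by exact: (smooth_on_fst oa (sX a)).
have s2 : smooth_on (img (A := SA) a) (fun z => (x z).2) by exact: (smooth_on_snd oa (sX a)).
have s3 : smooth_on (img (A := SA) a) (fun z => (x z).2 - n (fun z => (x z).1) z).
  by apply: smooth_onD => //; apply: smooth_onN => //; exact: hlift_smooth.
have s4 : smooth_on (img (A := SA) a)
    (fun z => n (fun z => (x z).2 - n (fun z => (x z).1) z) z - (x z).1).
  by apply: smooth_onD => //; [exact: hlift_smooth|exact: smooth_onN].
apply: (rep_smooth satlas (smooth_on_pair oa s3 s4)) => u au.
have nE r : n r (sco a u) = hlift (H := H) a u (r (sco a u)).
  by apply: eq_bigr => i _; rewrite (repE satlas).
by rewrite !nE /x !(repE satlas)// /bapp (J_chart manA slitM' hH hJ (tX u) au).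
Qed.

Lemma Jhsec X : tsec X -> vsec (JX (hX X)).
Proof.
move=> sX; have [_ s] := Jsec (hsec sX).
split; last exact: s.
by move=> u; apply: (J_hproj_vertical hF hH hJ); case: sX.
Qed.

Lemma vsec0 : vsec 0.
Proof.
split=> [u|a]; first exact: (vertical0 manA slitM' u).
by apply: (rep_smooth satlas (smooth_on_cst _ (0 : E))).
Qed.

Lemma vsecN X : vsec X -> vsec (- X).
Proof.
move=> sX; have [vX_ _] := sX.
have [_ s] := sectionN satlas (section_vertical sX).
split=> [u|]; last exact: s.
have := vertical_linear manA slitM' (-1) (vX_ u) (vertical0 manA slitM' u).
by rewrite addr0 scaleN1r.
Qed.

Lemma vmetric_smooth X Y : vsec X -> vsec Y ->
  smooth_fun SA (fun u => vmetric F u (X u) (Y u)).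
Proof.
move=> [vX_ sX] [vY sY] a; have oa := simg_open hF (a := a).
apply: (@rep_smooth _ _ _ _ satlas _ _ _ (fun z => \sum_i \sum_j
  (2^-1 * 'D_(ey i) ('D_(ey j) (L_ a)) z
   * (rep (A := SA) a (fun p => X p a) z).2 0 i
   * (rep (A := SA) a (fun p => Y p a) z).2 0 j))).
  apply: smooth_on_sum => // i _; apply: smooth_on_sum => // j _.
  apply: smooth_onM => //; last exact: smooth_on_coord (smooth_on_snd oa (sY a)).
  apply: smooth_onM => //; last exact: smooth_on_coord (smooth_on_snd oa (sX a)).
  apply: smooth_onM => //; first exact: smooth_on_cst.
  by do 2!apply: smooth_on_derive; exact: L_smooth.
move=> u au; rewrite (vmetricE hF au (vX_ u) (vY u)).
apply: eq_bigr => i _; apply: eq_bigr => j _.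
by rewrite !(repE satlas)// mxE.
Qed.

Lemma sasaki_splitf X Y : tsec X -> tsec Y ->
  (fun u => G u (X u) (Y u)) = (fun u =>
    vmetric F u (JX (hX X) u) (JX (hX Y) u) + vmetric F u (vX X u) (vX Y u)).
Proof.
move=> [tX _] [tY _]; apply/funext => u.
exact: (sasaki_split hF hH hJ (tX u) (tY u)).
Qed.

Lemma smooth_funD (f g : slit M' -> R) : smooth_fun SA f -> smooth_fun SA g ->
  smooth_fun SA (fun u => f u + g u).
Proof.
move=> sf sg a; have oa := simg_open hF (a := a).
apply: (rep_smooth satlas (smooth_onD oa (sf a) (sg a))) => u au.
by rewrite !(repE satlas).
Qed.

Lemma sasaki_smooth X Y : tsec X -> tsec Y ->
  smooth_fun SA (fun u => G u (X u) (Y u)).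
Proof.
move=> sX sY; rewrite (sasaki_splitf sX sY); apply: smooth_funD.
  exact: vmetric_smooth (Jhsec sX) (Jhsec sY).
exact: vmetric_smooth (vsecP sX) (vsecP sY).
Qed.

Lemma sasaki_riemannian : riemannian_metric G.
Proof.
split.
- by move=> u v v' w c tv tv' tw; exact: (sasaki_linear hF hH c tv tv' tw).
- by move=> u v w _ _; exact: (sasakiC hF).
- by move=> u v tv v0; exact: (sasaki_pos hF hH tv v0).
- exact: sasaki_smooth.
Qed.

Lemma J_almost_complex : almost_complex J.
Proof.
split.
- by move=> u v tv; exact: (J_tangent manA slitM' hH hJ tv).
- by move=> u v w c tv tw; exact: (J_linear hJ c tv tw).
- by move=> u v tv; exact: (JJ manA slitM' hH hJ tv).
- exact: Jsec.
Qed.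

Lemma vproj_J u v : tangent SA u v -> vproj H u (J u v) = J u (hproj H u v).
Proof.
move=> tv; have cu := sdom_at manA slitM' u.
have tJ := J_tangent manA slitM' hH hJ tv.
have t1 := vertical_tangent (vproj_vertical hH tJ).
have t2 := vertical_tangent (J_hproj_vertical hF hH hJ tv).
apply: (tangent_inj t1 t2 cu).
rewrite (vproj_chart manA slitM' hH tJ cu) (J_chart manA slitM' hH hJ tv cu).
rewrite (J_chart manA slitM' hH hJ (hproj_tangent hH tv) cu).
rewrite (hproj_chart manA slitM' hH tv cu) /= subrr hlift0 sub0r.
by rewrite addrAC subrr add0r.
Qed.

Lemma J_vertical_H u v : vertical u v -> H u (J u v).
Proof.
move=> vv; have tv := vertical_tangent vv; have cu := sdom_at manA slitM' u.
have tJ := J_tangent manA slitM' hH hJ tv.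
have [HJ _] := hprojP hH tJ.
suff <- : hproj H u (J u v) = J u v by [].
apply: (tangent_inj (hproj_tangent hH tJ) tJ cu).
rewrite (hproj_chart manA slitM' hH tJ cu) (J_chart manA slitM' hH hJ tv cu)/=.
by rewrite (vertical_fst manA slitM' cu vv) hlift0 !subr0.
Qed.

Lemma hproj_J u v : tangent SA u v -> hproj H u (J u v) = J u (vproj H u v).
Proof.
move=> tv; have tJ := J_tangent manA slitM' hH hJ tv.
apply: (hproj_uniq hH tJ (J_vertical_H (vproj_vertical hH tv))).
have th := hproj_tangent hH tv.
rewrite /vproj (JB manA slitM' hJ tv th) opprB addrC subrK.
exact: (J_hproj_vertical hF hH hJ tv).
Qed.

(** [D X Y] has the form [v - J w] with [v] and [w] vertical. This lemma and the next two recover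
    the two covariant derivatives from it. *)
Lemma hproj_recombine u v w : vertical u v -> vertical u w ->
  hproj H u (v - J u w) = - J u w.
Proof.
move=> vv vw; have tJ := J_tangent manA slitM' hH hJ (vertical_tangent vw).
apply: (hproj_uniq hH (tangentB satlas (vertical_tangent vv) tJ)).
  by rewrite -scaleN1r; apply: (H_scale hH); exact: J_vertical_H.
by rewrite opprK subrK.
Qed.

Lemma Jhproj_recombine u v w : vertical u v -> vertical u w ->
  J u (hproj H u (v - J u w)) = w.
Proof.
move=> vv vw; have tw := vertical_tangent vw.
rewrite (hproj_recombine vv vw) (JN hJ (J_tangent manA slitM' hH hJ tw)).
by rewrite (JJ manA slitM' hH hJ tw) opprK.
Qed.

Lemma vproj_recombine u v w : vertical u v -> vertical u w ->
  vproj H u (v - J u w) = v.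
Proof. by move=> vv vw; rewrite /vproj (hproj_recombine vv vw) opprK subrK. Qed.

(** * The connection [D] is metric and commutes with [J] *)

Context {nab : (slit M' -> fam') -> (slit M' -> fam') -> (slit M' -> fam')}.
Hypothesis lnab : linear_connection vertical nab.
Hypothesis mnab : metric_connection vertical (vmetric F) nab.
Local Notation D := (natural_connection H J nab).

Lemma nab_sec X Y : tsec X -> vsec Y -> vsec (nab X Y).
Proof. by case: lnab => s _ _ _ _; exact: s. Qed.

Lemma nab0 X : tsec X -> nab X 0 = 0.
Proof.
move=> sX; case: lnab => _ _ _ aD _; have := aD X 0 0 sX vsec0 vsec0.
by rewrite addr0 => /eqP; rewrite -subr_eq0 opprD addNKr oppr_eq0 => /eqP.
Qed.

Lemma nabN X Y : tsec X -> vsec Y -> nab X (- Y) = - nab X Y.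
Proof.
move=> sX sY; case: lnab => _ _ _ aD _; have := aD X Y (- Y) sX sY (vsecN sY).
by rewrite subrr (nab0 sX) => /esym/eqP; rewrite addrC addr_eq0 => /eqP.
Qed.

Lemma DE X Y u : D X Y u = nab X (vX Y) u - J u (nab X (JX (hX Y)) u).
Proof. by []. Qed.

Lemma nabv_vertical X Y u : tsec X -> tsec Y -> vertical u (nab X (vX Y) u).
Proof. by move=> sX sY; case: (nab_sec sX (vsecP sY)). Qed.

Lemma nabh_vertical X Y u : tsec X -> tsec Y -> vertical u (nab X (JX (hX Y)) u).
Proof. by move=> sX sY; case: (nab_sec sX (Jhsec sY)). Qed.

Lemma D_sec X Y : tsec X -> tsec Y -> tsec (D X Y).
Proof.
move=> sX sY; apply: (sectionB satlas).
  exact: section_vertical (nab_sec sX (vsecP sY)).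
exact: Jsec (section_vertical (nab_sec sX (Jhsec sY))).
Qed.

(** [D X Y] is built from the vertical sections vY and JhY. Replacing Y by JY turns them into JhY
    and -vY, and applying [J] to [D X Y] exchanges its two terms in the same way. *)
Lemma D_J X Y : tsec X -> tsec Y -> D X (JX Y) = JX (D X Y).
Proof.
move=> sX sY; have [tY _] := sY.
have e1 : vX (JX Y) = JX (hX Y) by apply/funext => u; exact: vproj_J (tY u).
have e2 : JX (hX (JX Y)) = - vX Y.
  apply/funext => u; rewrite /bapp (hproj_J (tY u)).
  exact: (JJ manA slitM' hH hJ (vertical_tangent (vproj_vertical hH (tY u)))).
have E1 := congr1 (nab X) e1.
have E2 := etrans (congr1 (nab X) e2) (nabN sX (vsecP sY)).
apply/funext => u.
apply: (etrans (congr2 (fun P Q : slit M' -> fam' => P u - J u (Q u)) E1 E2)).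
have t1 := vertical_tangent (nabv_vertical u sX sY).
have t2 := vertical_tangent (nabh_vertical u sX sY).
apply: (etrans (congr1 (fun w => _ - w) (JN hJ t1))); rewrite opprK addrC.
apply: esym; apply: (etrans (JB manA slitM' hJ t1 (J_tangent manA slitM' hH hJ t2))).
by apply: (etrans (congr1 (fun w => _ - w) (JJ manA slitM' hH hJ t2))); rewrite opprK.
Qed.

(** By [sasaki_splitf], [G] is the sum of the vertical metric on the sections JhY and on the
    sections vY. These are the sections which [D] differentiates by [nab], so metricity of [nab] is
    used twice. *)
Lemma D_metric : metric_connection (tangent SA) G D.
Proof.
move=> X Y Z sX sY sZ u; have tX := proj1 sX u.
have [tD1 _] := D_sec sX sY; have [tD2 _] := D_sec sX sZ.
have [tY _] := sY; have [tZ _] := sZ.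
rewrite (sasaki_splitf sY sZ) (actD satlas _ _ (vmetric_smooth (Jhsec sY) (Jhsec sZ))
  (vmetric_smooth (vsecP sY) (vsecP sZ))).
rewrite (mnab sX (Jhsec sY) (Jhsec sZ)) (mnab sX (vsecP sY) (vsecP sZ)).
rewrite (sasaki_split hF hH hJ (tD1 u) (tZ u)) (sasaki_split hF hH hJ (tY u) (tD2 u)).
have e1 W : tsec W -> J u (hproj H u (D X W u)) = nab X (JX (hX W)) u.
  by move=> sW; rewrite DE; apply: Jhproj_recombine; [exact: nabv_vertical|exact: nabh_vertical].
have e2 W : tsec W -> vproj H u (D X W u) = nab X (vX W) u.
  by move=> sW; rewrite DE; apply: vproj_recombine; [exact: nabv_vertical|exact: nabh_vertical].
have K (f : fam' -> fam' -> R) p p' q q' r r' s s' y1 z1 y2 z2 :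
    p = p' -> q = q' -> r = r' -> s = s' ->
    f p' z1 + f y1 q' + (f r' z2 + f y2 s') =
    f p z1 + f r z2 + (f y1 q + f y2 s).
  by move=> -> -> -> ->; exact: addrACA.
exact: (K (vmetric F u) _ _ _ _ _ _ _ _ _ _ _ _ (e1 Y sY) (e1 Z sZ) (e2 Y sY) (e2 Z sZ)).
Qed.

(** * Consequences of the vanishing torsion *)

Hypothesis hTD : forall X Y, tsec X -> tsec Y -> torsion D X Y = 0.

Lemma bracket_D X Y u : tsec X -> tsec Y -> bracket X Y u = D X Y u - D Y X u.
Proof.
move=> sX sY; have /(congr1 (fun f => f u)) := hTD sX sY.
move=> /eqP; rewrite -[torsion _ _ _ u]/(D X Y u - D Y X u - bracket X Y u) subr_eq0.
by move=> /eqP.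
Qed.

Lemma J_integrable : integrable_acs J.
Proof.
split; first exact: J_almost_complex.
move=> X Y sX sY; have sJX := Jsec sX; have sJY := Jsec sY.
apply/funext => u; rewrite -[nijenhuis _ _ _ u]/(bracket (JX X) (JX Y) u
  - J u (bracket (JX X) Y u) - J u (bracket X (JX Y) u) - bracket X Y u).
have [t1 _] := D_sec sX sY; have [t2 _] := D_sec sY sX.
have [t3 _] := D_sec sJX sY; have [t4 _] := D_sec sJY sX.
have DJ W W' : tsec W -> tsec W' -> D W (JX W') u = J u (D W W' u).
  by move=> sW sW'; exact: (congr1 (fun f => f u) (D_J sW sW')).
have B1 : bracket (JX X) (JX Y) u = J u (D (JX X) Y u) - J u (D (JX Y) X u).
  by apply: (etrans (bracket_D u sJX sJY)); exact: (congr2 (fun p q : fam' => p - q) (DJ _ _ sJX sY) (DJ _ _ sJY sX)).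
have B2 : J u (bracket (JX X) Y u) = J u (D (JX X) Y u) + D Y X u.
  apply: (etrans (congr1 (J u) (bracket_D u sJX sY))).
  apply: (etrans (congr1 (fun w => J u (_ - w)) (DJ _ _ sY sX))).
  apply: (etrans (JB manA slitM' hJ (t3 u) (J_tangent manA slitM' hH hJ (t2 u)))).
  by apply: (etrans (congr1 (fun w => _ - w) (JJ manA slitM' hH hJ (t2 u)))); rewrite opprK.
have B3 : J u (bracket X (JX Y) u) = - D X Y u - J u (D (JX Y) X u).
  apply: (etrans (congr1 (J u) (bracket_D u sX sJY))).
  apply: (etrans (congr1 (fun w => J u (w - _)) (DJ _ _ sX sY))).
  apply: (etrans (JB manA slitM' hJ (J_tangent manA slitM' hH hJ (t1 u)) (t4 u))).
  exact: (congr1 (fun w => w - _) (JJ manA slitM' hH hJ (t1 u))).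
(* Each bracket is a difference of two [D]-derivatives and [J] commutes with [D]. The Nijenhuis
   tensor is then a signed sum of [p] = J D_JX Y, [q] = J D_JY X, [r] = D_X Y and [s] = D_Y X in
   which everything cancels. *)
have K (w1 w2 w3 w4 p q r s : fam') : w1 = p - q -> w2 = p + s -> w3 = - r - q ->
    w4 = r - s -> w1 - w2 - w3 - w4 = 0.
  move=> -> -> -> ->; rewrite (opprD p s) (addrACA p) subrr add0r.
  by rewrite (opprD (- r)) !opprK [r + q]addrC (addrACA (- q)) addNr add0r [- s + r]addrC subrr.
exact: (K _ _ _ _ _ _ _ _ B1 B2 B3 (bracket_D u sX sY)).
Qed.

Lemma sasaki0l u w : tangent SA u w -> G u 0 w = 0.
Proof.
move=> tw; have t0 := tangent0 SA u; have := sasaki_linear hF hH 1 t0 t0 tw.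
by rewrite scale1r addr0 mul1r => /eqP; rewrite -subr_eq0 opprD addNKr oppr_eq0 => /eqP.
Qed.

Lemma sasakiD u v v' w : tangent SA u v -> tangent SA u v' -> tangent SA u w ->
  G u (v + v') w = G u v w + G u v' w.
Proof.
move=> tv tv' tw; have := sasaki_linear hF hH 1 tv tv' tw.
by rewrite scale1r mul1r.
Qed.

Lemma sasakiN u v w : tangent SA u v -> tangent SA u w -> G u (- v) w = - G u v w.
Proof.
move=> tv tw; have := sasaki_linear hF hH (-1) tv (tangent0 SA u) tw.
by rewrite addr0 scaleN1r mulN1r (sasaki0l tw) addr0.
Qed.

Lemma sasakiB u v v' w : tangent SA u v -> tangent SA u v' -> tangent SA u w ->
  G u (v - v') w = G u v w - G u v' w.
Proof.
move=> tv tv' tw; apply: (etrans (sasakiD tv (tangentN satlas tv') tw)).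
exact: (congr1 (fun r => _ + r) (sasakiN tv' tw)).
Qed.

(* The difference [W] of two torsion-free metric connections is symmetric in
   its two arguments, while [G (W X Y) Z] is skew in [Y] and [Z]. *)
Lemma levi_civita_D nab' X Y : levi_civita G nab' -> tsec X -> tsec Y ->
  nab' X Y = D X Y.
Proof.
move=> [[nsec _ _ _ _] nmet ntor] sX sY.
pose al (P Q S : slit M' -> fam') u := G u (nab' P Q u - D P Q u) (S u).
have tn P Q u : tsec P -> tsec Q -> tangent SA u (nab' P Q u).
  by move=> sP sQ; exact: (proj1 (nsec P Q sP sQ) u).
have tD P Q u : tsec P -> tsec Q -> tangent SA u (D P Q u).
  by move=> sP sQ; exact: (proj1 (D_sec sP sQ) u).
have alsym P Q S u : tsec P -> tsec Q -> al P Q S u = al Q P S u.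
  move=> sP sQ; apply: (congr1 (fun w => G u w (S u))).
  have b1 := bracket_D u sP sQ.
  have b2 : nab' P Q u - nab' Q P u - bracket P Q u = 0.
    exact: (congr1 (fun f => f u) (ntor P Q sP sQ)).
  have K (p q r s b : fam') : b = r - s -> p - q - b = 0 -> p - r = q - s.
    move=> -> /eqP; rewrite subr_eq0 => /eqP E.
    by rewrite (canRL (subrK q) E) [_ + q - r]addrAC [r - s - r]addrAC subrr add0r addrC.
  exact: (K _ _ _ _ _ b1 b2).
have alskew P Q S u : tsec P -> tsec Q -> tsec S -> al P Q S u = - al P S Q u.
  move=> sP sQ sS; have tQ := proj1 sQ u; have tS := proj1 sS u.
  have e1 := nmet P Q S sP sQ sS u; have e2 := D_metric sP sQ sS u.
  have h1 := sasakiB (tn P Q u sP sQ) (tD P Q u sP sQ) tS.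
  have h2 := sasakiB (tn P S u sP sS) (tD P S u sP sS) tQ.
  have h3 := sasakiC hF (H := H) u (nab' P S u) (Q u).
  have h4 := sasakiC hF (H := H) u (D P S u) (Q u).
  have K (a1 a2 p q r s q' s' e : R) : a1 = p - r -> a2 = q' - s' -> q' = q ->
      s' = s -> e = p + q -> e = r + s -> a1 = - a2.
    move=> -> -> -> -> -> E; apply/eqP; rewrite -addr_eq0; apply/eqP.
    by rewrite addrACA E -opprD subrr.
  exact: (K _ _ _ _ _ _ _ _ _ h1 h2 h3 h4 e1 e2).
(* Alternating three skew and three symmetric exchanges returns to the first term with the opposite
   sign. *)
have K (x1 x2 x3 x4 x5 x6 : R) : x1 = - x2 -> x2 = x3 -> x3 = - x4 -> x4 = x5 ->
    x5 = - x6 -> x6 = x1 -> x1 = 0.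
  by lra.
have al0 u Z : tsec Z -> al X Y Z u = 0.
  move=> sZ.
  have a1 := alskew X Y Z u sX sY sZ; have a2 := alsym X Z Y u sX sZ.
  have a3 := alskew Z X Y u sZ sX sY; have a4 := alsym Z Y X u sZ sY.
  have a5 := alskew Y Z X u sY sZ sX; have a6 := alsym Y X Z u sY sX.
  exact: (K _ _ _ _ _ _ a1 a2 a3 a4 a5 a6).
apply/funext => u; apply/eqP; rewrite -subr_eq0; apply/eqP.
have [//|w0] := pselect (nab' X Y u - D X Y u = 0).
have tW := tangentB satlas (tn _ _ u sX sY) (tD _ _ u sX sY).
have pos0 (x : R) : 0 < x -> x = 0 -> False by move=> + x0; rewrite x0 ltxx.
case: (pos0 _ (sasaki_pos hF hH tW w0)).
(* The third argument is the difference itself, so [al] is its squared length. *)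
exact: (al0 u (nab' X Y - D X Y) (sectionB satlas (nsec _ _ sX sY) (D_sec sX sY))).
Qed.

Lemma levi_civita_parallel nab' : levi_civita G nab' -> parallel nab' J.
Proof.
move=> lc X Y sX sY; have e1 := levi_civita_D lc sX sY.
have e2 := etrans (levi_civita_D lc sX (Jsec sY)) (D_J sX sY).
apply: (etrans (congr2 (fun P Q => P - JX Q) e2 e1)); exact: subrr.
Qed.

Lemma kahler_J : kahlerian J G.
Proof.
split.
- exact: sasaki_riemannian.
- exact: J_integrable.
- by move=> u v w tv tw; exact: (sasaki_J hF hH hJ tv tw).
move=> X Y Z sX sY sZ u.
have tD P Q : tsec P -> tsec Q -> tangent SA u (D P Q u).
  by move=> sP sQ; exact: (proj1 (D_sec sP sQ) u).
have tt P : tsec P -> tangent SA u (P u) by move=> sP; exact: (proj1 sP u).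
pose w (p q : fam') := G u p (J u q).
have wskew p q : tangent SA u p -> tangent SA u q -> w p q = - w q p.
  move=> tp tq; have tJp := J_tangent manA slitM' hH hJ tp.
  have tJq := J_tangent manA slitM' hH hJ tq.
  have h1 := sasaki_J hF hH hJ tp tJq.
  have h2 := congr1 (G u (J u p)) (JJ manA slitM' hH hJ tq).
  have h3 := sasakiC hF (H := H) u (J u p) (- q).
  have h4 := sasakiN tq tJp.
  exact: (etrans (esym h1) (etrans h2 (etrans h3 h4))).
have wB p q r : tangent SA u p -> tangent SA u q -> tangent SA u r ->
    w (p - q) r = w p r - w q r.
  by move=> tp tq tr; exact: (sasakiB tp tq (J_tangent manA slitM' hH hJ tr)).
have wact P Q S : tsec P -> tsec Q -> tsec S ->
    act P (fun q => G q (Q q) (J q (S q))) u = w (D P Q u) (S u) + w (Q u) (D P S u).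
  move=> sP sQ sS; apply: (etrans (D_metric sP sQ (Jsec sS) u)).
  apply: (congr1 (fun r => _ + r)).
  exact: (congr1 (fun f => G u (Q u) (f u)) (D_J sP sS)).
have wbr P Q S : tsec P -> tsec Q -> tsec S ->
    w (bracket P Q u) (S u) = w (D P Q u) (S u) - w (D Q P u) (S u).
  move=> sP sQ sS; apply: (etrans _ (wB _ _ _ (tD _ _ sP sQ) (tD _ _ sQ sP) (tt _ sS))).
  exact: (congr1 (fun v => w v (S u)) (bracket_D u sP sQ)).
(* The form [w] is [D]-parallel, as [G] and [J] are, so each action term expands by the Leibniz rule
   and each bracket by vanishing torsion; skewness of [w] cancels the rest. *)
have K (a1 a2 a3 b1 b2 b3 x1 x2 x3 x4 x5 x6 y1 y2 y3 : R) : a1 = x1 + y1 -> a2 = x2 + y2 ->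
    a3 = x3 + y3 -> b1 = x1 - x4 -> b2 = x2 - x5 -> b3 = x3 - x6 ->
    y1 = - x6 -> y2 = - x4 -> y3 = - x5 -> a1 + a2 + a3 - b1 - b2 - b3 = 0 :> R.
  by move=> -> -> -> -> -> -> -> -> ->; ring.
exact: (K _ _ _ _ _ _ _ _ _ _ _ _ _ _ _ (wact _ _ _ sX sY sZ) (wact _ _ _ sY sZ sX)
  (wact _ _ _ sZ sX sY) (wbr _ _ _ sX sY sZ) (wbr _ _ _ sY sZ sX) (wbr _ _ _ sZ sX sY)
  (wskew _ _ (tt _ sY) (tD _ _ sX sZ)) (wskew _ _ (tt _ sZ) (tD _ _ sY sX))
  (wskew _ _ (tt _ sX) (tD _ _ sZ sY))).
Qed.

End Cartan.

(** * Vanishing of the flag curvature *)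

Definition gform (R : realType) (m : nat) (L : 'rV[R]_m * 'rV[R]_m -> R)
  (v w : 'rV[R]_m) (z : 'rV[R]_m * 'rV[R]_m) : R := bil (gij L z) v w.

(* If [nu v] is the fibre component [- N v] of the horizontal lift of [v],
   then [gamma nu v w] is the derivative of [N v] in the fibre direction [w]. *)
Definition gamma (R : realType) (m : nat)
  (nu : 'rV[R]_m -> 'rV[R]_m * 'rV[R]_m -> 'rV[R]_m) (v w : 'rV[R]_m)
  (z : 'rV[R]_m * 'rV[R]_m) : 'rV[R]_m := - 'D_(0, w) (nu v) z.

Section LocalFlatness.
Context {R : realType} {m : nat}.
Local Notation E := ('rV[R]_m * 'rV[R]_m)%type.
Implicit Types (v w c : 'rV[R]_m) (z : E).

Lemma derive_coord (f : E -> 'rV[R]_m) k u z : differentiable f z ->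
  ('D_u f z) 0 k = 'D_u (fun y => f y 0 k) z.
Proof.
move=> df; apply: esym.
apply: (@derive_clinear _ _ _ _ f [the {linear 'rV[R]_m -> R} of rcoord k] z u) => //.
exact: coord_continuous.
Qed.

Lemma differentiable_coordf (f : E -> 'rV[R]_m) k z : differentiable f z ->
  differentiable (fun y => f y 0 k) z.
Proof.
move=> df; apply: (@differentiable_comp _ _ _ _ f (fun x : 'rV[R]_m => x 0 k)) => //.
exact: differentiable_coord.
Qed.

Lemma derive_dot (f : E -> 'rV[R]_m) (h : 'I_m -> E -> R) u z :
  differentiable f z -> (forall i, differentiable (h i) z) ->
  'D_u (fun y => \sum_i f y 0 i * h i y) z =
  \sum_i ('D_u f z) 0 i * h i z + \sum_i f z 0 i * 'D_u (h i) z.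
Proof.
move=> df dh.
have dfi i : differentiable (fun y => f y 0 i) z by exact: differentiable_coordf.
have -> : (fun y => \sum_i f y 0 i * h i y) =
    \sum_i ((fun y => f y 0 i) * h i).
  by apply/funext => y; rewrite fct_sumE.
rewrite derive_sum => [|i]; last first.
  by apply: derivableM; apply: diff_derivable.
rewrite -big_split/=; apply: eq_bigr => i _.
rewrite deriveM; try exact: diff_derivable.
have -> := derive_coord i u df.
exact: (etrans (addrC _ _) (congr2 +%R (mulrC _ _) erefl)).
Qed.

Lemma bil_deltal (g : 'M[R]_m) i w :
  bil g (delta_mx 0 i) w = \sum_j g i j * w 0 j.
Proof.
rewrite /bil (bigD1 i)//= [X in _ + X]big1 ?addr0 => [|k /negPf ki]; last first.
  by rewrite big1// => l _; rewrite !mxE ki andbF /= mulr0 mul0r.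
by apply: eq_bigr => j _; rewrite !mxE !eqxx/= mulr1.
Qed.

Lemma bil_expandl (g : 'M[R]_m) v w :
  bil g v w = \sum_i v 0 i * bil g (delta_mx 0 i) w.
Proof.
apply: eq_bigr => i _; rewrite bil_deltal mulr_sumr.
by apply: eq_bigr => j _; rewrite mulrA [g i j * _]mulrC.
Qed.

Lemma bil_mulmx (g : 'M[R]_m) v w : bil g v w = (v *m g *m w^T) 0 0.
Proof.
rewrite /bil mxE exchange_big/=; apply: eq_bigr => j _; rewrite !mxE mulr_suml.
by apply: eq_bigr => i _; rewrite [g i j * _]mulrC.
Qed.

(** A nonzero vector in the kernel would have length 0. *)
Lemma posdef_unitmx (g : 'M[R]_m) :
  (forall w, w != 0 -> 0 < bil g w w) -> g \in unitmx.
Proof.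
move=> gpos; rewrite -row_free_unit -kermx_eq0; apply/negPn/negP => k0.
have [w wk w0] : exists2 w : 'rV[R]_m, (w <= kermx g)%MS & w != 0.
  by case/rowV0Pn: k0 => w wk w0; exists w.
have := gpos w w0; rewrite bil_mulmx.
have -> : w *m g = 0 by apply/sub_kermxP.
by rewrite mul0mx mxE ltxx.
Qed.

Variables (N : set E) (L : E -> R) (nu : 'rV[R]_m -> E -> 'rV[R]_m).
Local Notation Gam := (gamma nu).
Local Notation g := (gform L).

(** What the torsion and metricity say about a local frame. [HA] and [HB] are metricity along the
    fibre and along horizontal lifts; in [HB] the derivative is purely along x because [HA] removes
    the fibre part of the lift. [HC] and [HD] are the base and fibre components of the horizontal
    torsion, [HD] being the vanishing of the bracket of two lifts. *)
Hypothesis oN : open N.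
Hypothesis sL : smooth_on N L.
Hypothesis snu : forall v, smooth_on N (nu v).
Hypothesis gpos : forall z w, N z -> w != 0 -> 0 < bil (gij L z) w w.
Hypothesis euler : forall z, N z -> 'D_(0, z.2) L z = 2 * L z.
Hypothesis HA : forall z v w c, N z -> 'D_(0, c) (g v w) z = 0.
Hypothesis HB : forall z v w w', N z ->
  'D_(v, 0) (g w w') z = g (Gam v w z) w' z + g w (Gam v w' z) z.
Hypothesis HC : forall z v w, N z -> Gam v w z = Gam w v z.
Hypothesis HD : forall z v w, N z ->
  'D_(v, nu v z) (nu w) z = 'D_(w, nu w z) (nu v) z.

Lemma nu_diff v z : N z -> differentiable (nu v) z.
Proof. exact: smooth_on_diff (snu v). Qed.

Lemma Gam_smooth v w : smooth_on N (Gam v w).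
Proof. by apply: smooth_onN => //; apply: smooth_on_derive; exact: snu. Qed.

Lemma Gam_diff v w z : N z -> differentiable (Gam v w) z.
Proof. exact: smooth_on_diff (Gam_smooth v w). Qed.

Lemma Gam_expandr v w z : N z ->
  Gam v w z = \sum_j w 0 j *: Gam v (delta_mx 0 j) z.
Proof.
move=> Nz; rewrite /gamma vec_ey derivev_sum; last exact: nu_diff.
by rewrite -sumrN; apply: eq_bigr => j _; rewrite scalerN.
Qed.

Lemma GamNr v w z : N z -> Gam v (- w) z = - Gam v w z.
Proof.
move=> Nz; apply: (congr1 -%R).
have -> : (0, - w) = (-1) *: (0, w) + 0 :> E.
  by rewrite addr0 scaleN1r [RHS]surjective_pairing/= oppr0.
by rewrite derive_linear ?derive0 ?addr0 ?scaleN1r//; exact: nu_diff.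
Qed.

Lemma Gam_expandrk v w z k : N z ->
  Gam v w z 0 k = \sum_j w 0 j * Gam v (delta_mx 0 j) z 0 k.
Proof.
move=> Nz; rewrite (Gam_expandr v w Nz) summxE; apply: eq_bigr => j _.
by rewrite mxE.
Qed.

(** [nu] is an abstract family, not known to be linear in its index; the expansion in [v] comes from
    the one in [w] by the symmetry [HC]. *)
Lemma Gam_expandlk v w z k : N z ->
  Gam v w z 0 k = \sum_i v 0 i * Gam (delta_mx 0 i) w z 0 k.
Proof.
move=> Nz; rewrite (HC v w Nz) (Gam_expandrk w v k Nz).
by apply: eq_bigr => i _; rewrite (HC _ _ Nz).
Qed.

Lemma g_smooth v w : smooth_on N (g v w).
Proof.
apply: (@smooth_on_eq _ _ _ _ _ (fun z => 2^-1 * 'D_(0, v) ('D_(0, w) L) z)) => //.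
  by move=> z /set_mem Nz; rewrite (bil_gij v w oN Nz sL) mulKf.
apply: smooth_onM => //; first exact: smooth_on_cst.
by do 2!apply: smooth_on_derive.
Qed.

Lemma g_diff v w z : N z -> differentiable (g v w) z.
Proof. exact: smooth_on_diff (g_smooth v w). Qed.

Lemma gC v w z : N z -> g v w z = g w v z.
Proof. by move=> Nz; apply: bilC; exact: (gij_sym oN Nz sL). Qed.

Lemma derive_gGam v w w' c z : N z ->
  'D_(0, c) (fun y => g (Gam v w y) w' y) z = g ('D_(0, c) (Gam v w) z) w' z.
Proof.
move=> Nz.
have -> : (fun y => g (Gam v w y) w' y) =
    (fun y => \sum_i Gam v w y 0 i * g (delta_mx 0 i) w' y).
  by apply/funext => y; exact: bil_expandl.
rewrite derive_dot; last 2 first.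
- exact: Gam_diff.
- by move=> i; exact: g_diff.
rewrite [X in _ + X]big1 ?addr0 => [|i _]; last by rewrite HA// mulr0.
by rewrite [RHS]bil_expandl.
Qed.

(* [Gam] is the Christoffel symbol of a metric which does not depend on [y]:
   the usual cyclic argument kills its vertical derivative. *)
Lemma Gam_vertical v w c z : N z -> 'D_(0, c) (Gam v w) z = 0.
Proof.
move=> Nz; pose T v w w' := g ('D_(0, c) (Gam v w) z) w' z.
have Tsym v1 w1 w2 : T v1 w1 w2 = T w1 v1 w2.
  apply: (congr1 (fun x => g x w2 z)); apply: (derive_eq_on _ oN Nz) => y /set_mem Ny.
  exact: (HC v1 w1 Ny).
have Tskew v1 w1 w2 : T v1 w1 w2 + T v1 w2 w1 = 0.
  have dd a b d : differentiable (fun y => g (Gam a b y) d y) z.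
    have -> : (fun y => g (Gam a b y) d y) =
        (fun y => \sum_i Gam a b y 0 i * g (delta_mx 0 i) d y).
      by apply/funext => y; exact: bil_expandl.
    apply: (@smooth_on_diff _ _ _ N) Nz; apply: smooth_on_sum => // i _.
    apply: smooth_onM => //; last exact: g_smooth.
    exact: smooth_on_coord (Gam_smooth _ _).
  apply: (etrans (esym (congr2 +%R (derive_gGam v1 w1 w2 c Nz) (derive_gGam v1 w2 w1 c Nz)))).
  have e : 'D_(0, c) ((fun y => g (Gam v1 w1 y) w2 y) + (fun y => g (Gam v1 w2 y) w1 y)) z
      = 'D_(0, c) (fun y => g (Gam v1 w1 y) w2 y) z + 'D_(0, c) (fun y => g (Gam v1 w2 y) w1 y) z.
    by apply: deriveD; apply: diff_derivable; exact: dd.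
  apply: (etrans (esym e)).
  (* By [HB] the symmetrised sum is a horizontal derivative of the metric; exchanging the two
     derivatives, it vanishes by [HA]. *)
  transitivity ('D_(0, c) ('D_(v1, 0) (g w1 w2)) z).
    apply: (derive_eq_on _ oN Nz) => y /set_mem Ny; apply: esym.
    by apply: (etrans (HB v1 w1 w2 Ny)); apply: (congr1 (fun r => _ + r)); exact: gC.
  apply: (etrans (smooth_schwarz _ _ oN Nz (g_smooth w1 w2))).
  apply: (etrans (derive_eq_on (g := fun=> 0) _ oN Nz _)); last exact: derive_cst.
  by move=> y /set_mem Ny; exact: HA.
have K (x1 x2 x3 x4 x5 x6 : R) : x1 + x2 = 0 -> x2 = x3 -> x3 + x4 = 0 ->
    x4 = x5 -> x5 + x6 = 0 -> x6 = x1 -> x1 = 0.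
  by lra.
have T0 v1 w1 w2 : T v1 w1 w2 = 0.
  have a1 := Tskew v1 w1 w2; have a2 := Tsym v1 w2 w1; have a3 := Tskew w2 v1 w1.
  have a4 := Tsym w2 w1 v1; have a5 := Tskew w1 w2 v1; have a6 := Tsym w1 v1 w2.
  exact: (K _ _ _ _ _ _ a1 a2 a3 a4 a5 a6).
apply/eqP; apply/negPn/negP => d0; have := gpos Nz d0.
by rewrite [X in 0 < X](T0 v w ('D_(0, c) (Gam v w) z)) ltxx.
Qed.

(** Differentiating Euler's relation in the direction [w] gives D_w L + 2 g(w, y) = 2 D_w L. *)
Lemma derive_L w z : N z -> 'D_(0, w) L z = 2 * g w z.2 z.
Proof.
move=> Nz.
have dL := smooth_on_diff sL Nz.
have dD j : differentiable ('D_(ey j) L) z.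
  exact: smooth_on_diff (smooth_on_derive _ sL) Nz.
have e1 : 'D_(0, w) (fun y : E => \sum_j y.2 0 j * 'D_(ey j) L y) z
    = 2 * 'D_(0, w) L z.
  rewrite (@derive_eq_on _ _ _ N _ (2 \*o L))//.
    rewrite -[_ \*o _]/(2 *: L) deriveZ//; exact: diff_derivable.
  move=> y /set_mem Ny; rewrite /= -euler// derive_ey//.
  exact: smooth_on_diff sL Ny.
have d2 : differentiable (snd : E -> 'rV[R]_m) z.
  exact/(@linear_differentiable _ _ _ [the {linear E -> 'rV[R]_m} of snd])/continuous_sndE.
have D2 : 'D_(0, w) (snd : E -> 'rV[R]_m) z = w.
  rewrite deriveE// (@diff_lin _ _ _ [the {linear E -> 'rV[R]_m} of snd])//.
  exact: continuous_sndE.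
move: e1; rewrite (@derive_dot snd)// D2 -derive_ey//.
have -> : \sum_i z.2 0 i * 'D_(0, w) ('D_(ey i) L) z = 2 * g w z.2 z.
  rewrite -(bil_gij _ _ oN Nz sL) -derive_lincomb//.
  apply: (derive_eq_on _ oN Nz) => y /set_mem Ny; rewrite derive_ey//.
  exact: smooth_on_diff sL Ny.
by move=> e; lra.
Qed.

Lemma LE z : N z -> L z = g z.2 z.2 z.
Proof. by move=> Nz; have := euler Nz; rewrite derive_L//; lra. Qed.

Lemma near_line_N z u : N z -> \forall t \near (0 : R), N (t *: (u, 0) + z).
Proof. by move=> Nz; apply: near0_line; exact: (open_nbhs_nbhs (conj oN Nz)). Qed.

Lemma line_snd z u (t : R) : (t *: (u, 0) + z : E).2 = z.2.
Proof. by rewrite /= scaler0 add0r. Qed.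

(** The vector y is constant along lines in the base direction, so it may be frozen at its value at
    [z]. *)
Lemma derive_DL c w z : N z ->
  'D_(c, 0) ('D_(0, w) L) z = 2 * 'D_(c, 0) (g w z.2) z.
Proof.
move=> Nz; transitivity ('D_(c, 0) (2 *: g w z.2) z).
  apply: derive_line_eq; apply: filterS (near_line_N c Nz) => t Nt.
  by apply: (etrans (derive_L w Nt)); rewrite line_snd.
by rewrite deriveZ//; apply: diff_derivable; exact: g_diff.
Qed.

Lemma derive_Lx w z : N z -> 'D_(w, 0) L z = 'D_(w, 0) (g z.2 z.2) z.
Proof.
move=> Nz; apply: derive_line_eq; apply: filterS (near_line_N w Nz) => t Nt.
by apply: (etrans (LE Nt)); rewrite line_snd.
Qed.

(** By [HB] the left side is 2 (g(Gamma(y, e_l), y) + g(e_l, Gamma(y, y))) - 2 g(Gamma(e_l, y), y),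
    and [HC] cancels the two terms paired with y. *)
Lemma spray_term z l : N z ->
  \sum_k 'D_(ex k) ('D_(ey l) L) z * z.2 0 k - 'D_(ex l) L z =
  2 * g (delta_mx 0 l) (Gam z.2 z.2 z) z.
Proof.
move=> Nz; have dl : differentiable ('D_(ey l) L) z.
  exact: smooth_on_diff (smooth_on_derive _ sL) Nz.
have -> : \sum_k 'D_(ex k) ('D_(ey l) L) z * z.2 0 k = 'D_(z.2, 0) ('D_(ey l) L) z.
  by rewrite vec_ex derivev_sum//; apply: eq_bigr => k _; rewrite mulrC.
have e1 := derive_DL z.2 (delta_mx 0 l) Nz.
have e2 := derive_Lx (delta_mx 0 l) Nz.
have e3 := HB z.2 (delta_mx 0 l) z.2 Nz.
have e4 := HB (delta_mx 0 l) z.2 z.2 Nz.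
have e5 := congr1 (fun x => g x z.2 z) (HC z.2 (delta_mx 0 l) Nz).
have e6 := gC z.2 (Gam (delta_mx 0 l) z.2 z) Nz.
have K (a b c d p q r s : R) : a = 2 * c -> b = d -> c = p + q -> d = r + s ->
    p = r -> s = r -> a - b = 2 * q.
  by move=> -> -> -> -> -> ->; ring.
exact: (K _ _ _ _ _ _ _ _ e1 e2 e3 e4 e5 e6).
Qed.

Lemma sprayE z i : N z -> spray L i z = 2^-1 * Gam z.2 z.2 z 0 i.
Proof.
move=> Nz; rewrite /spray.
have -> : \sum_l invmx (gij L z) i l *
    (\sum_k 'D_(ex k) ('D_(ey l) L) z * z.2 0 k - 'D_(ex l) L z) =
    2 * \sum_l invmx (gij L z) i l * (gij L z *m (Gam z.2 z.2 z)^T) l 0.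
  rewrite mulr_sumr; apply: eq_bigr => l _.
  rewrite (spray_term l Nz) mulrCA; congr (2 * (_ * _)).
  rewrite /gform bil_deltal mxE; apply: eq_bigr => j _.
  by apply: (congr1 ( *%R _)); apply: esym; rewrite mxE.
have gu : gij L z \in unitmx by apply: posdef_unitmx => w; exact: gpos.
have -> : \sum_l invmx (gij L z) i l * (gij L z *m (Gam z.2 z.2 z)^T) l 0 =
    (invmx (gij L z) *m (gij L z *m (Gam z.2 z.2 z)^T)) i 0 by rewrite mxE.
by rewrite mulmxA mulVmx// mul1mx mxE mulrA; congr (_ * _); field.
Qed.

Lemma snd_diff z : differentiable (snd : E -> 'rV[R]_m) z.
Proof.
exact/(@linear_differentiable _ _ _ [the {linear E -> 'rV[R]_m} of snd])/continuous_sndE.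
Qed.

Lemma derive_snd z u : 'D_u (snd : E -> 'rV[R]_m) z = u.2.
Proof.
rewrite deriveE; last exact: snd_diff.
by rewrite (@diff_lin _ _ _ [the {linear E -> 'rV[R]_m} of snd])//; exact: continuous_sndE.
Qed.

Lemma Gamk_diff v w k z : N z -> differentiable (fun y => Gam v w y 0 k) z.
Proof. by move=> Nz; apply: differentiable_coordf; exact: Gam_diff. Qed.

Lemma Gamk_vertical v w c k z : N z -> 'D_(0, c) (fun y => Gam v w y 0 k) z = 0.
Proof.
by move=> Nz; rewrite -derive_coord ?Gam_vertical ?mxE//; exact: Gam_diff.
Qed.

(* As [gamma] has no vertical derivative, in [gamma v (f y) y] only [f] contributes. *)
Lemma derive_Gam_arg v (f : E -> 'rV[R]_m) c k z : N z ->
  differentiable f z ->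
  'D_(0, c) (fun y => Gam v (f y) y 0 k) z = Gam v ('D_(0, c) f z) z 0 k.
Proof.
move=> Nz df.
transitivity ('D_(0, c) (fun y => \sum_j f y 0 j * Gam v (delta_mx 0 j) y 0 k) z).
  by apply: (derive_eq_on _ oN Nz) => y /set_mem Ny; exact: Gam_expandrk.
rewrite (derive_dot _ df (h := fun j y => Gam v (delta_mx 0 j) y 0 k)); last first.
  by move=> j; exact: Gamk_diff.
rewrite [X in _ + X]big1 ?addr0 => [|j _]; last by rewrite Gamk_vertical ?mulr0.
by rewrite [RHS]Gam_expandrk.
Qed.

Lemma Gam_arg_diff v k z : N z -> differentiable (fun y => Gam v y.2 y 0 k) z.
Proof.
move=> Nz; have s : smooth_on N (fun y : E => \sum_j y.2 0 j * Gam v (delta_mx 0 j) y 0 k).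
  apply: smooth_on_sum => // j _; apply: smooth_onM => //.
    apply: smooth_on_coord => // n.
    apply: (@diffn_lin _ _ _ _ _ [the {linear E -> 'rV[R]_m} of snd]).
    exact: continuous_sndE.
  by apply: smooth_on_coord => //; exact: Gam_smooth.
apply: (differentiable_eq_on oN Nz _ (smooth_on_diff s Nz)).
by move=> y /set_mem Ny; exact: Gam_expandrk.
Qed.

Lemma Gam_quad_diff k z : N z -> differentiable (fun y => Gam y.2 y.2 y 0 k) z.
Proof.
move=> Nz.
have d : differentiable (\sum_i (fun y : E => y.2 0 i * Gam (delta_mx 0 i) y.2 y 0 k)) z.
  apply: differentiable_sum => i; apply: differentiableM; last exact: Gam_arg_diff.
  exact: differentiable_coordf (snd_diff z).
apply: (differentiable_eq_on oN Nz _ d) => y /set_mem Ny.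
by rewrite fct_sumE; exact: Gam_expandlk.
Qed.

(** Since Gamma is constant along the fibre, only the two occurrences of y are differentiated, and
    by symmetry they contribute equally. *)
Lemma derive_quad c k z : N z ->
  'D_(0, c) (fun y => Gam y.2 y.2 y 0 k) z = 2 * Gam c z.2 z 0 k.
Proof.
move=> Nz.
transitivity ('D_(0, c) (fun y : E => \sum_i y.2 0 i * Gam (delta_mx 0 i) y.2 y 0 k) z).
  by apply: (derive_eq_on _ oN Nz) => y /set_mem Ny; exact: Gam_expandlk.
rewrite (@derive_dot snd (fun i y => Gam (delta_mx 0 i) y.2 y 0 k)); last 2 first.
- exact: snd_diff.
- by move=> i; exact: Gam_arg_diff.
rewrite derive_snd/= -Gam_expandlk//.
have -> : \sum_i z.2 0 i * 'D_(0, c) (fun y => Gam (delta_mx 0 i) y.2 y 0 k) z =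
    Gam z.2 c z 0 k.
  rewrite [RHS]Gam_expandlk//; apply: eq_bigr => i _.
  by rewrite (derive_Gam_arg _ _ _ Nz (snd_diff z)) derive_snd.
by rewrite (HC z.2 c Nz) mulrC mulr_natr mulr2n.
Qed.

Lemma spray_vertical c k z : N z -> 'D_(0, c) (spray L k) z = Gam c z.2 z 0 k.
Proof.
move=> Nz; transitivity ('D_(0, c) (2^-1 *: (fun y => Gam y.2 y.2 y 0 k)) z).
  by apply: (derive_eq_on _ oN Nz) => y /set_mem Ny; exact: sprayE.
rewrite deriveZ; first by rewrite derive_quad// /GRing.scale/= mulKf.
apply: diff_derivable.
exact: Gam_quad_diff.
Qed.

Lemma spray_vertical2 c w k z : N z ->
  'D_(0, w) ('D_(0, c) (spray L k)) z = Gam c w z 0 k.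
Proof.
move=> Nz; transitivity ('D_(0, w) (fun y => Gam c y.2 y 0 k) z).
  by apply: (derive_eq_on _ oN Nz) => y /set_mem Ny; exact: spray_vertical.
by rewrite (derive_Gam_arg _ _ _ Nz (snd_diff z)) derive_snd.
Qed.

Lemma spray_horizontal u k z : N z ->
  'D_(u, 0) (spray L k) z = 2^-1 * 'D_(u, 0) (fun y => Gam z.2 z.2 y 0 k) z.
Proof.
move=> Nz; transitivity ('D_(u, 0) (2^-1 *: (fun y => Gam z.2 z.2 y 0 k)) z).
  apply: derive_line_eq; apply: filterS (near_line_N u Nz) => t Nt.
  by apply: (etrans (sprayE k Nt)); rewrite line_snd.
by rewrite deriveZ//; apply: diff_derivable; exact: Gamk_diff.
Qed.

Lemma spray_mixed u c k z : N z ->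
  'D_(u, 0) ('D_(0, c) (spray L k)) z = 'D_(u, 0) (fun y => Gam c z.2 y 0 k) z.
Proof.
move=> Nz; apply: derive_line_eq; apply: filterS (near_line_N u Nz) => t Nt.
by apply: (etrans (spray_vertical c k Nt)); rewrite line_snd.
Qed.

(* The vertical derivative of [HD]. *)
Lemma Gam_curvature v w c k z : N z ->
  - 'D_(v, 0) (fun y => Gam w c y 0 k) z + Gam w (Gam v c z) z 0 k =
  - 'D_(w, 0) (fun y => Gam v c y 0 k) z + Gam v (Gam w c z) z 0 k.
Proof.
move=> Nz.
have key v1 w1 : 'D_(0, c) (fun y => ('D_(v1, nu v1 y) (nu w1) y) 0 k) z =
    - 'D_(v1, 0) (fun y => Gam w1 c y 0 k) z + Gam w1 (Gam v1 c z) z 0 k.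
  have snk : smooth_on N (fun y => nu w1 y 0 k) by apply: smooth_on_coord.
  (* The derivative along a horizontal lift is split into its base part and its fibre part; the
     latter is [- Gam], evaluated at the fibre component of the lift. *)
  transitivity ('D_(0, c) ('D_(v1, 0) (fun y => nu w1 y 0 k)
      + (fun y => - Gam w1 (nu v1 y) y 0 k)) z).
    apply: (derive_eq_on _ oN Nz) => y /set_mem Ny.
    have -> : (v1, nu v1 y) = 1 *: (v1, 0) + (0, nu v1 y) :> E.
      by rewrite scale1r [RHS]surjective_pairing/= addr0 add0r.
    have dn := nu_diff w1 Ny.
    rewrite derive_linear// scale1r mxE derive_coord//.
    by apply: (congr1 (fun r => _ + r)); rewrite /gamma mxE opprK.
  have d1 : differentiable ('D_(v1, 0) (fun y => nu w1 y 0 k)) z.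
    exact: smooth_on_diff (smooth_on_derive _ snk) Nz.
  have d2 : differentiable (fun y => Gam w1 (nu v1 y) y 0 k) z.
    have s : smooth_on N (fun y => \sum_j nu v1 y 0 j * Gam w1 (delta_mx 0 j) y 0 k).
      apply: smooth_on_sum => // j _; apply: smooth_onM => //.
        by apply: smooth_on_coord.
      by apply: smooth_on_coord => //; exact: Gam_smooth.
    apply: (differentiable_eq_on oN Nz _ (smooth_on_diff s Nz)).
    by move=> y /set_mem Ny; exact: Gam_expandrk.
  rewrite deriveD; last 2 first.
  - exact: diff_derivable.
  - by apply: diff_derivable; exact: differentiableN.
  apply: (congr2 +%R).
    apply: (etrans (smooth_schwarz _ _ oN Nz snk)).
    transitivity ('D_(v1, 0) (- (fun y => Gam w1 c y 0 k)) z).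
      apply: (derive_eq_on _ oN Nz) => y /set_mem Ny.
      rewrite -derive_coord; last exact: nu_diff.
      by rewrite !fctE /gamma mxE opprK.
    by rewrite deriveN//; apply: diff_derivable; exact: Gamk_diff.
  transitivity ('D_(0, c) (- (fun y => Gam w1 (nu v1 y) y 0 k)) z) => //.
  rewrite deriveN; last exact: diff_derivable.
  rewrite (derive_Gam_arg _ _ _ Nz (nu_diff v1 Nz)).
  apply: esym; apply: (etrans (congr1 (fun x : 'rV[R]_m => x 0 k) (GamNr w1 _ Nz))).
  by rewrite mxE.
apply: (etrans (esym (key v w))); apply: (etrans _ (key w v)).
apply: (derive_eq_on _ oN Nz) => y /set_mem Ny.
exact: (congr1 (fun x : 'rV[R]_m => x 0 k) (HD v w Ny)).
Qed.

(** In terms of Gamma the entry (i, k) is the i-th component of d_k Gamma(y, y) - d_y Gamma(e_k, y)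
    + Gamma(e_k, Gamma(y, y)) - Gamma(y, Gamma(e_k, y)), with y frozen: the curvature of Gamma
    contracted twice with y. [Gam_curvature] makes it vanish. *)
Lemma riemann_curv0 z : N z -> riemann_curv L z = 0.
Proof.
have K (a b c d p q r s : R) : a = p -> b = q -> c = r -> d = s ->
    - p + s = - q + r -> a - b + c - d = 0.
  by move=> -> -> -> -> E; lra.
move=> Nz; apply/matrixP => i k; rewrite mxE [RHS]mxE.
set y := z.2.
have e1 : 2 * 'D_(ex k) (spray L i) z = 'D_(delta_mx 0 k, 0) (fun x => Gam y y x 0 i) z.
  by apply: (etrans (congr1 _ (spray_horizontal _ i Nz))); rewrite mulVKf.
have e2 : \sum_j z.2 0 j * 'D_(ex j) ('D_(ey k) (spray L i)) z =
    'D_(y, 0) (fun x => Gam (delta_mx 0 k) y x 0 i) z.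
  rewrite (vec_ex y) derivev_sum; last exact: Gamk_diff.
  by apply: eq_bigr => j _; apply: (congr1 (fun r => _ * r)); exact: spray_mixed.
have e3 : 2 * \sum_j spray L j z * 'D_(ey j) ('D_(ey k) (spray L i)) z =
    Gam (delta_mx 0 k) (Gam y y z) z 0 i.
  rewrite (Gam_expandrk _ _ _ Nz) mulr_sumr; apply: eq_bigr => j _.
  rewrite (sprayE j Nz) -mulrA mulVKf//.
  by apply: (congr1 (fun r => _ * r)); exact: spray_vertical2.
have e4 : \sum_j 'D_(ey j) (spray L i) z * 'D_(ey k) (spray L j) z =
    Gam y (Gam (delta_mx 0 k) y z) z 0 i.
  rewrite (Gam_expandrk _ _ _ Nz); apply: eq_bigr => j _; rewrite mulrC.
  apply: (congr2 *%R); first exact: spray_vertical.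
  by apply: (etrans (spray_vertical _ _ Nz)); exact: (congr1 (fun x : 'rV[R]_m => x 0 i) (HC _ _ Nz)).
have e5 := Gam_curvature (delta_mx 0 k) y y i Nz.
exact: (K _ _ _ _ _ _ _ _ e1 e2 e3 e4 e5).
Qed.

Lemma flag_curvature0 z w : N z -> flag_curvature L z w = 0.
Proof.
by move=> Nz; rewrite /flag_curvature riemann_curv0// trmx0 mulmx0 bil0l mul0r.
Qed.

End LocalFlatness.

(** * Cut-off frames, and Euler's relation for F^2 *)

Section Frames.
Context {R : realType} {m : nat} {M : topologicalType} {A : charts 'rV[R]_m M}.
Local Notation E := ('rV[R]_m * 'rV[R]_m)%type.
Context {M' : set (TM A)} {F : slit M' -> R}.
Hypothesis hF : finsler_manifold F.
Local Notation SA := (scharts M').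
Local Notation sdom a := (chart_dom (c := SA) a).
Local Notation sco a := (chart_coord (c := SA) a).
Local Notation fam' := (fam SA).
Local Notation "'L_' a" := (rep (A := SA) a (Fstar F)) (at level 8, a at level 2).
Implicit Types (a b c : idx A) (u q : slit M') (X Y Z : slit M' -> fam') (v w : 'rV[R]_m).
Local Notation manA := (finsler_man hF).
Local Notation slitM' := (finsler_slit hF).
Local Notation satlas := (slit_atlas manA slitM').
Local Notation tsec X := (section SA (tangent SA) X).
Local Notation vsec X := (section SA vertical X).

(** The set is the image of a compact set under the inverse chart, which is continuous because
    charts are open maps; compact sets are closed in the Hausdorff space [M]. *)
Lemma chart_closed a (K : set 'rV[R]_m) : compact K ->
  K `<=` chart_coord (c := A) a @` chart_dom (c := A) a ->
  closed [set p : M | chart_dom (c := A) a p /\ K (chart_coord (c := A) a p)].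
Proof.
move=> cK KU; have [hM _ _ cax _] := manA; have [oa _ ainj aopen] := cax a.
have [[u0 _] _ _ _] := slitM'.
pose psi (x : 'rV[R]_m) : M :=
  xget (base u0) [set p | chart_dom (c := A) a p /\ chart_coord (c := A) a p = x].
have psiK p : chart_dom (c := A) a p -> psi (chart_coord (c := A) a p) = p.
  move=> ap; rewrite /psi; case: xgetP => [r _ [ar]|/(_ p)]; last by case.
  by move/ainj => -> //; rewrite inE.
have -> : [set p : M | chart_dom (c := A) a p /\ K (chart_coord (c := A) a p)] = psi @` K.
  apply/seteqP; split=> [p [ap Kp]|_ [x Kx <-]]; first by exists (chart_coord (c := A) a p); rewrite ?psiK.
  by have [p ap px] := KU x Kx; rewrite -px psiK//= px.
apply: (compact_closed hM); apply: continuous_compact cK.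
apply: continuous_in_subspaceT => x; rewrite inE => Kx.
have [p ap <-] := KU x Kx; move=> P; rewrite psiK// => /= Pp.
have [ O [oO Op] OP] : exists2 O : set M, open_nbhs p O & O `<=` P.
  by move: Pp; rewrite nbhsE => -[ O ? ?]; exists O.
have oI : open (O `&` chart_dom (c := A) a) by exact: openI.
have oim := aopen _ oI (@subIsetr _ _ _).
apply: (filterS _ (open_nbhs_nbhs (conj oim _))); last by exists p.
by move=> _ [r [Or ar] <-]; rewrite /= psiK//; exact: OP.
Qed.

(* Connections act on global sections only, so local frames are cut off. A bump
   in the base coordinates suffices: the frames extend by 0 because the
   preimage of a compact set of coordinates is closed in the Hausdorff [M]. *)
Definition cutoff (bump : 'rV[R]_m -> R) a (W : slit M' -> fam') : slit M' -> fam' :=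
  fun u => if `[< sdom a u >] then bump (chart_coord (c := A) a (base_proj u)) *: W u else 0.

Lemma cutoff_section (bump : 'rV[R]_m -> R) (K : set 'rV[R]_m) a W :
  compact K -> K `<=` chart_coord (c := A) a @` chart_dom (c := A) a ->
  (forall x, ~ K x -> bump x = 0) -> smooth_on setT bump ->
  (forall u, sdom a u -> tangent SA u (W u)) ->
  smooth_on (img (A := SA) a) (rep (A := SA) a (fun u => W u a)) ->
  tsec (cutoff bump a W).
Proof.
move=> cK KU b0 sb tW sW.
apply: (smooth_section satlas bE) => u.
  rewrite /cutoff; case: asboolP => au; last exact: tangent0.
  exact: (tangentZ satlas _ (tW u au)).
have [au|au] := pselect (sdom a u).
  exists a, (img (A := SA) a),
    (fun z => bump z.1 *: rep (A := SA) a (fun u => W u a) z); split.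
  - exact: au.
  - exact: (simg_open hF (a := a)).
  - exact: (img_chart au).
  split=> [k|q aq _].
    apply: (diffnZ bE); [exact: (simg_open hF (a := a))| |exact: (sW k)].
    apply: (@diffn_comp _ _ _ _ (cbasis_rV m) cbasisR k _ setT fst bump) => //.
      exact: (simg_open hF (a := a)).
    apply: (@diffn_lin _ _ _ _ _ [the {linear E -> 'rV[R]_m} of fst]).
    exact: continuous_fstE.
  by rewrite /cutoff asboolT// (repE satlas).
(* Away from the chart domain, the point has a neighbourhood avoiding the closed set [KM], and there
   the cut-off section is identically 0. *)
have [hM _ _ cax _] := manA.
pose KM := [set p : M | chart_dom (c := A) a p /\ K (chart_coord (c := A) a p)].
have cKM : closed KM := chart_closed cK KU.
pose b := chart_at SA u; have bu : sdom b u := sdom_at manA slitM' u.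
have [ob _ binj bopen] := cax b.
have oI : open (~` KM `&` chart_dom (c := A) b) by apply: openI => //; exact: closed_openC.
have oim := bopen _ oI (@subIsetr _ _ _).
exists b, [set z : E | (chart_coord (c := A) b @` (~` KM `&` chart_dom (c := A) b)) z.1],
  (fun=> 0); split.
- exact: bu.
- by apply: (@open_comp _ _ fst _ _ oim) => z _; exact: continuous_fstE.
- by exists (base_proj u) => //; split=> // -[].
split=> [k|q bq [p [nKp bp] pq]]; first exact: diffn_cst.
have {}pq : p = base_proj q by apply: (binj p _) pq; rewrite inE.
rewrite /cutoff; case: asboolP => // aq.
rewrite b0 ?scale0r// => Kq; apply: nKp; rewrite pq; split=> //.
Qed.

(** The fibres of [M'] need not be cones, so homogeneity is only applied to the factors [1 + s] with
    [s] near 0, for which the scaled vector stays in [M']. Along this ray F^2 is [(1 + s) ^+ 2]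
    times its value at [z]. *)
Lemma Fstar_euler a (z : E) : img (A := SA) a z ->
  'D_(0, z.2) (L_ a) z = 2 * (L_ a) z.
Proof.
move=> [q aq zq]; subst z; set z := sco a q; set c := (L_ a) z.
have dL : differentiable (L_ a) (z + 0 *: (0, z.2)).
  rewrite scale0r addr0.
  exact: smooth_on_diff (L_smooth hF a) (img_chart aq).
have d1 := is_derive_line dL.
have d2 : is_derive (0 : R) (1 : R) (fun s : R => (1 + s) * (1 + s) * c) (2 * c).
  have dd : is_derive (0 : R) (1 : R) (fun s : R => 1 + s) 1.
    apply: (is_derive_eq (is_deriveD (is_derive_cst (1 : R) (0 : R) (1 : R)) (is_derive_id (0 : R) (1 : R)))).
    exact: add0r.
  have de := is_deriveM (is_deriveM dd dd) (is_derive_cst c (0 : R) (1 : R)).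
  apply: (is_derive_eq de); rewrite /GRing.scale/= /cst/=; ring.
have e : \forall s \near (0 : R), (1 + s) * (1 + s) * c = (L_ a) (z + s *: (0, z.2)).
  have n1 := near0_line (0, z.2) (open_nbhs_nbhs (conj (simg_open hF (a := a)) (img_chart aq))).
  have n2 : \forall s \near (0 : R), - 1 < s by apply: lt_nbhsr; rewrite ltrN10.
  apply: filterS2 n1 n2 => s [q' aq' zq'] s1.
  have zE : z + s *: (0, z.2) = s *: (0, z.2) + z :> E by rewrite addrC.
  have s0 : 0 < 1 + s by rewrite -ltrBlDl sub0r.
  rewrite zE -zq' /c /z !(repE satlas)//.
  have x1 : chart_coord (c := A) a (base_proj q') = chart_coord (c := A) a (base_proj q).
    by have /(congr1 fst) := zq'; rewrite /= scaler0 add0r.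
  have y1 : vec (sval q') a = (1 + s) *: vec (sval q) a.
    by have /(congr1 snd) := zq'; rewrite /= scalerDl scale1r addrC.
  have [_ inj _ _] := manifold_atlas manA.
  have bq : base_proj q' = base_proj q by apply: (inj a) x1; rewrite inE.
  (* Homogeneity is stated for the tangent vectors themselves, so proportionality in the one chart
     [a] has to be lifted to the whole family of components. *)
  have vq : vec (sval q') = (1 + s) *: vec (sval q).
    have t1 := vec_tangent (sval q'); have t2 := vec_tangent (sval q).
    rewrite -[base (sval q')]/(base_proj q') bq in t1.
    exact: (tangent_inj t1 (tangentZ (manifold_atlas manA) (1 + s) t2) aq y1).
  by case: hF => _ _ _ hom _; rewrite (hom q q' (1 + s) s0 bq vq) expr2.
have d3 := near_eq_is_derive e d2.
have := @derive_val _ _ _ _ _ _ _ d1.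
by rewrite (@derive_val _ _ _ _ _ _ _ d3) scale0r addr0 => <-.
Qed.

End Frames.

(** * The torsion evaluated on the cut-off frames *)

Section FlagCurvature.
Context {R : realType} {m : nat} {M : topologicalType} {A : charts 'rV[R]_m M}.
Local Notation E := ('rV[R]_m * 'rV[R]_m)%type.
Context {M' : set (TM A)} {F : slit M' -> R}.
Hypothesis hF : finsler_manifold F.
Local Notation SA := (scharts M').
Local Notation sdom a := (chart_dom (c := SA) a).
Local Notation sco a := (chart_coord (c := SA) a).
Local Notation fam' := (fam SA).
Implicit Types (u q : slit M') (W : slit M' -> fam') (v w c : 'rV[R]_m).
Local Notation manA := (finsler_man hF).
Local Notation slitM' := (finsler_slit hF).
Local Notation satlas := (slit_atlas manA slitM').
Local Notation tsec X := (section SA (tangent SA) X).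
Local Notation vsec X := (section SA vertical X).

Context {H : slit M' -> set fam'} {J : slit M' -> fam' -> fam'}.
Hypothesis hH : nonlinear_connection H.
Hypothesis hJ : associate_acs H J.
Context {nab : (slit M' -> fam') -> (slit M' -> fam') -> (slit M' -> fam')}.
Hypothesis lnab : linear_connection vertical nab.
Hypothesis mnab : metric_connection vertical (vmetric F) nab.
Local Notation D := (natural_connection H J nab).
Hypothesis hTD : forall X Y, tsec X -> tsec Y -> torsion D X Y = 0.

Variables (a : idx A) (bump : 'rV[R]_m -> R) (K V : set 'rV[R]_m).
Hypothesis cK : compact K.
Hypothesis KU : K `<=` chart_coord (c := A) a @` chart_dom (c := A) a.
Hypothesis bumpK : forall x, ~ K x -> bump x = 0.
Hypothesis bump_smooth : smooth_on setT bump.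
Hypothesis oV : open V.
Hypothesis bumpV : forall x, V x -> bump x = 1.
Local Notation L := (rep (A := SA) a (Fstar F)).

Definition hcoef v (z : E) : 'rV[R]_m :=
  \sum_i v 0 i *: (rep (A := SA) a (fun u => delta_x H a i u a) z).2.
Local Notation nu := hcoef.
Local Notation Gam := (gamma nu).
Local Notation g := (gform L).

Definition hframe v : slit M' -> fam' :=
  cutoff bump a (fun u => \sum_i v 0 i *: delta_x H a i u).
Definition vframe w : slit M' -> fam' :=
  cutoff bump a (fun u => \sum_i w 0 i *: partial_y a i u).
Local Notation X := hframe.
Local Notation Y := vframe.

(** On this set the bump is 1, so the frames have their uncut components and can be differentiated
    as such. *)
Definition flat_dom : set E := img (A := SA) a `&` [set z | V z.1].
Local Notation N := flat_dom.

Lemma flat_dom_open : open N.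
Proof.
apply: openI; first exact: (simg_open hF (a := a)).
by apply: (@open_comp _ _ fst V) => // z _; exact: continuous_fstE.
Qed.

Lemma flat_dom_img : N `<=` img (A := SA) a.
Proof. by move=> z []. Qed.

Lemma hcoef_smooth v : smooth_on N (nu v).
Proof.
apply: (smooth_on_sub flat_dom_img).
exact: (hlift_smooth hF hH (smooth_on_cst (img (A := SA) a) v)).
Qed.

Lemma hcoef_hlift v u : sdom a u -> nu v (sco a u) = hlift (H := H) a u v.
Proof. by move=> au; apply: eq_bigr => i _; rewrite (repE satlas). Qed.

Lemma hframe_tsec v : tsec (X v).
Proof.
have oa := simg_open hF (a := a).
apply: (cutoff_section hF cK KU bumpK bump_smooth) => [u au|].
  apply: (tangent_sum satlas) => i _; apply: (tangentZ satlas).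
  exact: (H_tangent hH (delta_x_H manA slitM' hH i au)).
have s := hlift_smooth hF hH (smooth_on_cst (img (A := SA) a) v).
apply: (rep_smooth satlas (smooth_on_pair oa (smooth_on_cst _ v) s)) => u au.
by rewrite (sum_delta_x manA slitM' hH v au) -(hcoef_hlift v au).
Qed.

Lemma vframe_tsec w : tsec (Y w).
Proof.
apply: (cutoff_section hF cK KU bumpK bump_smooth) => [u au|].
  apply: (tangent_sum satlas) => i _; apply: (tangentZ satlas).
  exact: (vertical_tangent (partial_y_vertical manA slitM' i au)).
apply: (rep_smooth satlas (smooth_on_cst _ ((0, w) : E))) => u au.
exact: (sum_partial_y manA slitM' w au).
Qed.

Lemma hframe_H v u : H u (X v u).
Proof.
rewrite /hframe /cutoff; case: asboolP => au; last by case: hH => _ /(_ u)[].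
apply: (H_scale hH); apply: (H_sum hH) => i _; apply: (H_scale hH).
exact: (delta_x_H manA slitM' hH i au).
Qed.

Lemma vframe_vertical w u : vertical u (Y w u).
Proof.
rewrite /vframe /cutoff; case: asboolP => au; last exact: (vertical0 manA slitM' u).
have tY : tangent SA u (\sum_i w 0 i *: partial_y a i u).
  apply: (tangent_sum satlas) => i _; apply: (tangentZ satlas).
  exact: (vertical_tangent (partial_y_vertical manA slitM' i au)).
apply/(verticalE manA slitM' _ au); split; first exact: (tangentZ satlas _ tY).
by rewrite famZ (sum_partial_y manA slitM' w au)/= scaler0.
Qed.

Lemma vframe_vsec w : vsec (Y w).
Proof. by split; [exact: vframe_vertical|case: (vframe_tsec w)]. Qed.

Lemma hframe_chart v u : sdom a u -> N (sco a u) ->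
  X v u a = (v, nu v (sco a u)).
Proof.
move=> au [_ Vu]; rewrite /hframe /cutoff asboolT// famZ.
by rewrite (sum_delta_x manA slitM' hH v au) bumpV// scale1r (hcoef_hlift v au).
Qed.

Lemma vframe_chart w u : sdom a u -> N (sco a u) -> Y w u a = (0, w).
Proof.
move=> au [_ Vu]; rewrite /vframe /cutoff asboolT// famZ.
by rewrite (sum_partial_y manA slitM' w au) bumpV// scale1r.
Qed.

Lemma rep_hframe v : {in N, rep (A := SA) a (fun u => X v u a) =1 (fun z => (v, nu v z))}.
Proof.
move=> z /set_mem Nz; have [[u au zu] _] := Nz; rewrite -zu in Nz *.
by rewrite (repE satlas)//; exact: hframe_chart.
Qed.

Lemma rep_vframe w : {in N, rep (A := SA) a (fun u => Y w u a) =1 (fun=> (0, w))}.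
Proof.
move=> z /set_mem Nz; have [[u au zu] _] := Nz; rewrite -zu in Nz *.
by rewrite (repE satlas)//; exact: vframe_chart.
Qed.

(** Both frames are cut off by the same scalar function, so the relation holds on all of [M'] and
    can be used under [nab]. *)
Lemma J_hframe v : bapp J (X v) = - Y v.
Proof.
apply/funext => u; rewrite /bapp -[(- Y v) u]/(- (Y v u)) /hframe /vframe /cutoff.
case: asboolP => au; last by rewrite oppr0; exact: (J0 hJ u).
have td i : tangent SA u (delta_x H a i u) := H_tangent hH (delta_x_H manA slitM' hH i au).
have ts : tangent SA u (\sum_i v 0 i *: delta_x H a i u).
  by apply: (tangent_sum satlas) => i _; exact: (tangentZ satlas _ (td i)).
apply: (etrans (JZ hJ _ ts)); rewrite -scalerN; apply: (congr1 (fun x => _ *: x)).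
apply: (etrans (J_sum manA slitM' hJ _ td)); rewrite -sumrN; apply: eq_bigr => i _.
by rewrite -scalerN; apply: (congr1 (fun x => _ *: x)); case: hJ => _ /(_ a u au i)[].
Qed.

Lemma hproj_hframe v : bapp (hproj H) (X v) = X v.
Proof. by apply/funext => u; exact: (hproj_H manA slitM' hH (hframe_H v u)). Qed.

Lemma vproj_hframe v : bapp (vproj H) (X v) = 0.
Proof.
apply/funext => u; rewrite /bapp /vproj (hproj_H manA slitM' hH (hframe_H v u)).
exact: subrr.
Qed.

Lemma hproj_vframe w : bapp (hproj H) (Y w) = 0.
Proof. by apply/funext => u; exact: (hproj_vertical hH (vframe_vertical w u)). Qed.

Lemma vproj_vframe w : bapp (vproj H) (Y w) = Y w.
Proof.
apply/funext => u; rewrite /bapp /vproj (hproj_vertical hH (vframe_vertical w u)).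
exact: subr0.
Qed.

Lemma J_zero : bapp J 0 = 0.
Proof. by apply/funext => u; exact: (J0 hJ u). Qed.

Lemma D_vframe W w : tsec W -> D W (Y w) = nab W (Y w).
Proof.
move=> sW; rewrite /natural_connection vproj_vframe hproj_vframe J_zero.
have n0 := nab0 hF lnab sW.
by rewrite n0 J_zero subr0.
Qed.

Lemma D_hframe W v u : tsec W -> D W (X v) u = J u (nab W (Y v) u).
Proof.
move=> sW; have n0 := nab0 hF lnab sW.
have nN := nabN hF lnab sW (vframe_vsec v).
rewrite /natural_connection vproj_hframe hproj_hframe J_hframe n0 nN sub0r.
have tn : tangent SA u (nab W (Y v) u).
  exact: (vertical_tangent (proj1 (nab_sec lnab sW (vframe_vsec v)) u)).
apply: (etrans (congr1 -%R (JN hJ tn))); exact: opprK.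
Qed.

Lemma nab_vertical W w u : tsec W -> vertical u (nab W (Y w) u).
Proof. by move=> sW; exact: (proj1 (nab_sec lnab sW (vframe_vsec w)) u). Qed.

Lemma J_vertical_chart u (x : fam') : sdom a u -> vertical u x ->
  J u x a = ((x a).2, hlift (H := H) a u (x a).2).
Proof.
move=> au vx; rewrite (J_chart manA slitM' hH hJ (vertical_tangent vx) au).
by rewrite (vertical_fst manA slitM' au vx) hlift0 !subr0.
Qed.

Lemma derive_hframe v (t z : E) : N z ->
  'D_t (rep (A := SA) a (fun q => X v q a)) z = (0, 'D_t (nu v) z).
Proof.
move=> Nz.
apply: (etrans (derive_eq_on _ flat_dom_open Nz (rep_hframe v))).
rewrite derive_pair; last 2 first.
- exact: differentiable_cst.
- exact: smooth_on_diff (hcoef_smooth v) Nz.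
by rewrite derive_cst.
Qed.

Lemma derive_vframe w (t z : E) : N z ->
  'D_t (rep (A := SA) a (fun q => Y w q a)) z = 0.
Proof.
move=> Nz; apply: (etrans (derive_eq_on _ flat_dom_open Nz (rep_vframe w))).
exact: derive_cst.
Qed.

Lemma bracket_mixed v w u : sdom a u -> N (sco a u) ->
  bracket (X v) (Y w) u a = (0, Gam v w (sco a u)).
Proof.
move=> au Nu; rewrite bracketE// derive_vframe// derive_hframe// sub0r.
by rewrite vframe_chart// [LHS]surjective_pairing/= oppr0.
Qed.

Lemma bracket_horizontal v w u : sdom a u -> N (sco a u) ->
  bracket (X v) (X w) u a = (0, 'D_(v, nu v (sco a u)) (nu w) (sco a u)
                              - 'D_(w, nu w (sco a u)) (nu v) (sco a u)).
Proof.
move=> au Nu; rewrite (bracketE _ _ au) (derive_hframe v _ Nu) (derive_hframe w _ Nu).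
rewrite (hframe_chart v au Nu) (hframe_chart w au Nu).
by apply: (etrans (surjective_pairing _)); rewrite /= subr0.
Qed.

(** The bracket is vertical with fibre component [Gam v w], and it equals the vertical vector
    [nab (X v) (Y w)] minus the horizontal vector [J (nab (Y w) (Y v))]. The base component yields
    the first equation, and the fibre component then yields the second. *)
Lemma torsion_mixed v w u : sdom a u -> N (sco a u) ->
  (nab (Y w) (Y v) u a).2 = 0 /\ (nab (X v) (Y w) u a).2 = Gam v w (sco a u).
Proof.
move=> au Nu; have sX := hframe_tsec v; have sY := vframe_tsec w.
have e := bracket_D hTD u sX sY.
have e1 := congr1 (fun f => f u) (D_vframe w sX).
have e2 := D_hframe v u sY.
have v1 := nab_vertical w u sX; have v2 := nab_vertical v u sY.
have {}e : bracket (X v) (Y w) u = nab (X v) (Y w) u - J u (nab (Y w) (Y v) u).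
  exact: (etrans e (congr2 (fun p q : fam' => p - q) e1 e2)).
have := congr1 (fun f : fam' => f a) e.
rewrite /= (bracket_mixed v w au Nu) famD famN (J_vertical_chart au v2).
move: (vertical_fst manA slitM' au v1).
case: (nab (X v) (Y w) u a) => p1 p2 /= ->.
move: (nab (Y w) (Y v) u a).2 => r [/esym/eqP]; rewrite sub0r oppr_eq0 => /eqP -> ->.
by rewrite hlift0 subr0.
Qed.

(** Both derivatives in the torsion are [J] of a vertical vector, that is, horizontal lifts of
    [Gam v w] and [Gam w v]. The bracket has base component 0, so these agree; then the lifts agree
    and the bracket is 0. *)
Lemma torsion_horizontal v w u : sdom a u -> N (sco a u) ->
  Gam v w (sco a u) = Gam w v (sco a u) /\
  'D_(v, nu v (sco a u)) (nu w) (sco a u) = 'D_(w, nu w (sco a u)) (nu v) (sco a u).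
Proof.
move=> au Nu; have sX := hframe_tsec v; have sX' := hframe_tsec w.
have v1 := nab_vertical w u sX; have v2 := nab_vertical v u sX'.
have e : bracket (X v) (X w) u = J u (nab (X v) (Y w) u) - J u (nab (X w) (Y v) u).
  apply: (etrans (bracket_D hTD u sX sX')).
  exact: (congr2 (fun p q : fam' => p - q) (D_hframe w u sX) (D_hframe v u sX')).
have := congr1 (fun f : fam' => f a) e.
rewrite /= (bracket_horizontal v w au Nu) famD famN.
rewrite (J_vertical_chart au v1) (J_vertical_chart au v2).
have [_ e1] := torsion_mixed v w au Nu; have [_ e2] := torsion_mixed w v au Nu.
rewrite e1 e2 => -[/esym/eqP]; rewrite subr_eq0 => /eqP e3.
rewrite e3 subrr => /eqP; rewrite subr_eq0 => /eqP e4.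
by split.
Qed.

Lemma vmetric_frame v w u : sdom a u -> N (sco a u) ->
  vmetric F u (Y v u) (Y w u) = g v w (sco a u).
Proof.
move=> au Nu; rewrite (vmetricE hF au (vframe_vertical v u) (vframe_vertical w u)).
by rewrite !vframe_chart.
Qed.

Lemma act_vmetric W v w u : tsec W -> sdom a u -> N (sco a u) ->
  act W (fun q => vmetric F q (Y v q) (Y w q)) u = 'D_(W u a) (g v w) (sco a u).
Proof.
move=> sW au Nu.
apply: (etrans (actE satlas (vmetric_smooth hF (vframe_vsec v) (vframe_vsec w))
  (proj1 sW u) au)).
apply: (derive_eq_on _ flat_dom_open Nu) => z /set_mem Nz.
have [[q aq zq] _] := Nz; rewrite -zq in Nz *.
by rewrite (repE satlas)//; exact: vmetric_frame.
Qed.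

Lemma nab_metric W v w u : tsec W -> sdom a u -> N (sco a u) ->
  'D_(W u a) (g v w) (sco a u) =
  g (nab W (Y v) u a).2 w (sco a u) + g v (nab W (Y w) u a).2 (sco a u).
Proof.
move=> sW au Nu; apply: (etrans (esym (act_vmetric v w sW au Nu))).
apply: (etrans (mnab sW (vframe_vsec v) (vframe_vsec w) u)).
apply: (congr2 +%R).
  apply: (etrans (vmetricE hF au (nab_vertical v u sW) (vframe_vertical w u))).
  by rewrite vframe_chart.
apply: (etrans (vmetricE hF au (vframe_vertical v u) (nab_vertical w u sW))).
by rewrite vframe_chart.
Qed.

Lemma frame_flag_curvature u w : sdom a u -> V (chart_coord (c := A) a (base_proj u)) ->
  flag_curvature L (sco a u) w = 0.
Proof.
move=> au Vu; have oN := flat_dom_open.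
have sL : smooth_on N L := smooth_on_sub flat_dom_img (L_smooth hF a).
(* Metricity along the vertical frame, where [torsion_mixed] makes both covariant derivatives
   vanish. *)
have HA z v1 v2 c : N z -> 'D_(0, c) (g v1 v2) z = 0.
  move=> Nz; have [[q aq zq] _] := Nz; rewrite -zq in Nz *.
  have := nab_metric v1 v2 (vframe_tsec c) aq Nz; rewrite vframe_chart// => ->.
  have [e1 _] := torsion_mixed v1 c aq Nz; have [e2 _] := torsion_mixed v2 c aq Nz.
  by rewrite e1 e2 /gform bil0l (bilC _ _ (gij_sym oN Nz sL)) bil0l addr0.
apply: (@flag_curvature0 _ _ N L nu oN sL hcoef_smooth).
- move=> z v Nz v0; have [[q aq zq] _] := Nz; rewrite -zq.
  exact: (gmx_pos hF aq v0).
- by move=> z Nz; apply: (Fstar_euler hF); exact: flat_dom_img.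
- exact: HA.
- move=> z v w1 w2 Nz; have [[q aq zq] _] := Nz; rewrite -zq in Nz *.
  have := nab_metric w1 w2 (hframe_tsec v) aq Nz; rewrite hframe_chart//.
  have [_ e1] := torsion_mixed v w1 aq Nz; have [_ e2] := torsion_mixed v w2 aq Nz.
  rewrite e1 e2 => <-.
  (* Metricity differentiates along the full horizontal lift; its fibre part contributes 0 by
     [HA]. *)
  have -> : (v, nu v (sco a q)) = 1 *: (v, 0) + (0, nu v (sco a q)) :> E.
    by rewrite scale1r [RHS]surjective_pairing/= addr0 add0r.
  rewrite derive_linear; last exact: (g_diff oN sL).
  by rewrite HA// addr0 scale1r.
- move=> z v w1 Nz; have [[q aq zq] _] := Nz; rewrite -zq in Nz *.
  by have [] := torsion_horizontal v w1 aq Nz.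
- move=> z v w1 Nz; have [[q aq zq] _] := Nz; rewrite -zq in Nz *.
  by have [] := torsion_horizontal v w1 aq Nz.
- by split; [exists u|].
Qed.

End FlagCurvature.

Theorem corollary3 (R : realType) (m : nat) (M : topologicalType)
    (A : charts 'rV[R]_m M) (M' : set (TM A)) (F : slit M' -> R)
    (H : slit M' -> set (fam (scharts M')))
    (J : slit M' -> fam (scharts M') -> fam (scharts M'))
    (S T nab : (slit M' -> fam (scharts M')) -> (slit M' -> fam (scharts M')) ->
               (slit M' -> fam (scharts M')))
    (hF : finsler_manifold F)
    (hH : nonlinear_connection H)
    (hJ : associate_acs H J)
    (hS : skew_tensor S) (hT : skew_tensor T)
    (hnab : cartan_connection F H J S T nab)
    (hTD : forall X Y, section (scharts M') (tangent (scharts M')) X ->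
       section (scharts M') (tangent (scharts M')) Y ->
       torsion (natural_connection H J nab) X Y = 0%R) :
  [/\ zero_flag_curvature F,
      integrable_acs J,
      forall nab', levi_civita (sasaki F H) nab' -> parallel nab' J &
      kahlerian J (sasaki F H)].
Proof.
have [lnab mnab _ _] := hnab; split.
- move=> a u au w _.
  have oU : open (chart_coord (c := A) a @` chart_dom (c := A) a).
    exact: (img_open (manifold_atlas (finsler_man hF))).
  have Uu : (chart_coord (c := A) a @` chart_dom (c := A) a)
      (chart_coord (c := A) a (base_proj u)) by exists (base_proj u).
  (* The curvature at [u] is local, so a bump around the coordinates of its base point suffices. *)
  have [b [K [[cK KU] bK sb [V [oV Vu bV]]]]] := exists_smooth_bump oU Uu.
  exact: (frame_flag_curvature hF hH hJ lnab mnab hTD cK KU bK sb oV bV).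
- exact: (J_integrable hF hH hJ lnab hTD).
- by move=> nab'; exact: (levi_civita_parallel hF hH hJ lnab mnab hTD).
- exact: (kahler_J hF hH hJ lnab mnab hTD).
Qed.
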